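(* Let $X$ be a complex Banach space, $L$ a complex solvable Lie algebra of finite dimension $n$, and $\rho\colon L\to\mathrm{L}(X)$ a representation of $L$ in $X$. Then the sets $sp_e(\rho)$, $sp_{\delta,k,e}(\rho)$ and $sp_{\pi,k,e}(\rho)$, $0\le k\le n$, are compact non-void subsets of $L^*$ that have the projection property: denoting by $S(\rho)$ any one of these sets, for every ideal $I$ of $L$, and, if $L$ is nilpotent, for every subalgebra $I$ of $L$, $\pi(S(\rho))=S(\rho|_I)$, where $\pi\colon L^*\to I^*$ is the restriction map.
   Context: Koszul complex. Let $X$ be a complex Banach space, $\mathrm{L}(X)$ the bounded linear operators on $X$ with Lie bracket $[S,T]=ST-TS$, and $L$ a complex solvable Lie algebra of finite dimension $n$ with dual space $L^*$. A representation $\rho\colon L\to\mathrm{L}(X)$ is a Lie algebra morphism. A character of $L$ is $f\in L^*$ with $f([L,L])=0$; $\rho-f$ denotes the representation $l\mapsto\rho(l)-f(l)I$. The Koszul complex $(X\otimes\wedge L,d(\rho))$ has spaces $X\otimes\wedge^pL$ (zero for $p<0$ or $p>n$) and differentials $d_p(\rho)\colon X\otimes\wedge^pL\to X\otimes\wedge^{p-1}L$, $$d_p(\rho)(x\otimes\langle l_1\wedge\dots\wedge l_p\rangle)=\sum_{k=1}^p(-1)^{k+1}\rho(l_k)(x)\otimes\langle l_1\wedge\dots\wedge\hat{l_k}\wedge\dots\wedge l_p\rangle+\sum_{1\le i<j\le p}(-1)^{i+j-1}x\otimes\langle[l_i,l_j]\wedge l_1\wedge\dots\wedge\hat{l_i}\wedge\dots\wedge\hat{l_j}\wedge\dots\wedge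 l_p\rangle,$$ where $\hat{\ }$ means deletion. Essential split spectra. A complex of Banach spaces $(X_p,d_p)$, $d_p\colon X_p\to X_{p-1}$, is Fredholm split in degree $p$ if there are bounded operators $h_p\colon X_p\to X_{p+1}$, $h_{p-1}\colon X_{p-1}\to X_p$ and a compact operator $k_p$ on $X_p$ with $d_{p+1}h_p+h_{p-1}d_p=I-k_p$ on $X_p$. $sp_{p,e}(\rho)$ is the set of characters $f$ of $L$ such that $(X\otimes\wedge L,d(\rho-f))$ is not Fredholm split in degree $p$. For $k\ge0$, $sp_{\delta,k,e}(\rho)=\bigcup_{p=0}^ksp_{p,e}(\rho)$, $sp_{\pi,k,e}(\rho)=\bigcup_{p=n-k}^nsp_{p,e}(\rho)$, $sp_e(\rho)=\bigcup_{p=0}^nsp_{p,e}(\rho)$. $\rho|_I\colon I\to\mathrm{L}(X)$ is the restriction of $\rho$ to $I$, whose spectra are computed with the Koszul complex $X\otimes\wedge I$ and with $\dim I$ in place of $n$.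
   Formalization: Non-voidness is claimed only for infinite-dimensional X: if X is finite-dimensional every operator is compact, so all these essential spectra are empty. Compactness and the projection property are stated for every complex Banach space X. *)

(* Defs.v *)
From HB Require Import structures.
From mathcomp Require Import all_boot all_order all_algebra complex.
From mathcomp Require Import all_classical all_reals all_analysis.

Set Implicit Arguments.
Unset Strict Implicit.
Unset Printing Implicit Defensive.

Import Order.TTheory GRing.Theory Num.Theory.
Import numFieldNormedType.Exports.

Local Open Scope classical_set_scope.
Local Open Scope ring_scope.

HB.mixin Record Vector_isLie (K : fieldType) L & Vector K L := {
  lieb : L -> L -> L;
  lieb_linearl : forall z, linear (fun x => lieb x z);
  lieb_linearr : forall z, linear (lieb z);
  liebb : forall x, lieb x x = 0;
  lieb_jacobi : forall x y z,
    lieb x (lieb y z) + lieb y (lieb z x) + lieb z (lieb x y) = 0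
}.

#[short(type="lieAlgType")]
HB.structure Definition LieAlgebra (K : fieldType) :=
  {L of Vector_isLie K L & Vector K L}.

Section LieTheory.
Variables (K : fieldType) (L : lieAlgType K).
Implicit Types (U V : {vspace L}).

(* The span of the brackets [u, v], u in U, v in V; by bilinearity it is
   enough to let u and v range over bases (see lieprod_subP). *)
Definition lieprod U V : {vspace L} :=
  <<[seq lieb u v | u <- vbasis U, v <- vbasis V]>>%VS.

Lemma lieprod_subP U V (W : {vspace L}) :
  reflect (forall u v, u \in U -> v \in V -> lieb u v \in W)
          (lieprod U V <= W)%VS.
Proof.
apply: (iffP idP) => [sW u v uU vV|sW]; last first.
  by apply/span_subvP => _ /allpairsP[[u v] [/= uU vV ->]];
     apply: sW; apply: vbasis_mem.
apply: (subvP sW).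
pose lr := GRing.isLinear.Build _ _ _ _ _ (lieb_linearr u).
pose fr : {linear L -> L} := HB.pack (lieb u) lr.
rewrite (coord_vbasis vV) -[lieb u _]/(fr _) linear_sum.
apply: memv_suml => j _; rewrite linearZ /=; apply: memvZ.
pose ll := GRing.isLinear.Build _ _ _ _ _ (lieb_linearl (vbasis V)`_j).
pose fl : {linear L -> L} := HB.pack (lieb^~ (vbasis V)`_j) ll.
rewrite (coord_vbasis uU) -[lieb _ _]/(fl _) linear_sum.
apply: memv_suml => i _; rewrite linearZ /=; apply: memvZ.
by apply: memv_span; apply: allpairs_f; apply: mem_nth; rewrite size_tuple.
Qed.

Definition lie_solvable : Prop :=
  exists m, iter m (fun U => lieprod U U) {:L}%VS = 0%VS.

Definition lie_nilpotent : Prop := exists m, iter m (lieprod {:L}) {:L}%VS = 0%VS.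

Record lie_subalg := LieSubalg {
  lsval :> {vspace L};
  lie_subalgP : {in lsval &, forall x y, lieb x y \in lsval} }.

Definition is_lie_ideal U : Prop := forall x y, y \in U -> lieb x y \in U.

Definition character (f : 'Hom(L, K^o)) : Prop := forall x y, f (lieb x y) = 0.

End LieTheory.

Arguments lie_solvable {K} L.
Arguments lie_nilpotent {K} L.

Section SubLie.
Variables (K : fieldType) (L : lieAlgType K) (I : lie_subalg L).

Definition subvs_lieb (u v : subvs_of I) : subvs_of I :=
  Subvs (lie_subalgP (subvsP u) (subvsP v)).

Fact subvs_lieb_linearl z : linear (fun x => subvs_lieb x z).
Proof. by move=> a x y; apply/val_inj/lieb_linearl. Qed.
Fact subvs_lieb_linearr z : linear (subvs_lieb z).
Proof. by move=> a x y; apply/val_inj/lieb_linearr. Qed.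
Fact subvs_liebb x : subvs_lieb x x = 0.
Proof. exact/val_inj/liebb. Qed.
Fact subvs_lieb_jacobi x y z : subvs_lieb x (subvs_lieb y z) +
  subvs_lieb y (subvs_lieb z x) + subvs_lieb z (subvs_lieb x y) = 0.
Proof. exact/val_inj/lieb_jacobi. Qed.

HB.instance Definition _ := Vector_isLie.Build K (subvs_of I)
  subvs_lieb_linearl subvs_lieb_linearr subvs_liebb subvs_lieb_jacobi.

Definition dual_restrict (f : 'Hom(L, K^o)) : 'Hom(subvs_of I, K^o) :=
  (f \o linfun vsval)%VF.

End SubLie.

(* The dual of a finite-dimensional space is normed by the l^1 norm of the
   coordinates; all norms on it define the same topology. *)
Section DualNorm.
Variables (K : numFieldType) (L : vectType K).
Implicit Types f g : 'Hom(L, K^o).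

Definition dual_norm f : K := \sum_(e <- vbasis {:L}) `|f e|.

Fact dual_normD f g : dual_norm (f + g) <= dual_norm f + dual_norm g.
Proof.
by rewrite -big_split; apply: ler_sum => e _; rewrite add_lfunE ler_normD.
Qed.

Fact dual_normZ a f : dual_norm (a *: f) = `|a| * dual_norm f.
Proof.
by rewrite mulr_sumr; apply: eq_bigr => e _; rewrite scale_lfunE normrZ.
Qed.

Fact dual_norm0_eq0 f : dual_norm f = 0 -> f = 0.
Proof.
move=> /eqP; rewrite psumr_eq0 // => /allP f0.
apply/lfunP => v; rewrite lfunE /= (coord_vbasis (memvf v)) linear_sum.
rewrite big1 // => i _; rewrite linearZ /=.
have : (vbasis {:L})`_i \in vbasis {:L} by rewrite mem_nth // size_tuple.
by move=> /f0 /=; rewrite normr_eq0 => /eqP ->; rewrite scaler0.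
Qed.

HB.instance Definition _ := Lmodule_isNormed.Build K 'Hom(L, K^o)
  dual_normD dual_normZ dual_norm0_eq0.

End DualNorm.

(* Finite direct sums of copies of X. *)
Section FfunNorm.
Variables (K : numFieldType) (T : finType) (X : normedModType K).
Implicit Types u v : {ffun T -> X}.

Definition ffun_norm u : K := \sum_t `|u t|.

Fact ffun_normD u v : ffun_norm (u + v) <= ffun_norm u + ffun_norm v.
Proof.
by rewrite -big_split; apply: ler_sum => t _; rewrite ffunE ler_normD.
Qed.

Fact ffun_normZ a u : ffun_norm (a *: u) = `|a| * ffun_norm u.
Proof. by rewrite mulr_sumr; apply: eq_bigr => t _; rewrite ffunE normrZ. Qed.

Fact ffun_norm0_eq0 u : ffun_norm u = 0 -> u = 0.
Proof.
move=> /eqP; rewrite psumr_eq0 // => /allP u0; apply/ffunP => t.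
by have /= := u0 t (mem_index_enum t); rewrite normr_eq0 ffunE => /eqP.
Qed.

HB.instance Definition _ := Lmodule_isNormed.Build K {ffun T -> X}
  ffun_normD ffun_normZ ffun_norm0_eq0.

End FfunNorm.

Section FfunComplete.
Variables (K : numFieldType) (T : finType) (X : completeNormedModType K).

Fact ffun_complete (F : set_system {ffun T -> X}) :
  ProperFilter F -> cauchy F -> cvg F.
Proof.
move=> FF /cauchyP Fc.
have coord_le (u : {ffun T -> X}) t : `|u t| <= `|u|.
  by rewrite [leRHS](bigD1 t) //= lerDl sumr_ge0.
have Ft t : cvg ((fun u : {ffun T -> X} => u t) @ F).
  apply: cauchy_cvg; apply/cauchyP => e e0.
  have [u Fu] := Fc e e0; exists (u t).
  apply: (@filterS _ F _ (ball u e)) Fu => v.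
  rewrite -!ball_normE /=; apply: le_lt_trans.
  by have := coord_le (u - v) t; rewrite !ffunE.
pose l : {ffun T -> X} := [ffun t => lim ((fun u : {ffun T -> X} => u t) @ F)].
apply/cvg_ex; exists l; apply/cvgrPdist_lt => e e0.
pose d := e / (#|T|.+1)%:R.
have d0 : 0 < d by rewrite divr_gt0.
have Fd : F [set u | forall t, `|l t - u t| < d].
  apply: filter_forall => t; rewrite ffunE.
  by have /cvgrPdist_lt := Ft t; exact.
apply: filterS Fd => u ud.
apply: (@le_lt_trans _ _ (\sum_(t : T) d)).
  by apply: ler_sum => t _; rewrite !ffunE ltW //; have := ud t; rewrite ffunE.
rewrite sumr_const -mulr_natr /d mulrAC -mulrA -ltr_pdivlMl //.
by rewrite mulVf ?gt_eqF // ltr_pdivrMr // mul1r ltr_nat.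
Qed.

HB.instance Definition _ := Uniform_isComplete.Build {ffun T -> X} ffun_complete.

End FfunComplete.

Section Operators.
Variable K : numFieldType.

Definition compact_op (U V : normedModType K) (k : U -> V) : Prop :=
  precompact (k @` [set x | `|x| <= 1]).

(* U --d1--> V --d0--> W are the terms of degrees p + 1, p and p - 1 of a
   complex; the property is to be Fredholm split at V. *)
Definition fredholm_split (U V W : normedModType K)
    (d1 : U -> V) (d0 : V -> W) : Prop :=
  exists (h : {linear V -> U}) (h' : {linear W -> V}) (k : {linear V -> V}),
    [/\ continuous h, continuous h', continuous k, compact_op k &
        forall v, d1 (h v) + h' (d0 v) = v - k v].

(* If X is finite-dimensional, every operator on X is compact, hence every
   complex of finite sums of copies of X is Fredholm split and all the
   essential spectra below are empty. *)
Definition finite_dimensional (X : lmodType K) : Prop :=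
  exists (m : nat) (e : 'I_m -> X),
    forall x, exists a : 'I_m -> K, x = \sum_i a i *: e i.

End Operators.

Section Representation.
Variables (K : numFieldType) (L : lieAlgType K) (X : normedModType K).

Record representation := Representation {
  rep_op :> L -> X -> X;
  rep_op_linear : forall l, linear (rep_op l);
  rep_op_continuous : forall l, continuous (rep_op l);
  rep_linear : forall x, linear (rep_op^~ x);
  rep_lieb : forall l m x,
    rep_op (lieb l m) x = rep_op l (rep_op m x) - rep_op m (rep_op l x) }.

End Representation.

Section Restriction.
Variables (K : numFieldType) (L : lieAlgType K) (X : normedModType K).
Variables (rho : representation L X) (I : lie_subalg L).

Definition rep_restrict : representation (subvs_of I) X.
Proof.
exists (fun u => rho (vsval u)).
- by move=> l; exact: rep_op_linear.
- by move=> l; exact: rep_op_continuous.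
- by move=> x a u v; rewrite linearP; exact: rep_linear.
- by move=> u v x; exact: rep_lieb.
Defined.

End Restriction.

Section Koszul.
Variables (K : numFieldType) (L : lieAlgType K) (X : normedModType K).

Let n := \dim {:L}.
Let b := vbasis {:L}.

(* X (x) /\^p L: with e_0, ..., e_(n-1) the basis vbasis {:L}, the coordinate
   at A = {i_1 < ... < i_p} is the coefficient in X of e_(i_1) /\ ... /\
   e_(i_p). The space is zero unless 0 <= p <= n. *)
Definition subsets (p : int) := {A : {set 'I_n} | #|A|%:Z == p}.
HB.instance Definition _ p := SubFinite.on (subsets p).

Definition koszul_space (p : int) : Type := {ffun subsets p -> X}.

HB.instance Definition _ p := NormedModule.on (koszul_space p).

(* x (x) <l_1 /\ ... /\ l_p>, for l of size p; its coordinate at A is the minor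
   on the columns A of the matrix of coordinates of l. *)
Definition ktensor (p : int) (x : X) (l : seq L) : koszul_space p :=
  [ffun A : subsets p => \det (\matrix_(r < #|val A|, c < #|val A|)
                     coord b (enum_val c) l`_r) *: x].

Definition basis_seq (A : {set 'I_n}) : seq L := [seq b`_i | i : 'I_n <- enum A].

Lemma coord_basis_seq (A : {set 'I_n}) (r : 'I_#|A|) (i : 'I_n) :
  coord b i (basis_seq A)`_r = (i == enum_val r)%:R.
Proof.
have i0 : 'I_n := i.
rewrite (nth_map i0) -?cardE // -enum_val_nth.
by rewrite coord_free ?(basis_free (vbasisP _)) // eq_sym.
Qed.

Lemma ktensor_basis p x (A B : subsets p) :
  ktensor p x (basis_seq (val A)) B = if A == B then x else 0.
Proof.
rewrite ffunE; case: eqP => [->|/eqP nAB].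
  rewrite [X in \det X](_ : _ = 1%:M) ?det1 ?scale1r //.
  apply/matrixP => r c; rewrite !mxE coord_basis_seq.
  by rewrite (inj_eq enum_val_inj) eq_sym.
have cAB : #|val A| = #|val B|.
  have: #|val A|%:Z = #|val B|%:Z by rewrite (eqP (valP A)) (eqP (valP B)).
  by case.
have [i iB iNA] : exists2 i, i \in val B & i \notin val A.
  apply/subsetPn; apply: contra nAB => sBA.
  by rewrite -val_eqE eq_sym eqEcard sBA cAB leqnn.
set M := (\matrix_(r, c) _).
have -> : \det M = 0; last by rewrite scale0r.
rewrite (expand_det_col M (enum_rank_in iB i)) big1 // => r _.
rewrite mxE enum_rankK_in //.
have rA : (r < #|val A|)%N by rewrite cAB.
rewrite (coord_basis_seq (Ordinal rA)).
have /negPf -> : i != enum_val (Ordinal rA); last by rewrite mul0r.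
by apply: contra iNA => /eqP ->; exact: enum_valP.
Qed.

(* Hence ktensor p x l, for l in basis order, is the expected generator and
   koszul_d below is the linear extension of koszul_formula. *)
Lemma koszul_space_decomp p (u : koszul_space p) :
  u = \sum_A ktensor p (u A) (basis_seq (val A)).
Proof.
apply/ffunP => B; rewrite sum_ffunE (bigD1 B) //= ktensor_basis eqxx.
by rewrite big1 ?addr0 // => A /negPf nAB; rewrite ktensor_basis nAB.
Qed.

Definition delete (k : nat) (l : seq L) : seq L := take k l ++ drop k.+1 l.

(* The right-hand side of the formula for d_p(x (x) <l_1 /\ ... /\ l_p>); indices
   start at 0, so that the signs (-1)^(k+1) and (-1)^(i+j-1) of the
   formula indexed from 1 become (-1)^k and (-1)^(i+j+1). *)
Definition koszul_formula (q : int) (rho : L -> X -> X) (x : X) (l : seq L) :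
    koszul_space q :=
  \sum_(k < size l) (-1) ^+ k *: ktensor q (rho l`_k x) (delete k l)
  + \sum_(j < size l) \sum_(i < j)
      (-1) ^+ (i + j + 1) *:
        ktensor q x (lieb l`_i l`_j :: delete i (delete j l)).

(* The differential d_p, for q = p - 1. The target degree q is a separate
   argument so that d_(p+1) and d_p can be composed without a type cast. *)
Definition koszul_d (p q : int) (rho : L -> X -> X) (u : koszul_space p) :
    koszul_space q :=
  \sum_A koszul_formula q rho (u A) (basis_seq (val A)).

Definition koszul_fredholm_split (p : int) (rho : L -> X -> X) : Prop :=
  fredholm_split (@koszul_d (p + 1) p rho) (@koszul_d p (p - 1) rho).

End Koszul.

Section EssentialSplitSpectra.
Variables (K : numFieldType) (X : normedModType K).
Implicit Types (L : lieAlgType K) (k : nat).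

Definition sp_pe (p : int) L (rho : representation L X) : set 'Hom(L, K^o) :=
  [set f | character f /\
     ~ koszul_fredholm_split p (fun l x => rho l x - f l *: x)].

Definition sp_delta_e k L (rho : representation L X) : set 'Hom(L, K^o) :=
  \bigcup_(p in [set p : int | 0 <= p <= k%:Z]) sp_pe p rho.

Definition sp_pi_e k L (rho : representation L X) : set 'Hom(L, K^o) :=
  \bigcup_(p in [set p : int | (\dim {:L})%:Z - k%:Z <= p <= (\dim {:L})%:Z])
    sp_pe p rho.

Definition sp_e L (rho : representation L X) : set 'Hom(L, K^o) :=
  \bigcup_(p in [set p : int | 0 <= p <= (\dim {:L})%:Z]) sp_pe p rho.

Definition projection_property
    (S : forall L, representation L X -> set 'Hom(L, K^o))
    L (rho : representation L X) : Prop :=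
  forall I : lie_subalg L, is_lie_ideal I \/ lie_nilpotent L ->
    @dual_restrict K L I @` S L rho = S (subvs_of I) (rep_restrict rho I).

End EssentialSplitSpectra.

Arguments sp_e {K X} L rho.
Arguments sp_delta_e {K X} k L rho.
Arguments sp_pi_e {K X} k L rho.

(* Main.v *)
Require Import Defs.
From HB Require Import structures.
From mathcomp Require Import all_boot all_order all_algebra complex.
From mathcomp Require Import all_classical all_reals all_analysis.
From mathcomp Require Import ring lra zify.

Set Implicit Arguments.
Unset Strict Implicit.
Unset Printing Implicit Defensive.

Import Order.TTheory GRing.Theory Num.Theory.
Import numFieldNormedType.Exports.

Local Open Scope classical_set_scope.
Local Open Scope ring_scope.

(* Write [D] for the differential on [X (x) /\ L], [eps v] for the exterior
   product with [v] and [theta v = D eps v + eps v D] for the action of [v].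
   Being Fredholm split in degree [p] is the homotopy equation
   [P_p (d h + h' d) P_p = P_p] in the Calkin algebra [Q] of the total space.
   If [I] is an ideal of codimension 1 in [J = I + <y>], the Koszul complex of
   [J] is the mapping cone of [theta y] on that of [I], and twisting by the
   characters that extend [f] replaces [theta y] by [theta y - l]. A split
   complex has split cones. Conversely, if all the cones are split at [p] and the
   complex is split below [p] but not at [p], a right ideal [M] of [Q] is
   obtained, stable under the operator and such that every [t - l] is onto
   modulo [M]; a Gelfand-Mazur argument gives [1 \in M], a contradiction. The
   degrees next to [n] are reduced to those next to 0 by passing to the opposite
   ring. A singular [f] on [I] vanishes on [[y, I]], hence extends to a character
   of [J], because brackets act quasi-nilpotently: were [theta [y, b] - a] not
   invertible with [a != 0], a weight with value [a] at [[y, b]] would extend, by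
   Lie's theorem modulo right ideals, to a character of [L].
   Ideals of solvable and subalgebras of nilpotent algebras are joined to [L] by
   chains of such extensions. For [I = 0] a regular point makes the identity
   compact, whence the spectra are non-void by Riesz's theorem; they are closed
   by stability of splitting under small perturbations and bounded by the
   Neumann series. *)

(** No vectors survive in the Calkin algebra, so joint eigenvectors and homology classes are
    replaced by one-sided ideals: a proper right ideal that contains all [th u - f u] plays the role
    of an eigenvector, and surjectivity modulo a right ideal that of exactness. The analysis rests
    on two things that pass to quotients and to the opposite ring: representatives of bounded norm,
    and Neumann series. Closures of ideals are taken only where a limit is.

    A cone at [p] sees the complex at [p] and at [p - 1], and splitting at [p] is recovered from
    cones only after [p - 1] is known to split. The induction therefore runs over ranges of degrees
    that start where the complex vanishes, not over single degrees; these ranges are the sets with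
    indices delta and pi, and the full spectrum is a delta range that covers all degrees.

    One ring has to contain the differential, the homotopies and the degree projections, hence the
    total space over all subsets of the basis. On it the identities of the Koszul differential
    follow from its relations with the operators [eps v] and from its value on degree 0, which
    avoids squaring the double sum that defines it. *)

Section NcRing.
Variable Q : pzRingType.

(** Syntax for the reflexive tactic [nc_ring]: an identity between noncommutative polynomials in
    atoms is decided by comparing multisets of words. *)
Inductive nc_expr :=
  NcVar of nat | NcZero | NcOne | NcOpp of nc_expr
| NcAdd of nc_expr & nc_expr | NcMul of nc_expr & nc_expr.

Fixpoint nc_eval (env : seq Q) e : Q :=
  match e with
  | NcVar i => nth 0 env i
  | NcZero => 0
  | NcOne => 1
  | NcOpp a => - nc_eval env a
  | NcAdd a b => nc_eval env a + nc_eval env b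
  | NcMul a b => nc_eval env a * nc_eval env b
  end.

(* The words with positive and with negative sign in the expansion. *)
Fixpoint nc_words e : seq (seq nat) * seq (seq nat) :=
  match e with
  | NcVar i => ([:: [:: i]], [::])
  | NcZero => ([::], [::])
  | NcOne => ([:: [::]], [::])
  | NcOpp a => let w := nc_words a in (w.2, w.1)
  | NcAdd a b => let w := nc_words a in let v := nc_words b in
      (w.1 ++ v.1, w.2 ++ v.2)
  | NcMul a b => let w := nc_words a in let v := nc_words b in
      ([seq x ++ y | x <- w.1, y <- v.1] ++ [seq x ++ y | x <- w.2, y <- v.2],
       [seq x ++ y | x <- w.1, y <- v.2] ++ [seq x ++ y | x <- w.2, y <- v.1])
  end.

Let word env (w : seq nat) : Q := \prod_(i <- w) nth 0 env i.
Let words env (s : seq (seq nat)) : Q := \sum_(w <- s) word env w.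

Let words_cat env s t : words env (s ++ t) = words env s + words env t.
Proof. by rewrite /words big_cat. Qed.

Let words_mul env s t :
  words env [seq x ++ y | x <- s, y <- t] = words env s * words env t.
Proof.
rewrite /words big_allpairs_dep mulr_suml; apply: eq_bigr => x _.
by rewrite mulr_sumr; apply: eq_bigr => y _; rewrite /word big_cat.
Qed.

Let nc_eval_words env e :
  nc_eval env e = words env (nc_words e).1 - words env (nc_words e).2.
Proof.
elim: e => [i|||a IHa|a IHa b IHb|a IHa b IHb] /=.
- by rewrite /words big_seq1 big_nil subr0 /word big_seq1.
- by rewrite /words !big_nil subr0.
- by rewrite /words big_seq1 big_nil subr0 /word big_nil.
- by rewrite IHa opprB.
- by rewrite IHa IHb !words_cat opprD addrACA.
rewrite IHa IHb !words_cat !words_mul mulrBl !mulrBr !opprD !opprK.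
by rewrite [- _ + _ in LHS]addrC addrACA.
Qed.

(** Moving the negative words to the other side makes cancellation automatic: words are neither
    collected nor ordered. *)
Lemma nc_ringP env e1 e2 :
  perm_eq ((nc_words e1).1 ++ (nc_words e2).2)
          ((nc_words e2).1 ++ (nc_words e1).2) ->
  nc_eval env e1 = nc_eval env e2.
Proof.
move=> ew; rewrite !nc_eval_words.
have /eqP H : words env (nc_words e1).1 + words env (nc_words e2).2 =
          words env (nc_words e2).1 + words env (nc_words e1).2.
  by rewrite -!words_cat; apply: perm_big.
by apply/eqP; rewrite subr_eq addrAC eq_sym subr_eq eq_sym.
Qed.

End NcRing.

Ltac nc_index x s :=
  lazymatch s with
  | ?y :: ?t => match goal with
     | _ => let _ := match goal with _ => constr_eq x y end in constr:(O)
     | _ => let i := nc_index x t in constr:(S i)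
     end
  end.
Ltac nc_insert x s :=
  match goal with
  | _ => let _ := nc_index x s in s
  | _ => constr:(x :: s)
  end.
Ltac nc_atoms e s :=
  lazymatch e with
  | @GRing.add _ ?a ?b => let s := nc_atoms a s in nc_atoms b s
  | @GRing.mul _ ?a ?b => let s := nc_atoms a s in nc_atoms b s
  | @GRing.opp _ ?a => nc_atoms a s
  | @GRing.zero _ => s
  | @GRing.one _ => s
  | _ => nc_insert e s
  end.
Ltac nc_reify e s :=
  lazymatch e with
  | @GRing.add _ ?a ?b =>
      let a := nc_reify a s in let b := nc_reify b s in constr:(NcAdd a b)
  | @GRing.mul _ ?a ?b =>
      let a := nc_reify a s in let b := nc_reify b s in constr:(NcMul a b)
  | @GRing.opp _ ?a => let a := nc_reify a s in constr:(NcOpp a)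
  | @GRing.zero _ => constr:(NcZero)
  | @GRing.one _ => constr:(NcOne)
  | _ => let i := nc_index e s in constr:(NcVar i)
  end.
Ltac nc_ring_in Q :=
  lazymatch goal with
  | |- ?a = ?b =>
    let s := nc_atoms a (@nil (GRing.PzRing.sort Q)) in
    let s := nc_atoms b s in
    let ea := nc_reify a s in
    let eb := nc_reify b s in
    refine (@nc_ringP Q s ea eb _); by vm_compute
  end.

(** The second branch serves carriers such as [bop T], whose type is not displayed as the sort of a
    ring; the structure is then inferred. *)
Ltac nc_ring :=
  lazymatch goal with
  | |- @eq (GRing.PzRing.sort ?Q) _ _ => nc_ring_in Q
  | |- @eq ?T _ _ => nc_ring_in (T : pzRingType)
  end.

(** * Real-valued modulus of complex numbers *)

Section ComplexNorm.
Variable R : realType.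
Implicit Types a b : R[i].

(** The norm of [R[i]] takes values in [R[i]]; estimates, limits and [lra] live in the ordered field
    [R]. *)
Definition cnorm a : R := complex.Re `|a|.

Lemma cnormE a : (cnorm a)%:C%C = `|a|.
Proof.
rewrite /cnorm; apply/eqP; rewrite eq_complex /= eqxx /=.
by have := normr_ge0 a; rewrite lecE /= => /andP[].
Qed.

Lemma cnorm_ge0 a : 0 <= cnorm a.
Proof. by have := normr_ge0 a; rewrite lecE => /andP[]. Qed.

Lemma cnorm_eq0 a : (cnorm a == 0) = (a == 0).
Proof. by rewrite -(inj_eq (@complexI R)) cnormE normr_eq0. Qed.

Lemma cnorm_gt0 a : (0 < cnorm a) = (a != 0).
Proof. by rewrite lt_def cnorm_ge0 andbT cnorm_eq0. Qed.

Lemma cnormM a b : cnorm (a * b) = cnorm a * cnorm b.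
Proof. by apply: (@complexI R); rewrite rmorphM /= !cnormE normrM. Qed.

Lemma cnormD a b : cnorm (a + b) <= cnorm a + cnorm b.
Proof. by rewrite -(@lecR R) rmorphD /= !cnormE ler_normD. Qed.

Lemma cnormN a : cnorm (- a) = cnorm a.
Proof. by apply: (@complexI R); rewrite !cnormE normrN. Qed.

Lemma cnormV a : cnorm a^-1 = (cnorm a)^-1.
Proof. by apply: (@complexI R); rewrite fmorphV /= !cnormE normfV. Qed.

Lemma cnormR (r : R) : cnorm r%:C%C = `|r|.
Proof. by apply: (@complexI R); rewrite cnormE normc_def /= expr0n addr0 sqrtr_sqr. Qed.

Lemma cnorm0 : cnorm 0 = 0.
Proof. by apply/eqP; rewrite cnorm_eq0. Qed.

Lemma cnorm1 : cnorm 1 = 1.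
Proof. by apply: (@complexI R); rewrite cnormE normr1. Qed.

Lemma cnormX a n : cnorm (a ^+ n) = cnorm a ^+ n.
Proof. by apply: (@complexI R); rewrite rmorphXn /= !cnormE normrX. Qed.

Lemma cnorm_ReIm a : cnorm a <= `|complex.Re a| + `|complex.Im a|.
Proof.
rewrite /cnorm normc_def /= -[leRHS]ger0_norm ?addr_ge0 // -sqrtr_sqr.
apply: ler_wsqrtr; rewrite sqrrD !real_normK ?num_real //.
by rewrite -addrA lerD2l lerDr mulrn_wge0 // mulr_ge0.
Qed.

End ComplexNorm.

(* The part of the structure of a complex Banach algebra that survives in a
   quotient by an ideal, closed or not: [bd q c] says that [q] has a
   representative of norm at most [c]. *)
Record bdata (R : realType) (Q : pzRingType) := Bdata {
  sc : R[i] -> Q;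
  scD : {morph sc : a b / a + b};
  scM : {morph sc : a b / a * b};
  sc1 : sc 1 = 1;
  scC : forall a q, sc a * q = q * sc a;
  bd : Q -> R -> Prop;
  bd_le : forall q c c', bd q c -> c <= c' -> bd q c';
  bd_ge0 : forall q c, bd q c -> 0 <= c;
  bdD : forall p q c c', bd p c -> bd q c' -> bd (p + q) (c + c');
  bdM : forall p q c c', bd p c -> bd q c' -> bd (p * q) (c * c');
  bd_sc : forall a, bd (sc a) (cnorm a);
  bd_ex : forall q, exists c, bd q c;
  neumann : forall q c, bd q c -> c < 1 ->
    exists g, [/\ (1 - q) * g = 1, g * (1 - q) = 1 & bd g (1 - c)^-1] }.

(** * Normed data on the opposite ring *)

Section ConverseData.
Variables (R : realType) (Q : pzRingType) (A : bdata R Q).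

(** Central scalars and two-sided Neumann inverses make the axioms invariant under reversal of
    products. *)
Definition conv_data : bdata R Q^c.
Proof.
refine (@Bdata R Q^c (sc A) _ _ _ _ (bd A) _ _ _ _ _ _ _).
- exact: (scD A).
- by move=> a b; rewrite scM; exact: (scC A).
- exact: (sc1 A).
- by move=> a q; symmetry; exact: (scC A).
- exact: (@bd_le _ _ A).
- exact: (@bd_ge0 _ _ A).
- exact: (@bdD _ _ A).
- by move=> p q c c' pc qc; rewrite [X in bd _ _ X]mulrC; exact: (@bdM _ _ A q p c' c qc pc).
- exact: (@bd_sc _ _ A).
- exact: (@bd_ex _ _ A).
- by move=> q c qc c1; have [g [g1 g2 g3]] := @neumann _ _ A q c qc c1; exists g.
Defined.

End ConverseData.

(** * Elementary estimates and resolvents *)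

Section BdataTheory.
Variables (R : realType) (Q : pzRingType) (A : bdata R Q).
Local Notation sc := (sc A).
Local Notation bd := (bd A).

Lemma sc0 : sc 0 = 0.
Proof. by apply: (addrI (sc 0)); rewrite -scD !addr0. Qed.

Lemma scN a : sc (- a) = - sc a.
Proof. by apply: (addrI (sc a)); rewrite -scD !subrr sc0. Qed.

Lemma scB a b : sc (a - b) = sc a - sc b.
Proof. by rewrite scD scN. Qed.

Lemma scX a n : sc (a ^+ n) = sc a ^+ n.
Proof. by elim: n => [|n IH]; rewrite ?expr0 ?sc1 // !exprS scM IH. Qed.

Lemma scV a : a != 0 -> sc a^-1 * sc a = 1.
Proof. by move=> a0; rewrite -scM mulVf // sc1. Qed.

Lemma bd1 : bd 1 1.
Proof. by have := bd_sc A 1; rewrite sc1 cnorm1. Qed.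

Lemma bd0 : bd 0 0.
Proof. by have := bd_sc A 0; rewrite sc0 cnorm0. Qed.

Lemma bdN q c : bd q c -> bd (- q) c.
Proof.
move=> qc; have := bdM (bd_sc A (-1)) qc.
by rewrite scN sc1 mulN1r cnormN cnorm1 mul1r.
Qed.

Lemma bdZ a q c : bd q c -> bd (sc a * q) (cnorm a * c).
Proof. by move=> qc; apply: bdM => //; apply: bd_sc. Qed.

Lemma bdX q c n : bd q c -> bd (q ^+ n) (c ^+ n).
Proof.
move=> qc; elim: n => [|n IH]; first by rewrite !expr0; apply: bd1.
by rewrite !exprS; apply: bdM.
Qed.

(** The Neumann series at infinity, from [q - a = - a (1 - q / a)]. *)
Lemma bd_resolvent q c a : bd q c -> c < cnorm a ->
  exists g, [/\ (q - sc a) * g = 1, g * (q - sc a) = 1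
              & bd g (cnorm a - c)^-1].
Proof.
move=> qc ca; have c0 := bd_ge0 qc.
have n0 : 0 < cnorm a by apply: le_lt_trans ca.
have a0 : a != 0 by rewrite -cnorm_gt0.
have q'c : bd (sc a^-1 * q) ((cnorm a)^-1 * c) by rewrite -cnormV; apply: bdZ.
have [|g [g1 g2 gb]] := neumann q'c; first by rewrite mulrC ltr_pdivrMr ?mul1r.
have ss : sc a * sc a^-1 = 1 by rewrite -scM divff // sc1.
have E : q - sc a = - sc a * (1 - sc a^-1 * q).
  have -> : - sc a * (1 - sc a^-1 * q) = sc a * sc a^-1 * q - sc a by nc_ring.
  by rewrite ss mul1r.
set Y := 1 - _ in E g1 g2; exists (- (sc a^-1 * g)); split.
- have -> : (q - sc a) * - (sc a^-1 * g) = sc a * (Y * sc a^-1) * g.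
    by rewrite E; nc_ring.
  by rewrite -(scC A _ Y) mulrA ss mul1r.
- have -> : - (sc a^-1 * g) * (q - sc a) = sc a^-1 * (g * sc a) * Y.
    by rewrite E; nc_ring.
  by rewrite -(scC A _ g) mulrA -scM mulVf // sc1 mul1r.
have -> : (cnorm a - c)^-1 = (cnorm a)^-1 * (1 - (cnorm a)^-1 * c)^-1.
  by rewrite -invfM mulrBr mulr1 mulrA divff ?mul1r // gt_eqF.
by apply: bdN; apply: bdM => //; rewrite -cnormV; apply: bd_sc.
Qed.

End BdataTheory.

(* An elementary Gelfand-Mazur argument. The inverse of [1 - (t / l) ^ 2 ^ m]
   is the average of those of [1 - t / (w l)] over the roots of unity [w], so it
   is Lipschitz in [l] uniformly in [m]; hence [(t / r) ^ 2 ^ m --> 0]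
   propagates from large to small radii [r], against the invertibility of [t].
   Everything is up to elements of norm 0. *)
Section GelfandMazur.
Variables (R : realType) (Q : pzRingType) (A : bdata R Q).
Local Notation sc := (sc A).
(** Kept apart from the bound of [A]: in the application [nb] bounds left multiplications on the
    quotient by the closure of a right ideal, and holds only for elements that preserve this
    closure. *)
Variable nb : Q -> R -> Prop.
Hypothesis nb_le : forall q c c', nb q c -> c <= c' -> nb q c'.
Hypothesis nbD : forall p q c c', nb p c -> nb q c' -> nb (p + q) (c + c').
Hypothesis nbM : forall p q c c', nb p c -> nb q c' -> nb (p * q) (c * c').
Hypothesis nb_sc : forall a, nb (sc a) (cnorm a).
Variables (t : Q) (T C : R) (b : R[i] -> Q).
Hypothesis C_gt0 : 0 < C.
Hypothesis T_gt0 : 0 < T.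
Hypothesis nbt : nb t T.
Hypothesis nbb : forall l, nb (b l) C.
Hypothesis tb1 : forall l, nb ((t - sc l) * b l - 1) 0.
Hypothesis bt1 : forall l, nb (b l * (t - sc l) - 1) 0.

Let nb0 : nb 0 0.
Proof. by have := nb_sc 0; rewrite sc0 cnorm0. Qed.

Let nb1 : nb 1 1.
Proof. by have := nb_sc 1; rewrite sc1 cnorm1. Qed.

Let nbN q c : nb q c -> nb (- q) c.
Proof.
move=> qc; have := nbM (nb_sc (-1)) qc.
by rewrite scN sc1 mulN1r cnormN cnorm1 mul1r.
Qed.

Let nbB p q c c' : nb p c -> nb q c' -> nb (p - q) (c + c').
Proof. by move=> pc qc; apply: nbD => //; apply: nbN. Qed.

Let nbX q c n : nb q c -> nb (q ^+ n) (c ^+ n).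
Proof.
move=> qc; elim: n => [|n IH]; first by rewrite !expr0.
by rewrite !exprS; apply: nbM.
Qed.

Let nb_eqv p q c : nb q c -> nb (p - q) 0 -> nb p c.
Proof. by move=> qc pq; have := nbD pq qc; rewrite subrK add0r. Qed.

Let x l := sc l^-1 * t.

Let xX l n : x l ^+ n = sc (l^-1 ^+ n) * t ^+ n.
Proof. by rewrite /x exprMn_comm ?scX //; apply: scC. Qed.

Let nbx l : nb (x l) ((cnorm l)^-1 * T).
Proof. by rewrite -cnormV; apply: nbM. Qed.

Let om m : R[i] := (2 ^ m).-root (-1).

Let omX m : om m ^+ (2 ^ m) = -1.
Proof. by rewrite rootCK // expn_gt0. Qed.

Let cnorm_om m : cnorm (om m) = 1.
Proof.
apply/eqP; rewrite -(@pexpr_eq1 _ _ (2 ^ m)) ?expn_gt0 ?cnorm_ge0 //.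
by rewrite -cnormX omX cnormN cnorm1.
Qed.

(** The recursion is [1 / (1 - y ^ 2) = (1 / (1 - y) + 1 / (1 + y)) / 2] for [y = (t / l) ^ 2 ^ m]:
    as [om m] is a root of -1 of order [2 ^ m], passing from [l] to [om m * l] changes the sign of
    [y]. *)
Fixpoint root_average m l : Q :=
  if m is m'.+1
  then sc 2^-1 * (root_average m' l + root_average m' (om m' * l))
  else - (sc l * b l).
Local Notation F := root_average.

Let sc_half : sc 2^-1 + sc 2^-1 = 1.
Proof. by have := splitr (1 : R[i]); rewrite !mul1r -scD => <-; apply: sc1. Qed.

Let F_inv m l : l != 0 -> nb (F m l * (1 - x l ^+ (2 ^ m)) - 1) 0.
Proof.
elim: m l => [|m IH] l l0 /=.
  have ll : sc l * sc l^-1 = 1 by rewrite -scM divff // sc1.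
  rewrite expn0 expr1 /x.
  have -> : - (sc l * b l) * (1 - sc l^-1 * t) - 1 =
     sc l * (b l * sc l^-1) * t - sc l * b l - 1 by nc_ring.
  rewrite -(scC A _ (b l)) mulrA ll mul1r (scC A l).
  by have -> : b l * t - b l * sc l - 1 = b l * (t - sc l) - 1 by nc_ring.
have om0 : om m != 0 by rewrite -cnorm_gt0 cnorm_om.
have := IH _ (mulf_neq0 om0 l0); have := IH _ l0.
have -> : x (om m * l) ^+ (2 ^ m) = - x l ^+ (2 ^ m).
  by rewrite !xX invfM exprMn (exprVn (om m)) omX invrN invr1 mulN1r scN mulNr.
rewrite expnS mulnC exprM opprK; set y := x l ^+ (2 ^ m).
set F1 := F m l; set F2 := F m _ => h1 h2.
have ny : nb y (((cnorm l)^-1 * T) ^+ (2 ^ m)) by apply: nbX.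
have -> : sc 2^-1 * (F1 + F2) * (1 - y ^+ 2) - 1 =
    sc 2^-1 * ((F1 * (1 - y) - 1) * (1 + y) + (F2 * (1 + y) - 1) * (1 - y))
    + (sc 2^-1 + sc 2^-1 - 1).
  by rewrite expr2; nc_ring.
rewrite sc_half subrr addr0.
by have := nbM (nb_sc 2^-1) (nbD (nbM h1 (nbD nb1 ny)) (nbM h2 (nbB nb1 ny)));
  rewrite !mul0r addr0 mulr0.
Qed.

Let F_bound m l : nb (F m l) (cnorm l * C).
Proof.
elim: m l => [|m IH] l /=; first by apply: nbN; apply: nbM.
have := nbM (nb_sc 2^-1) (nbD (IH l) (IH (om m * l))).
rewrite cnormM cnorm_om mul1r => h; apply: nb_le h _.
have -> : cnorm (2^-1 : R[i]) = 2^-1.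
  by rewrite cnormV -[2 : R[i]](rmorph_nat (@real_complex R)) cnormR ger0_norm.
lra.
Qed.

(** For [m = 0] this is the resolvent identity applied to [l * b l]. Averaging keeps the constant,
    because the rotations have modulus 1 and commute with the dilation by [s]. *)
Let F_lip m l (s : R) : 0 < s -> s <= 1 ->
  nb (F m l - F m (s%:C%C * l)) ((1 - s) * (cnorm l * C + (cnorm l * C) ^+ 2)).
Proof.
move=> s0 s1; elim: m l => [|m IH] l /=; last first.
  have := nbM (nb_sc 2^-1) (nbD (IH l) (IH (om m * l))).
  rewrite cnormM cnorm_om mul1r [om m * (_ * l)]mulrCA.
  set p := F m l; set p' := F m (_ * l); set q := F m _; set q' := F m (_ * _).
  have -> : sc 2^-1 * (p + q) - sc 2^-1 * (p' + q') =
            sc 2^-1 * (p - p' + (q - q')) by nc_ring.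
  move=> h; apply: nb_le h _.
  have -> : cnorm (2^-1 : R[i]) = 2^-1.
    by rewrite cnormV -[2 : R[i]](rmorph_nat (@real_complex R)) cnormR ger0_norm.
  lra.
set m := s%:C%C * l.
have lm : cnorm (l - m) = (1 - s) * cnorm l.
  have -> : l - m = (1 - s)%:C%C * l by rewrite /m rmorphB rmorph1; ring.
  by rewrite cnormM cnormR ger0_norm // subr_ge0.
have res : nb (b l - b m) ((1 - s) * cnorm l * (C * C)).
  apply: (nb_eqv (q := sc (l - m) * (b l * b m))).
    by rewrite -lm; apply: nbM => //; apply: nbM.
  rewrite scB.
  have -> : b l - b m - (sc l - sc m) * (b l * b m) =
     (b l * (t - sc l) - 1) * b m - b l * ((t - sc m) * b m - 1)
     + (b l * sc l - sc l * b l) * b m - (b l * sc m - sc m * b l) * b m.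
    by nc_ring.
  rewrite !(scC A _ (b l)) !subrr !mul0r addr0 subr0.
  by have := nbB (nbM (bt1 l) (nbb m)) (nbM (nbb l) (tb1 m));
    rewrite mul0r mulr0 addr0.
have -> : - (sc l * b l) - - (sc m * b m) =
  - (sc l * (b l - b m)) - sc (l - m) * b m by rewrite scB; nc_ring.
have := nbB (nbN (nbM (nb_sc l) res)) (nbM (nb_sc (l - m)) (nbb m)).
rewrite lm => h; apply: nb_le h _; lra.
Qed.

Let root_small r := forall e, 0 < e -> exists m0, forall m, (m0 <= m)%N ->
  nb (x r%:C%C ^+ (2 ^ m)) e.

Let geometric_small (q c e : R) : 0 <= q -> q < 1 -> 0 <= c -> 0 < e ->
  exists m0, forall m, (m0 <= m)%N -> c * q ^+ (2 ^ m) <= e.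
Proof.
move=> q0 q1 c0 e0.
have /cvgrPdist_le /(_ _ e0) [m0 _ H] : (fun k => c * q ^+ k) @ \oo --> (0 : R).
  rewrite -[0](mulr0 c); apply: cvgM; [exact: cvg_cst | apply: cvg_expr].
  by rewrite ger0_norm.
exists m0 => m mm; have := H (2 ^ m)%N; rewrite /= sub0r normrN => h.
apply: le_trans (ler_norm _) (h _).
by rewrite /= (leq_trans mm) // ltnW // ltn_expl.
Qed.

Let root_small_start r : 0 < r -> T < r -> root_small r.
Proof.
move=> r0 Tr e e0.
have q0 : 0 <= r^-1 * T by rewrite mulr_ge0 ?invr_ge0 // ltW.
have q1 : r^-1 * T < 1 by rewrite mulrC ltr_pdivrMr // mul1r.
have [m0 H] := geometric_small q0 q1 ler01 e0.
exists m0 => m mm; apply: nb_le (H m mm).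
by rewrite mul1r; apply: nbX; have := nbx r%:C%C; rewrite cnormR gtr0_norm.
Qed.

(** Small powers at radius [r] make [F m r] close to 1, uniformly for large [m]; by the Lipschitz
    bound so is [F m (s r)], which bounds the powers at [s r] by 2. Between [s r] and [r] such a
    bound turns into geometric decay. *)
Let root_small_step r (s : R) : 0 < r -> 2^-1 <= s -> s < 1 ->
    (1 - s) * (r * C + (r * C) ^+ 2) <= 4^-1 ->
  root_small r -> root_small ((1 + s) / 2 * r).
Proof.
move=> r0 s0 s1 small rs e e0.
have sgt0 : 0 < s by lra.
set k := (4 * (r * C + 1))^-1; have k0 : 0 < k.
  by rewrite invr_gt0 mulr_gt0 // addr_gt0 // mulr_gt0.
have [m1 H1] := rs k k0.
set r' := (1 + s) / 2 * r.
have r'0 : 0 < r' by rewrite mulr_gt0 //; lra.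
have q0 : 0 <= s * r / r' by rewrite divr_ge0 // ltW // mulr_gt0.
have q1 : s * r / r' < 1.
  by rewrite ltr_pdivrMr // mul1r /r' ltr_pM2r //; lra.
have [m2 H2] := geometric_small q0 q1 (ler0n R 2) e0.
exists (maxn m1 m2) => m; rewrite geq_max => /andP[mm1 mm2].
have rC0 : r%:C%C != 0 :> R[i] by rewrite -cnorm_gt0 cnormR gtr0_norm.
have Fr : nb (F m r%:C%C - 1) 4^-1.
  have F1 := F_inv m rC0; set y := x _ ^+ _ in F1.
  have := nbD F1 (nbM (F_bound m r%:C%C) (H1 m mm1)).
  rewrite -/y; have -> : F m r%:C%C * (1 - y) - 1 + F m r%:C%C * y =
    F m r%:C%C - 1 by nc_ring.
  move=> h; apply: nb_le h _; rewrite cnormR gtr0_norm // add0r /k.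
  by rewrite ler_pdivrMr ?mulr_gt0 ?addr_gt0 ?mulr_gt0 //; lra.
have Fs : nb (1 - F m (s * r)%:C%C) 2^-1.
  have := nbD (nbN Fr) (F_lip m r%:C%C sgt0 (ltW s1)).
  rewrite -rmorphM cnormR gtr0_norm //.
  set p := F m _; set p' := F m _.
  have -> : - (p - 1) + (p - p') = 1 - p' by nc_ring.
  by move=> h; apply: nb_le h _; lra.
have srC0 : (s * r)%:C%C != 0 :> R[i].
  by rewrite -cnorm_gt0 cnormR gtr0_norm ?mulr_gt0.
have y2 : nb (x (s * r)%:C%C ^+ (2 ^ m)) 2.
  have F1 := F_inv m srC0; set y := x _ ^+ _ in F1 *.
  set p := F m _ in Fs F1.
  (* Since [p (1 - y) = 1] up to norm 0, [y] equals [(1 - p) y - (1 - p)]: a bound [c] improves to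
     [1/2 + c/2], and iteration brings any bound below 2. *)
  have step c : nb y c -> nb y (2^-1 + c / 2).
    move=> yc; have := nbD (nbB (nbM Fs yc) Fs) (nbN F1).
    have -> : (1 - p) * y - (1 - p) - (p * (1 - y) - 1) = y by nc_ring.
    by move=> h; apply: nb_le h _; lra.
  have iter_step c k' : nb y c -> nb y (1 + c / 2 ^+ k').
    move=> yc; elim: k' => [|k' IH]; first by apply: nb_le yc _; rewrite expr0; lra.
    apply: nb_le (step _ IH) _; rewrite exprS invfM; lra.
  have yc : nb y (((cnorm (s * r)%:C%C)^-1 * T) ^+ (2 ^ m)) by apply: nbX.
  set c := _ ^+ _ in yc.
  have c0 : 0 <= c by rewrite exprn_ge0 // mulr_ge0 ?invr_ge0 ?cnorm_ge0 // ltW.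
  apply: nb_le (iter_step c (Num.truncn c).+1 yc) _.
  have : c / 2 ^+ (Num.truncn c).+1 <= 1.
    rewrite ler_pdivrMr ?exprn_gt0 // mul1r; apply: le_trans (ltW (truncnS_gt _)) _.
    by rewrite -natrX ler_nat ltnW // ltn_expl.
  lra.
apply: nb_le (H2 m mm2).
have -> : x r'%:C%C ^+ (2 ^ m) =
    sc ((s * r / r') ^+ (2 ^ m))%:C%C * x (s * r)%:C%C ^+ (2 ^ m).
  rewrite !xX mulrA -scM -!fmorphV -!rmorphXn -rmorphM /=; congr (sc _%:C%C * _).
  by rewrite -exprMn mulrAC divff ?mul1r // gt_eqF // mulr_gt0.
rewrite [2 * _]mulrC; have := nbM (nb_sc ((s * r / r') ^+ (2 ^ m))%:C%C) y2.
by rewrite cnormR ger0_norm ?exprn_ge0.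
Qed.

(** At a radius [r] with [r C <= 1/2], the identity [1 = (r b(0)) ^ n (t / r) ^ n], valid up to norm
    0, bounds 1 by 1/2 as soon as the second factor is small. *)
Lemma gelfand_mazur : nb 1 2^-1.
Proof.
(* [M] exceeds [T], so the descent starts inside the Neumann region. [s] is so close to 1 that
   [(1 - s) B <= 1/4]; as the Lipschitz constant grows with the radius, the same [s] serves at every
   radius below [M]. *)
set M := 2 * T + 1 + C^-1.
have C'0 : 0 < C^-1 by rewrite invr_gt0.
have M0 : 0 < M by rewrite !addr_gt0 // mulr_gt0.
set B := M * C + (M * C) ^+ 2.
have B0 : 0 < B by rewrite addr_gt0 ?exprn_gt0 ?mulr_gt0.
set s := 1 - (4 * (B + 1))^-1.
have B1 : 0 < (4 * (B + 1))^-1 <= 4^-1.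
  rewrite invr_gt0 mulr_gt0 //=; last by lra.
  by rewrite lef_pV2 ?posrE //; lra.
set q := (1 + s) / 2.
have q01 : 0 < q < 1 by rewrite /q /s; lra.
have [q0 q1] := andP q01.
have small k : root_small (q ^+ k * M).
  elim: k => [|k IH].
    by rewrite expr0 mul1r; apply: root_small_start => //; rewrite /M; move: C^-1 C'0 T_gt0 => c c0 T0; lra.
  rewrite exprS -mulrA; apply: root_small_step => //.
  - by rewrite mulr_gt0 ?exprn_gt0.
  - by rewrite /s; lra.
  - by rewrite /s; lra.
  rewrite /s opprB addrC subrK.
  rewrite mulrC ler_pdivrMr; last by lra.
  have kM : q ^+ k * M * C <= M * C.
    rewrite ler_pM2r // ler_piMl ?(ltW M0) //.
    by rewrite exprn_ile1 // ltW.
  have kM0 : 0 <= q ^+ k * M * C by rewrite !mulr_ge0 ?exprn_ge0 // ltW.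
  have : (q ^+ k * M * C) ^+ 2 <= (M * C) ^+ 2.
    by rewrite ler_sqr ?nnegrE // (le_trans kM0).
  by rewrite /B in B0 *; lra.
have [k _ /(_ k (leqnn _)) qk] :
    \forall k \near \oo, q ^+ k * M <= (2 * C)^-1.
  have /cvgrPdist_le /(_ (2 * C)^-1) : (fun k => q ^+ k * M) @ \oo --> (0 : R).
    rewrite -[0](mul0r M); apply: cvgM; [apply: cvg_expr | exact: cvg_cst].
    by rewrite ger0_norm ?ltW.
  rewrite invr_gt0 mulr_gt0 // => /(_ isT); apply: filterS => k.
  by rewrite sub0r normrN; apply: le_trans (ler_norm _).
set r := q ^+ k * M in qk.
have r0 : 0 < r by rewrite mulr_gt0 ?exprn_gt0.
have [|m /(_ m (leqnn _)) xm] := small k 2^-1; first by rewrite invr_gt0.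
have bt n : nb (b 0 ^+ n * t ^+ n - 1) 0.
  elim: n => [|n IH]; first by rewrite !expr0 mul1r subrr.
  have h := bt1 0; rewrite sc0 subr0 in h.
  rewrite exprSr exprS.
  have -> : b 0 ^+ n * b 0 * (t * t ^+ n) - 1 =
     b 0 ^+ n * (b 0 * t - 1) * t ^+ n + (b 0 ^+ n * t ^+ n - 1) by nc_ring.
  have := nbD (nbM (nbM (nbX n (nbb 0)) h) (nbX n nbt)) IH.
  by rewrite mulr0 mul0r addr0.
set n := (2 ^ m)%N in xm.
have rC0 : r%:C%C != 0 :> R[i] by rewrite -cnorm_gt0 cnormR gtr0_norm.
have := nbB (nbM (nbM (nb_sc (r%:C%C ^+ n)) (nbX n (nbb 0))) xm) (bt n).
rewrite xX -/r.
have -> : sc (r%:C%C ^+ n) * b 0 ^+ n * (sc (r%:C%C^-1 ^+ n) * t ^+ n) =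
          b 0 ^+ n * t ^+ n.
  rewrite mulrA (scC A (r%:C%C ^+ n)) -(mulrA _ (sc _) (sc _)) -scM -exprMn divff //.
  by rewrite expr1n sc1 mulr1.
rewrite opprB addrC subrK => h; apply: nb_le h _.
rewrite cnormX cnormR gtr0_norm // addr0 -exprMn -[leRHS]mul1r.
have rC : 0 <= r * C by rewrite mulr_ge0 // ltW.
apply: ler_pM => //; rewrite ?exprn_ge0 ?invr_ge0 //.
rewrite exprn_ile1 //.
apply: (@le_trans _ _ ((2 * C)^-1 * C)); first by rewrite ler_pM2r.
by rewrite invfM -mulrA mulVf ?gt_eqF // mulr1; lra.
Qed.

End GelfandMazur.

(** * Right ideals and surjectivity modulo them *)

Definition right_ideal (Q : pzRingType) (D : Q -> Prop) : Prop :=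
  [/\ D 0, forall x y, D x -> D y -> D (x + y) & forall x q, D x -> D (x * q)].

Section SquareCompact.
Variable R : realType.

Lemma compact_square (r : R) :
  compact ([set` `[- r, r]] `*` [set` `[- r, r]] : set (R * R)).
Proof. by apply: compact_setX; apply: segment_compact. Qed.

(** Compactness in its near-covering form, along the filter of bounds tending to infinity, turns
    local bounds into one on the disc. *)
Lemma uniform_on_disc (P : R -> R[i] -> Prop) (r : R) :
  (forall l C C', P C l -> C <= C' -> P C' l) ->
  (forall l0, exists e C, 0 < e /\ forall l, cnorm (l - l0) < e -> P C l) ->
  exists C, forall l, cnorm l <= r -> P C l.
Proof.
move=> Ple loc.
pose z (x : R * R) : R[i] := (x.1 +i* x.2)%C.
have /compact_near_coveringP cov := @compact_square r.
have [|C [_ H]] := cov R (pinfty_nbhs R) (fun C x => P C (z x)) _.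
  move=> x _; have [e [C [e0 H]]] := loc (z x).
  exists (ball x (e / 2), [set c | C < c]).
    split; first by apply: nbhsx_ballx; rewrite divr_gt0.
    by exists C; split; rewrite ?num_real.
  move=> [y c] [[/= y1 y2] Cc]; apply: Ple (ltW Cc); apply: H.
  apply: (le_lt_trans (cnorm_ReIm _)).
  rewrite /ball /= in y1 y2; rewrite /z /=.
  by rewrite distrC in y1; rewrite distrC in y2; rewrite (splitr e) ltrD.
exists (C + 1) => l lr; have -> : l = z (complex.Re l, complex.Im l) by case: (l).
apply: H; first by rewrite ltrDl.
have ReIm : `|complex.Re l| <= r /\ `|complex.Im l| <= r.
  split; apply: le_trans lr; rewrite /cnorm normc_def /= -sqrtr_sqr ler_wsqrtr //.
    by rewrite lerDl sqr_ge0.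
  by rewrite lerDr sqr_ge0.
by split; rewrite /= in_itv /= -ler_norml; case: ReIm.
Qed.

End SquareCompact.

Section Surjective.
Variables (R : realType) (Q : pzRingType) (A : bdata R Q).
Local Notation sc := (sc A).
Local Notation bd := (bd A).
Variable D : Q -> Prop.
Hypothesis Dr : right_ideal D.

Let D0 : D 0. Proof. by case: Dr. Qed.
Let DD x y : D x -> D y -> D (x + y). Proof. by case: Dr => _ h _; apply: h. Qed.
Let DM x q : D x -> D (x * q). Proof. by case: Dr => _ _ h; apply: h. Qed.
Let DN x : D x -> D (- x). Proof. by move=> /(DM (-1)); rewrite mulrN1. Qed.
Let DB x y : D x -> D y -> D (x - y). Proof. by move=> ? /DN; apply: DD. Qed.

(** The quotient seminorm modulo [D], as an infimum that need not be attained. Its null space [M] is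
    the closure of [D]. *)
Definition dist_le q c := forall e, 0 < e -> exists d, D d /\ bd (q - d) (c + e).
Local Notation bM := dist_le.
Local Notation M := (dist_le^~ 0).

Let bM_le q c c' : bM q c -> c <= c' -> bM q c'.
Proof.
move=> qc cc e e0; have [d [dD dq]] := qc e e0; exists d; split=> //.
by apply: bd_le dq _; rewrite lerD2r.
Qed.

Let bMD p q c c' : bM p c -> bM q c' -> bM (p + q) (c + c').
Proof.
move=> pc qc e e0.
have e20 : 0 < e / 2 by rewrite divr_gt0.
have [d [dD dq]] := pc _ e20; have [d' [dD' dq']] := qc _ e20.
exists (d + d'); split; first exact: DD.
have -> : p + q - (d + d') = (p - d) + (q - d') by nc_ring.
by apply: bd_le (bdD dq dq') _; lra.
Qed.

Let MD p q : M p -> M q -> M (p + q).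
Proof. by move=> pc qc; rewrite -[0](addr0 0); apply: bMD. Qed.

Let DM_M q : D q -> M q.
Proof.
move=> qD e e0; exists q; split=> //; rewrite subrr.
by apply: bd_le (bd0 A) _; rewrite add0r ltW.
Qed.

Let bMsc q c a : bM q c -> bM (sc a * q) (cnorm a * c).
Proof.
move=> qc e e0; have a0 := cnorm_ge0 a.
have [|d [dD dq]] := qc (e / (cnorm a + 1)); first by rewrite divr_gt0 // ltr_wpDl.
exists (sc a * d); split; first by rewrite scC; apply: DM.
rewrite -mulrBr; apply: bd_le (bdZ a dq) _.
rewrite mulrDr lerD2l mulrA ler_pdivrMr ?ltr_wpDl //; lra.
Qed.

Let Msc q a : M q -> M (sc a * q).
Proof. by move=> /(@bMsc _ _ a); rewrite mulr0. Qed.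

Let MN q : M q -> M (- q).
Proof.
by move=> /(@bMsc _ _ (-1)); rewrite mulr0 scN sc1 mulN1r.
Qed.

Let MR q p : M q -> M (q * p).
Proof.
move=> qM e e0; have [c pc] := bd_ex A p; have c0 := bd_ge0 pc.
have [|d [dD dq]] := qM (e / (c + 1)); first by rewrite divr_gt0 // ltr_wpDl.
exists (d * p); split; first exact: DM.
rewrite -mulrBl; apply: bd_le (bdM dq pc) _.
rewrite !add0r mulrAC ler_pdivrMr ?ltr_wpDl //; nra.
Qed.

Let bM_bd q c : bd q c -> bM q c.
Proof.
move=> qc e e0; exists 0; split=> //; rewrite subr0.
by apply: bd_le qc _; rewrite lerDl ltW.
Qed.

(** [D] is only a right ideal, so left multiplication by [p] acts on the quotient only if it maps
    [D] into the closure. *)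
Let bM_left p q b c : (forall d, D d -> M (p * d)) -> 0 <= b -> 0 <= c ->
  bd p b -> bM q c -> bM (p * q) (b * c).
Proof.
move=> pD b0 c0 pb qc e e0.
have [|d [dD dq]] := qc (e / (2 * (b + 1))).
  by rewrite divr_gt0 // mulr_gt0 // ltr_wpDl.
have [|d' [dD' dq']] := pD d dD (e / 2); first by rewrite divr_gt0.
exists d'; split=> //.
have -> : p * q - d' = p * (q - d) + (p * d - d') by nc_ring.
apply: bd_le (bdD (bdM pb dq) dq') _.
have h : b * (e / (2 * (b + 1))) <= e / 2.
  rewrite mulrA ler_pdivrMr ?mulr_gt0 ?ltr_wpDl //.
  have -> : e / 2 * (2 * (b + 1)) = e * (b + 1) by field.
  by rewrite mulrC ler_pM2l // lerDl.
by rewrite mulrDr; lra.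
Qed.

Let shrink q : (forall c, 0 <= c -> bM q c -> bM q (c / 2)) -> M q.
Proof.
move=> qh; have [c qc] := bd_ex A q; have c0 := bd_ge0 qc.
have H k : bM q (c / 2 ^+ k).
  elim: k => [|k IH]; first by rewrite expr0 divr1; apply: bM_bd.
  rewrite exprSr invfM mulrA; apply: qh => //.
  by rewrite divr_ge0 // exprn_ge0.
move=> e e0; have e20 : 0 < e / 2 by rewrite divr_gt0.
have [k ck] : exists k, c / 2 ^+ k <= e / 2.
  exists (Num.truncn (c / (e / 2))).+1.
  rewrite ler_pdivrMr ?exprn_gt0 // mulrC -ler_pdivrMr //.
  apply: le_trans (ltW (truncnS_gt _)) _.
  by rewrite -natrX ler_nat ltnW // ltn_expl.
have [d [dD dq]] := H k _ e20; exists d; split=> //.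
by apply: bd_le dq _; rewrite add0r; lra.
Qed.

Variable t : Q.
Hypothesis tD : forall x, D x -> D (t * x).
Hypothesis tsurj : forall l, exists b, D ((t - sc l) * b - 1).

Let D1_of_near d : D d -> bd (1 - d) (3 / 4) -> D 1.
Proof.
move=> dD d1; have [|g [g1 _ _]] := neumann d1; first by lra.
by rewrite -g1 opprB addrC subrK; apply: DM.
Qed.

(** Right inverses of norm bounded independently of [l]: near a given point by perturbing one right
    inverse, on a disc by compactness, outside it by the resolvent bound. *)
Let tsurj_bounded : exists C, 0 < C /\
  forall l, exists b, bd b C /\ D ((t - sc l) * b - 1).
Proof.
have [T tT] := bd_ex A t; have T0 := bd_ge0 tT.
pose P C l := exists b, bd b C /\ D ((t - sc l) * b - 1).
have [C HC] : exists C, forall l, cnorm l <= T + 1 -> P C l.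
  apply: uniform_on_disc => [l C C' [b [bC bD]] CC|l0].
    by exists b; split=> //; apply: bd_le bC CC.
  have [b bD] := tsurj l0; have [C bC] := bd_ex A b; have C0 := bd_ge0 bC.
  (* On this ball [(l - l0) b] has norm at most 1/2, so the correcting factor has norm at most 2. *)
  exists (2 * (C + 1))^-1, (C * 2); split.
    by rewrite invr_gt0 mulr_gt0 // ltr_wpDl.
  move=> l ll.
  have h : cnorm (l - l0) * C <= 2^-1.
    apply: (@le_trans _ _ ((2 * (C + 1))^-1 * (C + 1))).
      by apply: ler_pM => //; [exact: cnorm_ge0 | exact: ltW | rewrite lerDl].
    by rewrite invfM -mulrA mulVf ?mulr1 // gt_eqF // ltr_wpDl.
  have [|g [g1 _ g2]] := neumann (bdM (bd_sc A (l - l0)) bC); first by lra.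
  exists (b * g); split.
    apply: bdM => //; apply: bd_le g2 _; rewrite -[leRHS]invrK lef_pV2 ?posrE //; lra.
  have -> : (t - sc l) * (b * g) - 1 = ((t - sc l0) * b - 1) * g
     + ((1 - sc (l - l0) * b) * g - 1) by rewrite scB; nc_ring.
  by rewrite g1 subrr addr0; apply: DM.
exists (Num.max C 1); split; first by rewrite lt_max ltr01 orbT.
move=> l; case: (leP (cnorm l) (T + 1)) => lT.
  have [b [bC bD]] := HC _ lT; exists b; split=> //.
  by apply: bd_le bC _; rewrite le_max lexx.
have [|g [g1 _ g2]] := @bd_resolvent _ _ A t T l tT; first by lra.
exists g; split; last by rewrite g1 subrr.
apply: bd_le g2 _; rewrite le_max; apply/orP; right.
by rewrite invf_le1; lra.
Qed.

(* [D] absorbs [t] and every [t - l] is onto modulo [D]: on the Banach quotient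
   by the closure of [D] all [t - l] are then bijective, since injectivity holds
   for large [l] and propagates, the norms of the sections being bounded. *)
Theorem surjective_everywhere : D 1.
Proof.
have [C [C0 bex]] := tsurj_bounded.
have [b bP] := choice bex.
have bC l : bd (b l) C by case: (bP l).
have bD l : D ((t - sc l) * b l - 1) by case: (bP l).
have [T' tT'] := bd_ex A t.
pose T := T' + 1; have T0 : 0 < T by rewrite /T; have := bd_ge0 tT'; lra.
have tT : bd t T by apply: bd_le tT' _; rewrite lerDl.
pose inj l := forall q, M ((t - sc l) * q) -> M q.
have inj_large l : 2 * T <= cnorm l -> inj l.
  move=> lT q qM; apply: shrink => c c0 qc.
  have l0 : 0 < cnorm l by apply: lt_le_trans lT; lra.
  have l1 : l != 0 by rewrite -cnorm_gt0.
  have E : q = sc l^-1 * (t * q) - sc l^-1 * ((t - sc l) * q).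
    have -> : sc l^-1 * (t * q) - sc l^-1 * ((t - sc l) * q) =
      sc l^-1 * sc l * q by nc_ring.
    by rewrite scV // mul1r.
  rewrite E; have tq : bM (t * q) (T * c).
    by apply: bM_left => //; [move=> d dD; apply/DM_M/tD | apply: ltW].
  have := bMD (bMsc l^-1 tq) (MN (Msc l^-1 qM)).
  move=> h; apply: bM_le h _.
  rewrite addr0 cnormV mulrA mulrC ler_wpM2l //.
  by rewrite mulrC ler_pdivrMr //; lra.
have b_preserves l : inj l -> forall m, M m -> M (b l * m).
  move=> il m mM; apply: il.
  have -> : (t - sc l) * (b l * m) = ((t - sc l) * b l - 1) * m + m by nc_ring.
  by apply: MD => //; apply/DM_M/DM.
have b_left l : inj l -> M (b l * (t - sc l) - 1).
  move=> il; apply: il.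
  have -> : (t - sc l) * (b l * (t - sc l) - 1) =
    ((t - sc l) * b l - 1) * (t - sc l) by nc_ring.
  by apply/DM_M/DM.
(* Injectivity at [l0] makes [b l0] a left inverse too, whence [q = (l - l0) b(l0) q] modulo [M]: a
   bound for the distance of [q] can be halved forever. *)
have inj_step l l0 : inj l0 -> cnorm (l - l0) * C <= 2^-1 -> inj l.
  move=> il ll q qM; apply: shrink => c c0 qc.
  have E : q = sc (l - l0) * (b l0 * q) + b l0 * ((t - sc l) * q)
      - (b l0 * (t - sc l0) - 1) * q.
    have -> : sc (l - l0) * (b l0 * q) + b l0 * ((t - sc l) * q)
      - (b l0 * (t - sc l0) - 1) * q =
      (sc (l - l0) * b l0 - b l0 * (sc l - sc l0)) * q + q by nc_ring.
    by rewrite -scB scC subrr mul0r add0r.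
  have bq : bM (b l0 * q) (C * c).
    by apply: bM_left => //; [move=> d dD; apply/b_preserves/DM_M | apply: ltW].
  rewrite E; have := bMD (bMD (bMsc (l - l0) bq) (b_preserves _ il _ qM))
    (MN (MR q (b_left _ il))).
  move=> h; apply: bM_le h _; rewrite !addr0 mulrA mulrC ler_wpM2l //.
have inj_all l : inj l.
  (* The step length depends only on the uniform [C], so finitely many real steps lead back to [l]
     from the region where injectivity is known. *)
  pose h := (2 * C)^-1; have h0 : 0 < h by rewrite invr_gt0 mulr_gt0.
  have H n k : 2 * T + cnorm l <= n%:R * h -> (k <= n)%N ->
      inj (l + ((n - k)%:R * h)%:C%C).
    move=> nT; elim: k => [|k IH] kn.
      apply: inj_large; rewrite subn0.
      have nh : 0 <= n%:R * h by rewrite mulr_ge0 // ltW.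
      have := cnormD (l + (n%:R * h)%:C%C) (- l).
      have -> : l + (n%:R * h)%:C%C - l = (n%:R * h)%:C%C by ring.
      by rewrite cnormN cnormR ger0_norm // => lh; lra.
    apply: inj_step (IH (ltnW kn)) _.
    have -> : l + ((n - k.+1)%:R * h)%:C%C - (l + ((n - k)%:R * h)%:C%C)
       = - h%:C%C.
      have -> : (n - k = (n - k.+1).+1)%N by rewrite subnSK.
      by rewrite -[in (_.+1)%:R]natr1 mulrDl mul1r rmorphD /=; ring.
    rewrite cnormN cnormR gtr0_norm // /h invfM -mulrA mulVf ?mulr1 //.
    by rewrite gt_eqF.
  pose n := (Num.truncn ((2 * T + cnorm l) / h)).+1.
  have := H n n; rewrite subnn mul0r addr0; apply=> //.
  by rewrite -ler_pdivrMr // ltW // truncnS_gt.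
(* Elements seen as operators on the Banach quotient; preservation of [M] is what makes this bound
   submultiplicative. *)
pose nb q c := [/\ 0 <= c, forall m, M m -> M (q * m) & bM q c].
have nb1 : nb 1 2^-1.
  apply: (@gelfand_mazur _ _ A nb _ _ _ _ t T C b C0 T0).
  - by move=> q c c' [c0 qM qc] cc; split=> //; [apply: le_trans cc|apply: bM_le cc].
  - move=> p q c c' [c0 pM pc] [c0' qM qc]; split.
    + by rewrite addr_ge0.
    + by move=> m mM; rewrite mulrDl; apply: MD; [apply: pM|apply: qM].
    by apply: bMD.
  - move=> p q c c' [c0 pM pc] [c0' qM qc]; split; first by rewrite mulr_ge0.
      by move=> m mM; rewrite -mulrA; apply/pM/qM.
    (* The total error is [e1 (c + c' + e1 + 1)]; [e1 <= 1] bounds it by [e1 (c + c' + 2)]. *)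
    move=> e e0; pose e1 := Num.min 1 (e / (4 * (c + c' + 2))).
    have cc0 : 0 < 4 * (c + c' + 2) by lra.
    have e10 : 0 < e1 by rewrite lt_min ltr01 divr_gt0.
    have [d [dD dp]] := pc _ e10; have [d' [dD' dq]] := qc _ e10.
    have [d2 [dD2 pd2]] := pM _ (DM_M dD') _ e10.
    exists (d * q + (d2 - d * d')); split; first by apply: DD; [|apply: DB]; try apply: DM.
    have -> : p * q - (d * q + (d2 - d * d')) =
       (p - d) * (q - d') + (p * d' - d2) by nc_ring.
    apply: bd_le (bdD (bdM dp dq) pd2) _; rewrite add0r.
    have e11 : e1 <= 1 by rewrite ge_min lexx.
    have : e1 * (4 * (c + c' + 2)) <= e.
      by rewrite -ler_pdivlMr // ge_min lexx orbT.
    move: (e1) e10 e11 => x x0 x1; nra.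
  - move=> a; split; first exact: cnorm_ge0.
      by move=> m mM; have := bMsc a mM; rewrite mulr0.
    exact: bM_bd (bd_sc A a).
  - split; first exact: ltW; last exact: bM_bd.
    move=> m mM; rewrite -[0](mulr0 T); apply: bM_left => //; last exact: ltW.
    by move=> d dD; apply/DM_M/tD.
  - by move=> l; split; [exact: ltW | exact: b_preserves | exact: bM_bd].
  - move=> l; split=> //; last exact: DM_M.
    by move=> m mM; apply/DM_M/DM.
  move=> l; split=> //; last exact: b_left.
  by move=> m mM; apply/MR/b_left.
(* Slack 1/4 puts an element of [D] within 3/4 of 1; it differs from an invertible by nothing, so
   [D] itself, not just its closure, contains 1. *)
have [_ _ /(_ 4^-1)] := nb1; case=> [|d [dD d1]]; first by rewrite invr_gt0.
by apply: D1_of_near dD _; apply: bd_le d1 _; lra.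
Qed.

End Surjective.

(** * Coordinates and eigenvectors on quotient spaces *)

Section QuotientCoordinates.
Variables (K : fieldType) (V : vectType K) (W : {vspace V}).

Let B := vbasis (W^C)%VS.
Let m := \dim (W^C)%VS.

(** Coordinates of the class of [v] in [V / W], read on a complement of [W]. They are rows, so
    operators act by right multiplication. *)
Definition qcoord (v : V) : 'rV[K]_m := \row_i coord B i (daddv_pi (W^C)%VS W v).
Definition qlift (r : 'rV[K]_m) : V := \sum_i r 0 i *: B`_i.

Let cap0 : (W^C :&: W = 0)%VS. Proof. by rewrite capvC capv_compl. Qed.

Fact qcoord_linear : linear qcoord.
Proof. by move=> a u v; apply/rowP => i; rewrite !mxE !linearP. Qed.
HB.instance Definition _ :=
  GRing.isLinear.Build _ _ _ _ qcoord qcoord_linear.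

Fact qlift_linear : linear qlift.
Proof.
move=> a u v; rewrite /qlift scaler_sumr -big_split /=; apply: eq_bigr => i _.
by rewrite !mxE scalerDl scalerA.
Qed.
HB.instance Definition _ :=
  GRing.isLinear.Build _ _ _ _ qlift qlift_linear.

Lemma qliftK v : v - qlift (qcoord v) \in W.
Proof.
have -> : qlift (qcoord v) = daddv_pi (W^C)%VS W v.
  rewrite [RHS](coord_vbasis (memv_pi (W^C)%VS W v)).
  by apply: eq_bigr => i _; rewrite mxE.
have vf : v \in (W^C + W)%VS by rewrite addvC addv_complf memvf.
by rewrite -{1}(daddv_pi_add cap0 vf) addrAC subrr add0r memv_pi.
Qed.

Lemma qcoord0 w : (qcoord w == 0) = (w \in W).
Proof.
apply/eqP/idP => [w0|wW]; first by have := qliftK w; rewrite w0 linear0 subr0.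
have vf : w \in (W^C + W)%VS by rewrite addvC addv_complf memvf.
have := daddv_pi_add cap0 vf; rewrite (daddv_pi_id _ wW) 1?capvC //.
move=> /(canRL (addrK _)); rewrite subrr => w0.
by apply/rowP => i; rewrite !mxE w0 linear0.
Qed.

Lemma qcoordK r : qcoord (qlift r) = r.
Proof.
apply/rowP => i; rewrite mxE daddv_pi_id //; last first.
  by apply: memv_suml => j _; apply: memvZ; apply: vbasis_mem; rewrite mem_nth ?size_tuple.
by rewrite coord_sum_free // (basis_free (vbasisP _)).
Qed.

Definition qmatrix (N : V -> V) : 'M[K]_m := \matrix_i qcoord (N B`_i).

Lemma qmatrixP (N : {linear V -> V}) v :
  (forall w, w \in W -> N w \in W) -> qcoord v *m qmatrix N = qcoord (N v).
Proof.
move=> NW; have -> : qcoord (N v) = qcoord (N (qlift (qcoord v))).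
  apply/eqP; rewrite -subr_eq0 -linearB -linearB qcoord0 NW //.
  exact: qliftK.
rewrite /qlift linear_sum linear_sum; apply/rowP => j; rewrite !mxE summxE.
apply: eq_bigr => i _.
by rewrite linearZ linearZ /= !mxE.
Qed.

End QuotientCoordinates.

Section Eigenvector.
Variables (K : closedFieldType) (V : vectType K).

Lemma eigenvector_mod (W : {vspace V}) (N : {linear V -> V}) :
  W != fullv -> (forall w, w \in W -> N w \in W) ->
  exists a mu, a \notin W /\ N a - mu *: a \in W.
Proof.
move=> Wf NW.
have m0 : (0 < \dim (W^C)%VS)%N.
  rewrite lt0n dimv_eq0; apply: contra Wf => /eqP W0.
  by have := addv_complf W; rewrite W0 addv0 => ->.
have [mu] : exists mu, eigenvalue (qmatrix W N) mu.
  have /closed_rootP[mu] : size (char_poly (qmatrix W N)) != 1.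
    by rewrite size_char_poly eqSS -lt0n.
  by rewrite -eigenvalue_root_char => e; exists mu.
move=> /eigenvalueP[r rE r0]; exists (qlift r), mu.
rewrite -!qcoord0 qcoordK r0; split=> //.
by rewrite linearB linearZ /= -qmatrixP // qcoordK rE subrr.
Qed.

End Eigenvector.

Lemma exists_functional (K : fieldType) (V : vectType K) (U : {vspace V}) y :
  y \notin U ->
  exists g : 'Hom(V, K^o), g y = 1 /\ forall u, u \in U -> g u = 0.
Proof.
move=> yU; have r0 : qcoord U y != 0 by rewrite qcoord0.
have [i ri] : exists i, qcoord U y 0 i != 0 by apply/rV0Pn.
pose g0 (v : V) : K^o := (qcoord U y 0 i)^-1 * qcoord U v 0 i.
have g0l : linear g0.
  by move=> a u v; rewrite /g0 linearP !mxE mulrDr mulrCA.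
pose g : {linear V -> K^o} := HB.pack g0 (GRing.isLinear.Build _ _ _ _ _ g0l).
exists (linfun g); split; first by rewrite lfunE /= /g0 mulVf.
move=> u uU; rewrite lfunE /= /g0.
have /eqP u0 : qcoord U u == 0 by rewrite qcoord0.
by have -> : qcoord U u 0 i = 0 by [rewrite u0 mxE]; rewrite mulr0.
Qed.

(** * Complex matrices as normed data *)

Section MatrixBdata.
Variables (R : realType) (m : nat).
Local Notation M := 'M[R[i]]_m.

Definition row_norm (v : 'rV[R[i]]_m) : R := \sum_i cnorm (v 0 i).

Lemma row_norm_ge0 v : 0 <= row_norm v.
Proof. by apply: sumr_ge0 => i _; apply: cnorm_ge0. Qed.

Lemma row_normD u v : row_norm (u + v) <= row_norm u + row_norm v.
Proof. by rewrite -big_split; apply: ler_sum => i _; rewrite mxE cnormD. Qed.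

Lemma row_normZ a v : row_norm (a *: v) = cnorm a * row_norm v.
Proof. by rewrite mulr_sumr; apply: eq_bigr => i _; rewrite mxE cnormM. Qed.

Lemma row_norm_eq0 v : row_norm v = 0 -> v = 0.
Proof.
move=> /eqP; rewrite psumr_eq0 => [/allP v0|i _]; last exact: cnorm_ge0.
apply/rowP => i; rewrite mxE; apply/eqP; rewrite -cnorm_eq0.
exact: (implyP (v0 i (mem_index_enum i))).
Qed.

Definition matrix_bd (q : M) (c : R) : Prop :=
  0 <= c /\ forall v, row_norm (v *m q) <= c * row_norm v.

(** No series is summed: [1 - q] is bounded below, hence injective, hence invertible in finite
    dimension. *)
Lemma matrix_neumann q c : matrix_bd q c -> c < 1 ->
  exists g, [/\ (1 - q) * g = 1, g * (1 - q) = 1 & matrix_bd g (1 - c)^-1].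
Proof.
move=> [c0 qc] c1.
have low v : (1 - c) * row_norm v <= row_norm (v *m (1 - q)).
  have := row_normD (v *m (1 - q)) (v *m q).
  rewrite -mulmxDr subrK mulmx1; have := qc v; lra.
have u : 1 - q \in unitmx.
  rewrite -row_free_unit; apply: inj_row_free => v vq; apply: row_norm_eq0.
  have := low v; rewrite vq /row_norm [X in _ <= X]big1 => [h|i _]; last first.
    by rewrite mxE cnorm0.
  by apply/eqP; rewrite eq_le row_norm_ge0 andbT; move: h; rewrite pmulr_rle0 // subr_gt0.
exists (invmx (1 - q)); split; [exact: mulmxV | exact: mulVmx |].
have c1' : 0 < 1 - c by rewrite subr_gt0.
split; first by rewrite invr_ge0 ltW.
by move=> v; rewrite mulrC ler_pdivlMr // mulrC -[in leRHS](mulmxKV u v).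
Qed.

(** Makes the weight arguments available for the adjoint action on quotients of [L], where they give
    the classical theorem of Lie. *)
Definition matrix_bdata : bdata R M.
Proof.
refine (@Bdata R M (fun a => a%:M) _ _ _ _ matrix_bd _ _ _ _ _ _ _).
- by move=> a b; rewrite raddfD.
- by move=> a b; exact: scalar_mxM.
- by [].
- by move=> a q; exact: etrans (mul_scalar_mx _ _) (esym (mul_mx_scalar _ _)).
- move=> q c c' [c0 qc] cc; split=> [|v]; first exact: le_trans cc.
  by apply: le_trans (qc v) _; rewrite ler_wpM2r // row_norm_ge0.
- by move=> q c [].
- move=> p q c c' [c0 pc] [c0' qc]; split=> [|v]; first exact: addr_ge0.
  rewrite mulmxDr mulrDl; apply: le_trans (row_normD _ _) _.
  by apply: lerD.
- move=> p q c c' [c0 pc] [c0' qc]; split=> [|v]; first exact: mulr_ge0.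
  rewrite mulmxA; apply: le_trans (qc _) _.
  by rewrite -mulrA mulrCA ler_wpM2l.
- by move=> a; split=> [|v]; rewrite ?cnorm_ge0 // mul_mx_scalar row_normZ.
- move=> q; exists (\sum_i row_norm (row i q)); split=> [|v].
    by apply: sumr_ge0 => i _; apply: row_norm_ge0.
  have -> : v *m q = \sum_i v 0 i *: row i q.
    apply/rowP => j; rewrite mxE summxE; apply: eq_bigr => i _.
    by rewrite !mxE.
  have nsum (r : seq 'I_m) (F : 'I_m -> 'rV[R[i]]_m) :
      row_norm (\sum_(i <- r) F i) <= \sum_(i <- r) row_norm (F i).
    elim: r => [|i r IH]; last first.
      by rewrite !big_cons; apply: le_trans (row_normD _ _) _; rewrite lerD2l.
    rewrite !big_nil /row_norm big1 // => i _; first by rewrite mxE cnorm0.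
  apply: le_trans (nsum _ _) _; rewrite mulr_suml; apply: ler_sum => i _.
  rewrite row_normZ mulrC ler_wpM2l ?row_norm_ge0 //.
  rewrite /row_norm (bigD1 i) //= lerDl; apply: sumr_ge0 => j _.
  exact: cnorm_ge0.
- exact: matrix_neumann.
Defined.

End MatrixBdata.

(** A chain from [U] up to [L]. As [U] is a subalgebra normalised by [y], it is an ideal of
    codimension 1 in [U + <[y]>]; inductions follow the chain upwards. *)
Inductive subnormal (K : fieldType) (L : lieAlgType K) : {vspace L} -> Prop :=
| SubnormalFull : subnormal fullv
| SubnormalStep (U : {vspace L}) (y : L) :
    y \notin U -> (forall u v, u \in U -> v \in U -> lieb u v \in U) ->
    (forall u, u \in U -> lieb y u \in U) ->
    subnormal (U + <[y]>)%VS -> subnormal U.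

Lemma exists_max_vspace (K : fieldType) (V : vectType K) (P : {vspace V} -> Prop) :
  P 0%VS -> exists W, P W /\ forall W', P W' -> (\dim W' <= \dim W)%N.
Proof.
move=> P0; pose p n := `[< exists W, P W /\ \dim W = n >].
have p0 : exists n, p n by exists (\dim (0%VS : {vspace V})); apply/asboolP; exists 0%VS.
have pb n : p n -> (n <= \dim {:V})%N.
  by move=> /asboolP[W [_ <-]]; apply/dimvS/subvf.
case: (ex_maxnP p0 pb) => n /asboolP[W [PW dW]] nmax.
by exists W; split=> // W' PW'; rewrite dW; apply: nmax; apply/asboolP; exists W'.
Qed.

Section AdLinear.
Variables (K : fieldType) (L : lieAlgType K) (y : L).
HB.instance Definition _ :=
  GRing.isLinear.Build K L L _ (lieb y) (@lieb_linearr K L y).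
End AdLinear.

Lemma liebC (K : fieldType) (L : lieAlgType K) (x y : L) : lieb x y = - lieb y x.
Proof.
have addl (u v z : L) : lieb (u + v) z = lieb u z + lieb v z.
  by have := lieb_linearl z 1 u v; rewrite !scale1r.
have := liebb (x + y); rewrite addl !linearD /= !liebb add0r addr0.
by move=> /eqP; rewrite addr_eq0 => /eqP.
Qed.

(** * Weights modulo right ideals *)

Section Weights.
Variables (R : realType) (Q : pzRingType) (A : bdata R Q).
Variable L : lieAlgType R[i].
Local Notation sc := (sc A).
Local Notation bd := (bd A).
Variable th : L -> Q.

Definition lie_rep :=
  (forall a u v, th (a *: u + v) = sc a * th u + th v) /\
  (forall u v, th (lieb u v) = th u * th v - th v * th u).

(** Equivalently, the [th u - f u] generate a proper right ideal: [f] is a point of the right joint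
    spectrum of [th] on [U]. *)
Definition weight (D : Q -> Prop) (U : {vspace L}) (f : 'Hom(L, R[i]^o)) :=
  [/\ right_ideal D, ~ D 1 & forall u, u \in U -> D (th u - sc (f u))].

Lemma one_in_near (D : Q -> Prop) d c :
  right_ideal D -> D d -> bd (1 - d) c -> c < 1 -> D 1.
Proof.
move=> [_ _ DM] dD d1 c1; have [g [g1 _ _]] := neumann d1 c1.
by rewrite -g1 opprB addrC subrK; apply: DM.
Qed.

Section Commutation.
Variables (D : Q -> Prop) (Y : Q) (B : nat -> Q) (mu s f0 : R[i]).
Hypothesis Dr : right_ideal D.
Hypothesis YB : forall j, Y * B j = B j * Y + B j.+1.
Hypothesis B0 : D (B 0%N - sc f0).
Hypothesis BS : forall j, D (B j.+1 - sc (mu ^+ j * s)).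

Let DD x y : D x -> D y -> D (x + y). Proof. by case: Dr => _ h _; apply: h. Qed.
Let DM x q : D x -> D (x * q). Proof. by case: Dr => _ _ h; apply: h. Qed.
Let DB x y : D x -> D y -> D (x - y).
Proof. by move=> ? /(DM (-1)); rewrite mulrN1; apply: DD. Qed.
Let Dsc a x : D x -> D (sc a * x). Proof. by rewrite scC; apply: DM. Qed.

(** [D] absorbs only on the right, so each [Y] is moved to the right of [B]; the geometric values
    produced on the way add up to a binomial power. *)
Let YnBS n j : D (Y ^+ n * B j.+1 - sc (mu ^+ j * s) * (Y + sc mu) ^+ n).
Proof.
elim: n j => [|n IH] j; first by rewrite !expr0 mul1r mulr1.
rewrite exprSr -mulrA YB.
have -> : Y ^+ n * (B j.+1 * Y + B j.+2)
     - sc (mu ^+ j * s) * (Y + sc mu) ^+ n.+1 =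
  (Y ^+ n * B j.+1 - sc (mu ^+ j * s) * (Y + sc mu) ^+ n) * Y
   + (Y ^+ n * B j.+2 - sc (mu ^+ j.+1 * s) * (Y + sc mu) ^+ n).
  rewrite (exprSr (Y + _)) (exprS mu) -(mulrA mu) (scM A mu); set Z := (Y + sc mu) ^+ n; set b := sc (_ * s).
  have -> : sc mu * b * Z = b * (Z * sc mu) by rewrite -(scC A mu Z) mulrA (scC A mu b).
  by nc_ring.
by apply: DD => //; apply: DM.
Qed.

(** The Heisenberg relation: modulo [D], right multiplication by [B 0 - f0] acts on powers of [Y] as
    [s] times the derivative, so [n] applications to [Y ^ n] leave [n! s ^ n]. *)
Lemma commutation_mu0 n : mu = 0 ->
  D (sc ((n`!)%:R * s ^+ n) - Y ^+ n * (B 0%N - sc f0) ^+ n).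
Proof.
move=> mu0; set E := B 0%N - _.
have YE k : D (Y ^+ k.+1 * E - sc (k.+1%:R * s) * Y ^+ k).
  have YB0 j : D (Y ^+ j * E - sc (j%:R * s) * Y ^+ j.-1).
    elim: j => [|j IH]; first by rewrite expr0 !mul0r sc0 mul0r subr0 mul1r.
    have h := YnBS j 0; rewrite mu0 expr0 mul1r sc0 addr0 in h.
    have -> : Y ^+ j.+1 * E - sc (j.+1%:R * s) * Y ^+ j.+1.-1 =
       (Y ^+ j * E - sc (j%:R * s) * Y ^+ j.-1) * Y + (Y ^+ j * B 1%N - sc s * Y ^+ j).
      have -> : sc (j.+1%:R * s) = sc (j%:R * s) + sc s.
        by rewrite -scD -[j.+1]addn1 natrD mulrDl mul1r.
      have jj : sc (j%:R * s) * Y ^+ j.-1 * Y = sc (j%:R * s) * Y ^+ j.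
        case: (j) => [|i]; first by rewrite mul0r sc0 !mul0r.
        by rewrite -mulrA -exprSr.
      rewrite mulrBl jj exprSr /= /E.
      have -> : Y ^+ j * Y * (B 0%N - sc f0) = Y ^+ j * (B 0%N - sc f0) * Y + Y ^+ j * B 1%N.
        by rewrite -!mulrA mulrBr YB -(scC A f0 Y); nc_ring.
      by nc_ring.
    by apply: DD => //; apply: DM.
  exact: YB0.
elim: n => [|n IH]; first by rewrite !expr0 !mulr1 sc1 subrr; case: Dr.
have -> : sc ((n.+1`!)%:R * s ^+ n.+1) - Y ^+ n.+1 * E ^+ n.+1 =
   sc (n.+1%:R * s) * (sc ((n`!)%:R * s ^+ n) - Y ^+ n * E ^+ n)
   - (Y ^+ n.+1 * E - sc (n.+1%:R * s) * Y ^+ n) * E ^+ n.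
  have -> : sc ((n.+1`!)%:R * s ^+ n.+1) = sc (n.+1%:R * s) * sc ((n`!)%:R * s ^+ n).
    rewrite -scM; have -> : (n.+1`!)%:R * s ^+ n.+1 =
        n.+1%:R * s * ((n`!)%:R * s ^+ n) by rewrite factS natrM exprS; ring.
    by [].
  by rewrite (exprS E); nc_ring.
by apply: DB; [apply: Dsc | apply: DM].
Qed.

(** The affine relation: modulo [D], right multiplication by the normalised [B 0] translates [Y] by
    [mu]. *)
Lemma commutation_mu n : mu != 0 -> s != 0 ->
  D (Y ^+ n * (sc (mu / s) * (B 0%N - sc f0) + 1) - (Y + sc mu) ^+ n).
Proof.
move=> mu0 s0; set E := _ * _ + 1.
elim: n => [|n IH].
  rewrite !expr0 mul1r /E addrK; exact: Dsc.
have h := YnBS n 0; rewrite expr0 mul1r in h.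
have -> : Y ^+ n.+1 * E - (Y + sc mu) ^+ n.+1 =
  (Y ^+ n * E - (Y + sc mu) ^+ n) * Y
  + sc (mu / s) * (Y ^+ n * B 1%N - sc s * (Y + sc mu) ^+ n).
  rewrite !exprSr; set Z := (Y + sc mu) ^+ n.
  have -> : Y ^+ n * Y * E = Y ^+ n * E * Y + sc (mu / s) * (Y ^+ n * B 1%N).
    have YE : Y * E = E * Y + sc (mu / s) * B 1%N.
      rewrite /E mulrDr mulrA -(scC A (mu / s) Y) -[_ * Y * _]mulrA mulrBr YB.
      by rewrite -(scC A f0 Y); nc_ring.
    by rewrite -mulrA YE (scC A (mu / s) (_ * B _)) -(scC A); rewrite mulrDr !mulrA -(scC A _ (Y ^+ n)).
  have -> : sc (mu / s) * (Y ^+ n * B 1%N - sc s * Z) =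
     sc (mu / s) * (Y ^+ n * B 1%N) - Z * sc mu.
    by rewrite mulrBr (mulrA _ (sc s)) -scM mulfVK // -(scC A mu).
  by nc_ring.
by apply: DD; [apply: DM | apply: Dsc].
Qed.

End Commutation.

End Weights.

Section WeightExtension.
Variables (R : realType) (Q : pzRingType) (A : bdata R Q).
Variable L : lieAlgType R[i].
Local Notation sc := (sc A).
Local Notation bd := (bd A).
Variable th : L -> Q.
Hypothesis thr : lie_rep A th.

Let thZ a u : th (a *: u) = sc a * th u.
Proof.
case: thr => lin _; have := lin 1 0 0; rewrite scaler0 addr0 sc1 mul1r.
move=> h; have th0 : th 0 = 0 by apply: (addrI (th 0)); rewrite addr0 -h.
by rewrite -[a *: u]addr0 lin th0 addr0.
Qed.

Let thD u v : th (u + v) = th u + th v.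
Proof. by case: thr => lin _; rewrite -[u]scale1r lin sc1 mul1r scale1r. Qed.

Let lfunDZ (f : 'Hom(L, R[i]^o)) u c y : f (u + c *: y) = f u + c * f y.
Proof. by rewrite linearD linearZ. Qed.

(** Take a maximal [N]-stable [W] on which [f] composed with [N] vanishes, and an eigenvector [a] of
    [N] modulo [W]. Were [f (N a) = 0], [W + <[a]>] would contradict maximality; so the values along
    the orbit of [a] are geometric and not zero. *)
Lemma adjoint_functional (f : 'Hom(L, R[i]^o)) (U : {vspace L}) y u0 :
  (forall u, u \in U -> lieb y u \in U) -> u0 \in U -> f (lieb y u0) != 0 ->
  exists a mu s, [/\ a \in U, s != 0 &
    forall j, f (iter j.+1 (lieb y) a) = mu ^+ j * s].
Proof.
move=> yU u0U fu0; pose N : {linear L -> L} := (lieb y \o projv U).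
have NU x : N x \in U by apply: yU; apply: memv_proj.
pose P (W : {vspace L}) := (forall w, w \in W -> N w \in W) /\ (forall w, w \in W -> f (N w) = 0).
have P0 : P 0%VS.
  by split=> w; rewrite memv0 => /eqP ->; rewrite !linear0 ?mem0v.
have [W [[NW fW] Wmax]] := exists_max_vspace P0.
have Wf : W != fullv.
  apply: contra fu0 => /eqP Wf; apply/eqP; have := fW u0.
  by rewrite Wf memvf /= projv_id // => ->.
have [a [mu [aW Na]]] := eigenvector_mod Wf NW.
pose s := f (N a).
have s0 : s != 0.
  apply/eqP => s0; have PW' : P (W + <[a]>)%VS.
    split=> _ /memv_addP[w wW [_ /vlineP[c ->] ->]]; rewrite !linearD !linearZ /=.
      have -> : c *: N a = c *: (N a - mu *: a) + (c * mu) *: a.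
        by rewrite scalerBr scalerA subrK.
      rewrite addrA; apply: memv_add; last by rewrite memvZ // memv_line.
      by apply: memvD; [exact: NW | exact: memvZ].
    by rewrite -/(N w) -/(N a) fW // -/s s0 scaler0 addr0.
  have sub : (W <= W + <[a]>)%VS by apply: addvSl.
  have /eqP E : W == (W + <[a]>)%VS by rewrite eqEdim sub Wmax.
  by move/negP: aW; apply; rewrite E memvE addvSr.
have iterN j : iter j N a - mu ^+ j *: a \in W.
  elim: j => [|j IH]; first by rewrite expr0 scale1r subrr mem0v.
  have -> : iter j.+1 N a - mu ^+ j.+1 *: a =
     N (iter j N a - mu ^+ j *: a) + mu ^+ j *: (N a - mu *: a).
    have -> : N (iter j N a - mu ^+ j *: a) = N (iter j N a) - mu ^+ j *: N a.
      by rewrite linearB linearZ.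
    by rewrite scalerBr scalerA -exprSr addrA subrK.
  by apply: memvD; [exact: NW | exact: memvZ].
exists (projv U a), mu, s; split=> //; first exact: memv_proj.
move=> j; have -> : iter j.+1 (lieb y) (projv U a) = iter j.+1 N a.
  elim: j => [//|j IH]; rewrite [LHS]iterS IH [RHS]iterS.
  by rewrite -[RHS]/(lieb y (projv U (iter j.+1 N a))) projv_id // iterS NU.
have := fW _ (iterN j).
have -> : N (iter j N a - mu ^+ j *: a) = N (iter j N a) - mu ^+ j *: N a.
  by rewrite linearB linearZ.
by rewrite linearB linearZ => /eqP; rewrite subr_eq0 => /eqP.
Qed.

(** The central point of Lie's theorem. A trace argument is impossible here; a nonzero value on a
    bracket would instead contradict the norm bounds on powers. *)
Theorem weight_lieb0 D U f y : weight A th D U f ->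
  (forall u, u \in U -> lieb y u \in U) ->
  forall u, u \in U -> f (lieb y u) = 0.
Proof.
move=> [Dr D1 Df] yU u0 u0U; apply/eqP/negPn/negP => fu0.
have [a [mu [s [aU s0 fa]]]] := adjoint_functional yU u0U fu0.
pose Y := th y; pose B j := th (iter j (lieb y) a).
have iU j : iter j (lieb y) a \in U by elim: j => [//|j IH]; apply: yU.
have YB j : Y * B j = B j * Y + B j.+1.
  by rewrite /B iterS; case: thr => _ ->; rewrite addrC subrK.
have BS j : D (B j.+1 - sc (mu ^+ j * s)) by rewrite -fa; apply: Df.
have DE0 : D (B 0%N - sc (f a)) by apply: Df.
set E0 := B 0%N - sc (f a) in DE0.
have [T YT] := bd_ex A Y; have T0 := bd_ge0 YT.
apply: D1; have [mu0|mu0] := eqVneq mu 0.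
  have H n := commutation_mu0 (f0 := f a) Dr YB DE0 BS n mu0.
  have [c Ec] := bd_ex A E0; have c0 := bd_ge0 Ec.
  have sn0 : 0 < cnorm s by rewrite cnorm_gt0.
  (* [Y ^ n E0 ^ n] is [n! s ^ n] modulo [D] but has norm at most [(T c) ^ n]: the quotient is a
     coefficient of an exponential series. *)
  have [n nh] : exists n, exp_coeff (T * c / cnorm s) n <= 2^-1.
    have /cvg_series_cvg_0/cvgrPdist_le /(_ 2^-1) :=
      is_cvg_series_exp_coeff (T * c / cnorm s).
    rewrite invr_gt0 => /(_ (ltr0n _ 2)) [n _ /(_ n (leqnn n)) h]; exists n.
    by move: h; rewrite /= sub0r normrN; apply: le_trans (ler_norm _).
  pose b := (n`!)%:R * s ^+ n.
  have b0 : b != 0 by rewrite mulf_neq0 ?expf_neq0 // pnatr_eq0 -lt0n fact_gt0.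
  have D1 : D (1 - sc b^-1 * (Y ^+ n * E0 ^+ n)).
    rewrite -(scV A b0) -mulrBr scC; case: Dr => _ _; apply; exact: H.
  apply: (one_in_near (c := 2^-1) Dr D1); last by lra.
  rewrite opprB addrC subrK.
  apply: bd_le (bdM (bd_sc A _) (bdM (bdX n YT) (bdX n Ec))) _.
  apply: le_trans nh; rewrite /exp_coeff /= cnormV cnormM cnormX.
  have -> : cnorm ((n`!)%:R : R[i]) = (n`!)%:R.
    by rewrite -(rmorph_nat (@real_complex R)) cnormR ger0_norm.
  rewrite !exprMn exprVn le_eqVlt; apply/orP; left; apply/eqP; field.
  by rewrite pnatr_eq0 -lt0n fact_gt0 expf_neq0 // gt_eqF.
(* After [k] translations [Y ^ n E ^ k] equals [(Y + k mu) ^ n] modulo [D]. With [k] fixed so that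
   [k mu] exceeds [3 T'], the inverse of the latter has norm at most [(2 T') ^ (- n)], and the left
   side at most [T' ^ n c ^ k]: large [n] is contradictory. *)
pose Yk k := Y + sc (k%:R * mu).
have YkB k j : Yk k * B j = B j * Yk k + B j.+1.
  by rewrite /Yk mulrDl YB mulrDr -(scC A _ (B j)); nc_ring.
pose E := sc (mu / s) * E0 + 1.
have YkE k n : D (Yk k ^+ n * E - Yk k.+1 ^+ n).
  have := commutation_mu (f0 := f a) Dr (YkB k) DE0 BS n mu0 s0.
  by rewrite -/E0 -/E; congr (D (_ - _ ^+ n)); rewrite /Yk -addrA -scD mulrSr mulrDl mul1r.
have YE k n : D (Y ^+ n * E ^+ k - Yk k ^+ n).
  elim: k => [|k IH].
    by rewrite expr0 mulr1 /Yk mul0r sc0 addr0 subrr; case: Dr.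
  have -> : Y ^+ n * E ^+ k.+1 - Yk k.+1 ^+ n =
    (Y ^+ n * E ^+ k - Yk k ^+ n) * E + (Yk k ^+ n * E - Yk k.+1 ^+ n).
    by rewrite exprSr; nc_ring.
  by case: Dr => _ DD DM; apply: DD => //; apply: DM.
have [c Ec] := bd_ex A E; have c0 := bd_ge0 Ec.
have mn0 : 0 < cnorm mu by rewrite cnorm_gt0.
pose T' := T + 1.
pose k := (Num.truncn (3 * T' / cnorm mu)).+1.
have kT : 3 * T' < cnorm (k%:R * mu).
  rewrite cnormM -(rmorph_nat (@real_complex R)) cnormR ger0_norm //.
  by rewrite -ltr_pdivrMr // truncnS_gt.
have [||g [g1 _ gb]] := @bd_resolvent _ _ A Y T' (- (k%:R * mu)).
- by apply: bd_le YT _; rewrite lerDl.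
- rewrite cnormN; apply: le_lt_trans kT; rewrite /T'; lra.
rewrite scN opprK -/(Yk k) in g1; rewrite cnormN in gb.
have T'0 : 0 < T' by rewrite /T'; lra.
have gT : bd g (2 * T')^-1.
  apply: bd_le gb _; rewrite lef_pV2 ?posrE; lra.
have gX n : Yk k ^+ n * g ^+ n = 1.
  elim: n => [|n IH]; first by rewrite !expr0 mulr1.
  by rewrite exprSr exprS mulrA -(mulrA _ (Yk k) g) g1 mulr1.
have [n nh] : exists n, c ^+ k * 2^-1 ^+ n <= 2^-1.
  have ck0 : 0 <= c ^+ k by rewrite exprn_ge0.
  exists (Num.truncn (2 * c ^+ k)).+1.
  rewrite exprVn ler_pdivrMr ?exprn_gt0 // -ler_pdivrMl ?invr_gt0 // invrK.
  apply: le_trans (ltW (truncnS_gt _)) _.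
  by rewrite -natrX ler_nat ltnW // ltn_expl.
apply: (@one_in_near _ _ A D ((Yk k ^+ n - Y ^+ n * E ^+ k) * g ^+ n) 2^-1 Dr).
- case: Dr => _ _ DM; apply: (DM); rewrite -opprB -mulrN1; apply: (DM); exact: YE.
- rewrite mulrBl gX opprB addrC subrK.
  have YT' : bd Y T' by apply: bd_le YT _; rewrite lerDl.
  apply: bd_le (bdM (bdM (bdX n YT') (bdX k Ec)) (bdX n gT)) _.
  apply: le_trans nh; rewrite invfM exprMn mulrAC !exprVn.
  have Tn0 : T' ^+ n != 0 by rewrite expf_neq0 // gt_eqF.
  by rewrite [2 ^- n * _]mulrC mulrA divff // mul1r mulrC.
by lra.
Qed.

(** The generated right ideal, as an intersection: a property of all its elements is proved by
    instantiating [D'] with that property. *)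
Definition gen_ideal (U : {vspace L}) (f : L -> R[i]) (x : Q) :=
  forall D', right_ideal D' -> (forall u, u \in U -> D' (th u - sc (f u))) -> D' x.

Lemma gen_ideal_right U f : right_ideal (gen_ideal U f).
Proof.
split=> [D' [? _ _] _ //|x y xG yG D' Dr' DU|x q xG D' Dr' DU].
  by case: (Dr') => _ DD _; apply: DD; [apply: xG|apply: yG].
by case: (Dr') => _ _ DM; apply: DM; apply: xG.
Qed.

(** The generated ideal, unlike an arbitrary [D], is stable under left multiplication by [th y],
    because [f] kills the brackets with [y]. So some [th y - l] is not onto modulo it; adding the
    right multiples of [th y - l] keeps it proper, and [l] becomes the value at [y]. *)
Lemma weight_extend_step D U f y : weight A th D U f -> y \notin U ->
  (forall u, u \in U -> lieb y u \in U) ->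
  exists D' f', weight A th D' (U + <[y]>)%VS f' /\ forall u, u \in U -> f' u = f u.
Proof.
move=> wD yU Uy; have f0 := weight_lieb0 wD Uy.
case: wD => Dr D1 Df.
pose G := gen_ideal U f.
have [G0 GD GM] := gen_ideal_right U f; have Gr := gen_ideal_right U f.
have GU u : u \in U -> G (th u - sc (f u)) by move=> uU D' _; apply.
have G1 : ~ G 1 by move=> /(_ D Dr Df).
have YG x : G x -> G (th y * x).
  (* The elements that [th y] sends into [G] form a right ideal; it remains to find the generators
     in it. *)
  move=> /(_ (fun x => G (th y * x))); apply.
    split=> [|a b|a q]; rewrite ?mulr0 ?mulrDr ?mulrA //; [exact: GD|exact: GM].
  move=> u uU; have -> : th y * (th u - sc (f u)) =
      (th u - sc (f u)) * th y + (th (lieb y u) - sc (f (lieb y u))).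
    rewrite f0 // sc0 subr0; case: thr => _ ->; rewrite mulrBr mulrBl.
    by rewrite (scC A _ (th y)); nc_ring.
  apply: GD.
    by apply: GM; apply: GU.
  by apply: GU; apply: Uy.
have [l lP] : exists l, ~ exists b, G ((th y - sc l) * b - 1).
  apply/existsNP => /= H; apply: G1; exact: (surjective_everywhere (A := A) Gr YG).
pose D' x := exists d b, G d /\ x = d + (th y - sc l) * b.
have [g [gy gU]] := exists_functional yU.
pose f' := f + (l - f y) *: g.
have f'U u : u \in U -> f' u = f u.
  by move=> uU; rewrite add_lfunE scale_lfunE gU // scaler0 addr0.
exists D', f'; split=> //; split.
- split.
  + by exists 0, 0; rewrite mulr0 addr0.
  + move=> _ _ [d [b [dG ->]]] [d' [b' [dG' ->]]]; exists (d + d'), (b + b').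
    by rewrite mulrDr addrACA; split=> //; apply: GD.
  by move=> _ q [d [b [dG ->]]]; exists (d * q), (b * q); rewrite mulrDl mulrA; split=> //; apply: GM.
- move=> [d [b [dG E]]]; apply: lP; exists b.
  by rewrite E opprD addrCA subrr addr0 -mulrN1; apply: GM.
move=> _ /memv_addP[u uU [_ /vlineP[c ->] ->]].
exists (th u - sc (f u)), (sc c); split; first exact: GU.
have f'y : f' y = l.
  by rewrite add_lfunE scale_lfunE gy /= -[_ *: 1]/(_ * 1) mulr1 addrC subrK.
have -> : f' (u + c *: y) = f u + c * l by rewrite lfunDZ f'U // f'y.
rewrite thD thZ scD (scM A c l) -(scC A c (th y - sc l)).
by nc_ring.
Qed.

Theorem weight_extend D U f : subnormal U -> weight A th D U f ->
  exists D' f', weight A th D' fullv f' /\ forall u, u \in U -> f' u = f u.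
Proof.
move=> nU; elim: nU D f => [D f wD|{}U y yU _ Uy _ IH D f wD]; first by exists D, f.
have [D1 [f1 [w1 E1]]] := weight_extend_step wD yU Uy.
have [D2 [f2 [w2 E2]]] := IH _ _ w1; exists D2, f2; split=> // u uU.
by rewrite E2 ?E1 // memvE (subv_trans _ (addvSl _ _)).
Qed.

End WeightExtension.

(** * Chains of codimension 1 ideals *)

Section Chains.
Variables (K : fieldType) (L : lieAlgType K).
Implicit Types (U W : {vspace L}).

Lemma hyperplane_above (V : vectType K) (U W : {vspace V}) :
  (W <= U)%VS -> W != U ->
  exists H y, [/\ (W <= H)%VS, (H <= U)%VS, y \notin H & (H + <[y]>)%VS = U].
Proof.
move=> WU WnU.
have [y yU yW] : exists2 y, y \in U & y \notin W.
  have /subvPn[y] : ~~ (U <= W)%VS by apply: contra WnU => h; rewrite eqEsubv WU.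
  by exists y.
have [g [gy gW]] := exists_functional yW.
exists (U :&: lker g)%VS, y; split.
- by apply/subvP => w wW; rewrite memv_cap (subvP WU) //= memv_ker gW.
- exact: capvSl.
- by rewrite memv_cap memv_ker gy /= oner_eq0 andbF.
apply/eqP; rewrite eqEsubv; apply/andP; split.
  by rewrite subv_add capvSl /= -memvE.
apply/subvP => v vU; rewrite -[v](subrK (g v *: y)) memv_add ?memvZ ?memv_line //.
rewrite memv_cap memvB ?memvZ //= memv_ker linearB linearZ /= gy.
by rewrite -[_ *: 1]/(_ * 1) mulr1 subrr.
Qed.

Definition is_subalg U := forall u v, u \in U -> v \in U -> lieb u v \in U.

Lemma memv_lieprod U W u w : u \in U -> w \in W -> lieb u w \in lieprod U W.
Proof. by move=> uU wW; have /lieprod_subP := subvv (lieprod U W); apply. Qed.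

Lemma subnormal_of_proper W : is_subalg W ->
  (forall U, is_subalg U -> (W <= U)%VS -> (U <= W + lieprod U U)%VS -> U = W) ->
  subnormal W.
Proof.
move=> Wa H.
have main n U : (\dim U <= n)%N -> is_subalg U -> (W <= U)%VS -> subnormal U -> subnormal W.
  elim: n U => [|n IH] U dU Ua WU nU.
    by rewrite -[W](_ : U = _) //; apply/eqP; rewrite eq_sym eqEdim WU (leq_trans dU).
  have [<-//|WnU] := eqVneq U W.
  have UU : (lieprod U U <= U)%VS by apply/lieprod_subP.
  have sub : (W + lieprod U U <= U)%VS by rewrite subv_add WU.
  have ne : (W + lieprod U U)%VS != U.
    by apply: contra WnU => /eqP E; rewrite (H U) // E.
  have [V [y [WV VU yV Vy]]] := hyperplane_above sub ne.
  have PV : (lieprod U U <= V)%VS by apply: subv_trans WV; apply: addvSr.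
  have yU : y \in U by rewrite -Vy memvE addvSr.
  have Va : is_subalg V.
    by move=> u v uV vV; apply: (subvP PV); apply: memv_lieprod; apply: (subvP VU).
  apply: (IH V) => //.
  - rewrite -ltnS; apply: leq_trans dU; rewrite ltnNge; apply: contra yV => h.
    have /eqP -> : V == U by rewrite eqEdim VU.
    by [].
  - by apply: subv_trans WV; apply: addvSl.
  apply: (SubnormalStep yV Va); last by rewrite Vy.
  by move=> u uV; apply: (subvP PV); apply: memv_lieprod => //; apply: (subvP VU).
apply: (main (\dim {:L}) fullv) => //; first by move=> u v _ _; apply: memvf.
  exact: subvf.
exact: SubnormalFull.
Qed.

Lemma lieb_addl (u v w : L) : lieb (u + v) w = lieb u w + lieb v w.
Proof. by have := lieb_linearl w 1 u v; rewrite !scale1r. Qed.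

Lemma lieb_scalel a (u w : L) : lieb (a *: u) w = a *: lieb u w.
Proof. by rewrite liebC linearZ /= -scalerN -liebC. Qed.

(** The inclusion of [U] in [W + [U, U]] propagates along the derived series, as an ideal [W]
    absorbs the mixed brackets. *)
Lemma subnormal_ideal W : lie_solvable L -> is_lie_ideal W -> subnormal W.
Proof.
move=> [m mL] Wi.
have Wi' x y : x \in W -> lieb x y \in W by move=> xW; rewrite liebC memvN; apply: Wi.
apply: subnormal_of_proper => [u v _|U Ua WU UW]; first exact: Wi.
have H k : (U <= W + iter k (fun U => lieprod U U) {:L}%VS)%VS.
  elim: k => [|k IH]; first by rewrite /= (subv_trans (subvf _)) // addvSr.
  apply: (subv_trans UW); rewrite subv_add addvSl /=; apply/lieprod_subP.
  move=> u v /(subvP IH)/memv_addP[w wW [d dD ->]].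
  move=> /(subvP IH)/memv_addP[w' wW' [d' dD' ->]].
  rewrite lieb_addl [lieb d _]linearD addrA; apply: memv_add; last exact: memv_lieprod.
  by apply: memvD; [apply: Wi' | apply: Wi].
by apply/eqP; rewrite eqEsubv WU andbT; have := H m; rewrite mL addv0.
Qed.

(** Here mixed brackets are absorbed by the next term of the lower central series. *)
Lemma subnormal_nilpotent W : lie_nilpotent L -> is_subalg W -> subnormal W.
Proof.
move=> [m mL] Wa; apply: subnormal_of_proper => // U Ua WU UW.
have H k : (U <= W + iter k (lieprod {:L}) {:L}%VS)%VS.
  elim: k => [|k IH]; first by rewrite /= (subv_trans (subvf _)) // addvSr.
  apply: (subv_trans UW); rewrite subv_add addvSl /=; apply/lieprod_subP.
  move=> u v /(subvP IH)/memv_addP[w wW [d dD ->]].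
  move=> /(subvP IH)/memv_addP[w' wW' [d' dD' ->]].
  rewrite lieb_addl ![lieb _ (w' + _)]linearD /= -addrA.
  apply: memv_add; first exact: Wa.
  apply: memvD; first by apply: memv_lieprod; rewrite ?memvf.
  by apply: memvD; [rewrite liebC memvN|]; apply: memv_lieprod; rewrite ?memvf.
by apply/eqP; rewrite eqEsubv WU andbT; have := H m; rewrite mL addv0.
Qed.

End Chains.

(** * Lie's theorem and invertibility of shifted brackets *)

Section LieTheorem.
Variables (R : realType) (L : lieAlgType R[i]).
Hypothesis Lsol : lie_solvable L.

(** If the columns of the [B i] spanned everything, 1 would be a sum of right multiples of them and
    lie in [D]; otherwise some row kills them all. *)
Lemma proper_right_ideal_null m (D : 'M[R[i]]_m -> Prop) n (B : 'I_n -> 'M[R[i]]_m) :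
  right_ideal D -> ~ D 1 -> (forall i, D (B i)) ->
  exists r : 'rV_m, r != 0 /\ forall i, r *m B i = 0.
Proof.
move=> [D0 DD DM] D1 DB.
pose S := (\sum_i (B i)^T)%MS.
have [full|notfull] := boolP (row_full S).
  have /sub_sumsmxP[u E] : (1%:M <= S)%MS by rewrite sub1mx.
  case: D1; have -> : 1 = \sum_i B i *m (u i)^T :> 'M[R[i]]_m.
    apply: trmx_inj; rewrite -[LHS]/(1%:M^T) trmx1 E linear_sum.
    by apply: eq_bigr => i _; rewrite /= trmx_mul trmxK.
  by apply: big_ind => // i _; apply: DM.
have : cokermx S != 0.
  apply: contra notfull => /eqP S0.
  have := mxrank_coker S; rewrite S0 mxrank0 => /esym/eqP.
  rewrite subn_eq0 => h; rewrite /row_full eqn_leq rank_leq_col; exact: h.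
move=> /matrix0Pn[i [j cij]]; exists (col j (cokermx S))^T; split.
  by apply/rV0Pn; exists i; rewrite mxE [col _ _ _ _]mxE.
move=> k; apply: trmx_inj; rewrite trmx_mul trmxK trmx0.
have /submxP[X ->] : ((B k)^T <= S)%MS by apply: (sumsmx_sup k).
have Sc : S *m col j (cokermx S) = 0 by rewrite colE mulmxA mulmx_coker mul0mx.
by rewrite -mulmxA Sc mulmx0.
Qed.

(* Lie's theorem for the adjoint action on [L / W]. *)
Theorem ideal_eigenvector (W : {vspace L}) : is_lie_ideal W -> W != fullv ->
  exists a (mu : 'Hom(L, R[i]^o)), [/\ a \notin W,
    forall l, lieb l a - mu l *: a \in W & forall u v, mu (lieb u v) = 0].
Proof.
(* Acting on rows reverses products; the sign turns the result back into a representation. *)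
move=> Wi Wf; pose th l := - qmatrix W (lieb l).
pose A := matrix_bdata R (\dim (W^C)%VS).
have Wad l w : w \in W -> lieb l w \in W by apply: Wi.
have qad l r : r *m th l = - qcoord W (lieb l (qlift r)).
  by rewrite mulmxN -{1}[r](qcoordK (W := W)) (qmatrixP _ (Wad l)).
have thr : lie_rep A th.
  split=> [a u v|u v].
    apply/row_matrixP => i; rewrite !rowE qad mulmxDr [_ *m (sc A a * _)]mulmxA.
    rewrite mul_mx_scalar -scalemxAl !qad; set x := qlift _.
    have -> : lieb (a *: u + v) x = a *: lieb u x + lieb v x by apply: lieb_linearl.
    by rewrite linearD linearZ /= opprD scalerN.
  apply/row_matrixP => i; rewrite !rowE qad mulmxBr.
  rewrite -[th u * th v]/(th u *m th v) -[th v * th u]/(th v *m th u).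
  have qq w w' r : r *m (th w *m th w') = qcoord W (lieb w' (lieb w (qlift r))).
    by rewrite mulmxA (qad w r) mulNmx mulmxN opprK (qmatrixP _ (Wad w')).
  rewrite !qq -linearB; set x := qlift _; rewrite -linearN; congr (qcoord W _).
  have := lieb_jacobi u v x.
  rewrite (liebC x u) linearN /= (liebC x (lieb u v)) => /eqP.
  rewrite subr_eq0 => /eqP <-; by rewrite opprD opprK addrC.
have m0 : (0 < \dim (W^C)%VS)%N.
  rewrite lt0n dimv_eq0; apply: contra Wf => /eqP W0.
  by have := addv_complf W; rewrite W0 addv0 => ->.
(* The zero ideal is a weight on the zero subalgebra, from which the extension to [L] starts. *)
have w0 : weight A th (eq^~ 0) 0%VS 0.
  split; first by split=> [|_ _ -> ->|_ q ->]; rewrite ?addr0 ?mul0r.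
    move=> /matrixP/(_ (Ordinal m0) (Ordinal m0)) /eqP.
    by rewrite !mxE eqxx oner_eq0.
  move=> u; rewrite memv0 => /eqP ->; rewrite linear0 sc0 subr0.
  apply/row_matrixP => i; rewrite !rowE qad.
  have -> : lieb 0 (qlift ('e_i : 'rV_(\dim (W^C)%VS))) = (0 : L).
    by rewrite liebC linear0 oppr0.
  by rewrite linear0 oppr0 mulmx0.
have n0 : subnormal (0%VS : {vspace L}).
  by apply: subnormal_ideal => // x y; rewrite !memv0 => /eqP ->; rewrite linear0.
have [D [f [wD _]]] := weight_extend thr n0 w0.
have [Dr D1 Df] := wD.
have [r [r0 rB]] := proper_right_ideal_null Dr D1
  (fun i : 'I_(\dim {:L}) => Df (vbasis {:L})`_i (memvf _)).
have rf l : qcoord W (lieb l (qlift r)) = - (f l *: r).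
  have key v : qcoord W (lieb v (qlift r)) + f v *: r = - (r *m (th v - sc A (f v))).
    by rewrite mulmxBr qad mul_mx_scalar opprB opprK addrC.
  apply/eqP; rewrite -addr_eq0.
  have add u v a : qcoord W (lieb (a *: u + v) (qlift r)) + f (a *: u + v) *: r =
     a *: (qcoord W (lieb u (qlift r)) + f u *: r) + (qcoord W (lieb v (qlift r)) + f v *: r).
    have -> : lieb (a *: u + v) (qlift r) = a *: lieb u (qlift r) + lieb v (qlift r).
      exact: lieb_linearl.
    rewrite linearP linearP /= scalerDl scalerDr scalerA addrACA.
    by [].
  pose g v := qcoord W (lieb v (qlift r)) + f v *: r.
  have gl : linear g by move=> a u v; apply: add.
  pose G : {linear L -> 'rV_(\dim (W^C)%VS)} := HB.pack g (GRing.isLinear.Build _ _ _ _ g gl).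
  rewrite -/(g l) -[g l]/(G l) (coord_vbasis (memvf l)) linear_sum big1 // => i _.
  by rewrite linearZ /= /g key rB oppr0 scaler0.
exists (qlift r), (- f); split.
- by rewrite -qcoord0 qcoordK.
- move=> l; rewrite opp_lfunE scaleNr opprK -qcoord0 linearD linearZ /= rf qcoordK.
  by rewrite addNr.
move=> u v; rewrite opp_lfunE (weight_lieb0 thr wD) ?oppr0 ?memvf //.
by move=> ? _; rewrite memvf.
Qed.

(** Add to the line of [z] larger and larger ideals [I] of [L], one eigenvector [a] modulo [I] at a
    time. The eigenvalue vanishes on brackets, so [z] sends [a] into [I], and [<[z]> + I] is an
    ideal after adding [a]. *)
Lemma subnormal_bracket (y b : L) : subnormal <[lieb y b]>%VS.
Proof.
set z := lieb y b.
have main n (I : {vspace L}) : (\dim {:L} - \dim I <= n)%N -> is_lie_ideal I ->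
    subnormal (<[z]> + I)%VS.
  elim: n I => [|n IH] I dI Ii.
    have -> : I = fullv.
      by apply/eqP; rewrite eqEdim subvf /= -subn_eq0 -leqn0.
    by rewrite (_ : _ + _ = fullv)%VS; [exact: SubnormalFull | apply/eqP; rewrite eqEsubv subvf addvSr].
  have [->|If] := eqVneq I fullv.
    by rewrite (_ : _ + _ = fullv)%VS; [exact: SubnormalFull | apply/eqP; rewrite eqEsubv subvf addvSr].
  have [a [mu [aI la mu0]]] := ideal_eigenvector Ii If.
  have I'i : is_lie_ideal (I + <[a]>)%VS.
    move=> x _ /memv_addP[i iI [_ /vlineP[c ->] ->]]; rewrite linearD linearZ /=.
    rewrite -[lieb x a](subrK (mu x *: a)) scalerDr addrA.
    apply: memv_add; last by rewrite !memvZ // memv_line.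
    by rewrite memvD ?memvZ //; apply: Ii.
  have dI' : (\dim {:L} - \dim (I + <[a]>)%VS <= n)%N.
    rewrite -ltnS; apply: leq_trans dI; apply: ltn_sub2l.
      by rewrite ltnNge; apply: contra If => h; rewrite eqEdim subvf.
    rewrite ltnNge; apply: contra aI => h.
    have /eqP -> : I == (I + <[a]>)%VS by rewrite eqEdim addvSl.
    by rewrite memvE addvSr.
  have nI' := IH _ dI' I'i; rewrite addvA in nI'.
  have [aV|aV] := boolP (a \in <[z]> + I)%VS.
    by move: nI'; rewrite (_ : _ + <[a]> = <[z]> + I)%VS //; apply/addv_idPl; rewrite -memvE.
  have Ii' x w : x \in I -> lieb x w \in I by move=> xI; rewrite liebC memvN; apply: Ii.
  have IV : (I <= <[z]> + I)%VS by apply: addvSr.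
  apply: (SubnormalStep aV) nI'.
    move=> _ _ /memv_addP[_ /vlineP[c ->] [i iI ->]] /memv_addP[_ /vlineP[c' ->] [i' iI' ->]].
    apply: (subvP IV); rewrite lieb_addl; apply: memvD; last exact: Ii'.
    rewrite [lieb _ (_ + _)]linearD /=; apply: memvD; last exact: Ii.
    by rewrite linearZ /= lieb_scalel liebb !scaler0 mem0v.
  move=> _ /memv_addP[_ /vlineP[c ->] [i iI ->]]; apply: (subvP IV).
  rewrite linearD linearZ /=; apply: memvD; last exact: Ii.
  apply: memvZ; rewrite liebC memvN.
  by have := la z; rewrite mu0 scale0r subr0.
rewrite -[<[z]>%VS]addv0; apply: (main (\dim {:L})); first exact: leq_subr.
by move=> x w; rewrite !memv0 => /eqP ->; rewrite linear0.
Qed.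

Lemma quasinilpotent_right (Q : pzRingType) (A : bdata R Q) (th : L -> Q) (y b : L) a :
  lie_rep A th -> a != 0 -> exists g, (th (lieb y b) - sc A a) * g = 1.
Proof.
move=> thr a0; set z := lieb y b; apply: contrapT => ng.
have z0 : z != 0.
  apply/eqP => z0; apply: ng; exists (- sc A a^-1).
  have -> : th z = 0.
    case: (thr) => _ E; rewrite z0 -(liebb (0 : L)) E; exact: subrr.
  by rewrite sub0r mulrNN -scM divff // sc1.
have zn : z \notin (0%VS : {vspace L}) by rewrite memv0.
have [g [gz _]] := exists_functional zn.
pose D x := exists q, x = (th z - sc A a) * q.
have thZ c u : th (c *: u) = sc A c * th u.
  case: (thr) => lin br; have th0 : th 0 = 0 by rewrite -(liebb (0 : L)) br subrr.
  by rewrite -[c *: u]addr0 lin th0 addr0.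
have w : weight A th D <[z]>%VS (a *: g).
  split; first split.
  - by exists 0; rewrite mulr0.
  - by move=> _ _ [p ->] [q ->]; exists (p + q); rewrite mulrDr.
  - by move=> _ q [p ->]; exists (p * q); rewrite mulrA.
  - by move=> [q qE]; apply: ng; exists q.
  move=> _ /vlineP[c ->]; exists (sc A c).
  have -> : (a *: g) (c *: z) = c * a.
    have gl : g (c *: z) = c * g z by rewrite linearZ.
    by rewrite scale_lfunE gl gz mulr1 -[_ *: _]/(a * c) mulrC.
  by rewrite thZ scM -mulrBr scC.
have [D' [f' [w' ff]]] := weight_extend thr (subnormal_bracket y b) w.
have := weight_lieb0 thr w' (y := y) (fun u _ => memvf _) (memvf b).
rewrite -/z ff ?memv_line // scale_lfunE gz => /eqP.
by rewrite -[a *: _]/(a * 1) mulr1 (negPf a0).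
Qed.

(** In the opposite ring [- th] is a representation, and a right inverse there is a left inverse
    here. *)
Theorem quasinilpotent_bracket (Q : pzRingType) (A : bdata R Q) (th : L -> Q)
    (y b : L) a : lie_rep A th -> a != 0 ->
  exists g, (th (lieb y b) - sc A a) * g = 1 /\ g * (th (lieb y b) - sc A a) = 1.
Proof.
move=> thr a0; have [g gE] := quasinilpotent_right y b thr a0.
pose th' (l : L) : Q^c := - th l.
have thr' : lie_rep (conv_data A) th'.
  case: thr => lin br; split=> [c u v|u v]; rewrite /th'.
    by rewrite lin opprD; congr (_ + _); rewrite -[RHS]/(- th u * sc A c) -scC mulrN.
  have E : - (th u * th v - th v * th u) = - th v * - th u - - th u * - th v.
    by nc_ring.
  by rewrite br; exact: E.
have a0' : - a != 0 by rewrite oppr_eq0.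
have [h hE'] := quasinilpotent_right y b thr' a0'.
have hE : (h : Q) * (- th (lieb y b) - sc A (- a)) = 1 :> Q by exact: hE'.
move: hE; move: (h : Q) => {hE'} k kE.
set T := th _ - _ in gE *.
have hT : - k * T = 1 by rewrite -kE scN /T; nc_ring.
exists g; split=> //.
by have -> : g = - k by rewrite -[RHS]mulr1 -gE mulrA hT mul1r.
Qed.

End LieTheorem.

(** * Splitting of graded complexes and cones in a ring *)

Section GradedRing.
Variable Q : pzRingType.
Implicit Types (P : int -> Q) (d t h k : Q) (p : int).

Definition graded_complex P d :=
  [/\ forall p q, P p * P q = if p == q then P p else 0,
      forall p, d * P p = P (p - 1) * d & d * d = 0].

(** The homotopies need not be homogeneous; [split_homogeneous] cuts them down with the
    projections. *)
Definition split_at P d p :=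
  exists h h', P p * (d * h + h' * d) * P p = P p.

(* The cone of [t] is [C_p + C_(p-1)] with differential [[d, t], [0, - d]]; [h]
   and [g] are the blocks of the homotopies out of degrees [p] and [p - 1]. *)
Definition cone_split P d t p :=
  exists h11 h12 h21 h22 g11 g12 g21 g22,
  [/\ P p * (d * h11 + t * h21 + g11 * d) * P p = P p,
      P p * (d * h12 + t * h22 + g11 * t - g12 * d) * P (p - 1) = 0,
      P (p - 1) * (g21 * d - d * h21) * P p = 0 &
      P (p - 1) * (g21 * t - d * h22 - g22 * d) * P (p - 1) = P (p - 1)].

Section Theory.
Variables (P : int -> Q) (d : Q).
Hypothesis gr : graded_complex P d.

Let PP p : P p * P p = P p. Proof. by case: gr => h _ _; rewrite h eqxx. Qed.
Let dP p : d * P p = P (p - 1) * d. Proof. by case: gr. Qed.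
Let Pd p : P p * d = d * P (p + 1). Proof. by rewrite dP addrK. Qed.
Let dd : d * d = 0. Proof. by case: gr. Qed.

Lemma split_homogeneous p : split_at P d p ->
  exists h h', [/\ P (p + 1) * h = h, h * P p = h, P p * h' = h',
    h' * P (p - 1) = h' & d * h + h' * d = P p].
Proof.
move=> [h [h' E]]; exists (P (p + 1) * h * P p), (P p * h' * P (p - 1)); split.
- by rewrite !mulrA PP.
- by rewrite -mulrA PP.
- by rewrite !mulrA PP.
- by rewrite -mulrA PP.
rewrite -[RHS]E mulrDr mulrDl !mulrA -Pd; congr (_ + _).
by rewrite -mulrA -dP !mulrA.
Qed.

(** One homotopy [k] is to serve in both degrees. The [k] given at [p - 1] makes [e = P p - k d]
    satisfy [d e = 0], and replacing [h] by [h e] fits it to the degree [p]. *)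
Lemma split_consistent p : split_at P d p -> split_at P d (p - 1) ->
  exists h k k', [/\ P (p + 1) * h = h, h * P p = h, P p * k = k & k * P (p - 1) = k] /\
   [/\ P (p - 1) * k' = k', d * h + k * d = P p & d * k + k' * d = P (p - 1)].
Proof.
move=> /split_homogeneous[h [h' [h1 h2 h3 h4 E]]].
move=> /split_homogeneous[k [k' [k1 k2 k3 k4 F]]]; rewrite subrK in k1.
pose e := P p - k * d.
have de : d * e = 0.
  rewrite /e mulrBr mulrA (canRL (addrK _) F) dP.
  have -> : P (p - 1) * d - (P (p - 1) - k' * d) * d = k' * (d * d) by nc_ring.
  by rewrite dd mulr0.
have eP : e * P p = e by rewrite /e mulrBl PP -mulrA dP mulrA k2.
have Pe : P p * e = e by rewrite /e mulrBr PP mulrA k1.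
exists (h * e), k, k'; split; split=> //.
- by rewrite mulrA h1.
- by rewrite -mulrA eP.
have -> : d * (h * e) = (d * h + h' * d) * e - h' * (d * e) by nc_ring.
by rewrite E de mulr0 subr0 Pe /e subrK.
Qed.

Variable t : Q.
Hypothesis tP : forall p, t * P p = P p * t.
Hypothesis td : t * d = d * t.

(** The homotopies of the two summands fill the diagonal; the corners [h t k] and [k t k'] correct
    for the failure of [t] to commute with them. *)
Lemma cone_split_of_split p :
  split_at P d p -> split_at P d (p - 1) -> cone_split P d t p.
Proof.
move=> sp sp1; have [h [k [k' [[h1 h2 k1 k2] [k3 E F]]]]] := split_consistent sp sp1.
exists h, (h * t * k), 0, (- k), k, (k * t * k'), 0, (- k').
split.
- have -> : d * h + t * 0 + k * d = d * h + k * d by nc_ring.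
  by rewrite E !PP.
- have -> : d * (h * t * k) + t * - k + k * t - k * t * k' * d =
    (d * h + k * d - P p) * (t * k) - k * (d * t - t * d) * k
     - k * t * (d * k + k' * d - P (p - 1)) + (P p * t * k - t * k) + (k * t - k * t * P (p - 1)).
    by nc_ring.
  rewrite E F td !subrr mul0r !mulr0 mul0r !subr0 add0r.
  have -> : P p * t * k - t * k = 0 by rewrite -tP -mulrA k1 subrr.
  by rewrite add0r mulrBr mulrBl !mulrA -(mulrA _ (P (p - 1))) PP subrr.
- have -> : 0 * d - d * 0 = 0 by nc_ring.
  by rewrite mulr0 mul0r.
have -> : 0 * t - d * - k - - k' * d = d * k + k' * d by nc_ring.
by rewrite F !PP.
Qed.

End Theory.

Section Contractible.
Variables (P : int -> Q) (d w g : Q).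
Hypothesis gr : graded_complex P d.

(** [d w + w d] commutes with [d], hence so does its inverse [g], and [w g] is a contracting
    homotopy. *)
Lemma contractible_split p :
  (d * w + w * d) * g = 1 -> g * (d * w + w * d) = 1 -> split_at P d p.
Proof.
set th := _ + _ => g1 g2; exists (w * g), (w * g).
have [PP _ dd] := gr.
have thd : th * d = d * th.
  by rewrite /th mulrDl mulrDr !mulrA dd mul0r -(mulrA w) dd mulr0 addr0 add0r.
have gd : g * d = d * g.
  by rewrite -[LHS]mulr1 -g1 !mulrA -(mulrA g) -thd !mulrA g2 mul1r.
have -> : d * (w * g) + w * g * d = th * g by rewrite -mulrA gd /th mulrDl !mulrA.
by rewrite g1 mulr1 PP eqxx.
Qed.

End Contractible.

End GradedRing.

(** * From cones to complexes, and stability under perturbation *)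

Section BanachComplex.
Variables (R : realType) (Q : pzRingType) (A : bdata R Q).
Local Notation sc := (sc A).
Local Notation bd := (bd A).

(** The idempotent [e] projects degree [p] onto the cycles, so [Q] modulo [D] below stands for the
    maps into the homology at [p], on which [e t e] acts. That 1 lies in [D] says that cycles are
    boundaries, with a homotopy. *)
Lemma cone_not_split (P : int -> Q) d t p :
  graded_complex P d -> (forall p, t * P p = P p * t) -> t * d = d * t ->
  split_at P d (p - 1) -> (forall l, cone_split P d (t - sc l) p) ->
  split_at P d p.
Proof.
move=> gr tP td sp1 cs.
have [PP dP dd] := gr.
have PPp q : P q * P q = P q by rewrite PP eqxx.
have Pd q : P q * d = d * P (q + 1) by rewrite dP addrK.
have [k [k' [k1 k2 k3 k4 F]]] := split_homogeneous gr sp1; rewrite subrK in k1.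
pose e := P p - k * d.
have de : d * e = 0.
  rewrite /e mulrBr mulrA (canRL (addrK _) F) dP.
  have -> : P (p - 1) * d - (P (p - 1) - k' * d) * d = k' * (d * d) by nc_ring.
  by rewrite dd mulr0.
have eP : e * P p = e by rewrite /e mulrBl PPp -mulrA dP mulrA k2.
have Pe : P p * e = e by rewrite /e mulrBr PPp mulrA k1.
have ee : e * e = e by rewrite {1}/e mulrBl Pe -mulrA de mulr0 subr0.
have ed : e * d = d * P (p + 1) by rewrite /e mulrBl -mulrA dd mulr0 subr0 Pd.
(* Maps into the boundaries plus maps into the complement of the cycles. *)
pose D x := exists q q', x = d * q + (1 - e) * q'.
have Dr : right_ideal D.
  split.
  - by exists 0, 0; rewrite !mulr0 addr0.
  - move=> _ _ [q [q' ->]] [r [r' ->]]; exists (q + r), (q' + r'); nc_ring.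
  by move=> _ r [q [q' ->]]; exists (q * r), (q' * r); nc_ring.
have [q [q' E]] : D 1.
  apply: (surjective_everywhere (A := A) Dr (t := e * t * e)).
    move=> _ [q [q' ->]]; exists (P (p + 1) * t * q), 0.
    have -> : e * t * e * (d * q + (1 - e) * q') =
       e * t * (e * d) * q + e * t * (e - e * e) * q' by nc_ring.
    rewrite ee subrr !mulr0 mul0r !addr0 ed -Pd !mulrA -(mulrA e t) tP.
    by rewrite mulrA eP -(mulrA e t) td mulrA ed.
  move=> l; have [h11 [h12 [h21 [h22 [g11 [g12 [g21 [g22 [E1 _ E2 _]]]]]]]]] := cs l.
  (* By [E2] this block takes cycles to cycles; by [E1] it inverts [t - l] on the right, up to
     boundaries. *)
  pose b := P p * h21 * e; exists b.
  have db : d * b = 0.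
    rewrite /b !mulrA dP.
    have : P (p - 1) * (g21 * d - d * h21) * P p * e = 0 by rewrite E2 mul0r.
    rewrite -mulrA Pe.
    have -> : P (p - 1) * (g21 * d - d * h21) * e =
       P (p - 1) * g21 * (d * e) - P (p - 1) * d * h21 * e by nc_ring.
    by rewrite de mulr0 sub0r => /eqP; rewrite oppr_eq0 => /eqP.
  have eb : e * b = b by rewrite /e mulrBl -mulrA db mulr0 subr0 /b !mulrA PPp.
  have key : e * (t - sc l) * b = e - d * (P (p + 1) * h11 * e).
    have : e * (P p * (d * h11 + (t - sc l) * h21 + g11 * d) * P p) * e = e.
      by rewrite E1 eP ee.
    have -> : e * (P p * (d * h11 + (t - sc l) * h21 + g11 * d) * P p) * e =
       (e * P p) * d * h11 * (P p * e) + (e * P p) * (t - sc l) * h21 * (P p * e)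
       + e * P p * g11 * (d * P p * e) by nc_ring.
    have sP : P p * sc l = sc l * P p by rewrite scC.
    have tb : e * (t - sc l) * b = (e * P p) * (t - sc l) * h21 * (P p * e).
      have tsP : (t - sc l) * P p = P p * (t - sc l) by rewrite mulrBl mulrBr tP sP.
      by rewrite /b Pe -!mulrA (mulrA _ (P p)) tsP -!mulrA.
    rewrite -tb -(mulrA d) Pe de !mulr0 addr0 eP ed => h.
    by apply: (addrI (d * (P (p + 1) * h11 * e))); rewrite [RHS]addrC subrK !mulrA; move: h; rewrite !mulrA => h.
  exists (- (P (p + 1) * h11 * e)), (- 1).
  have -> : (e * t * e - sc l) * b - 1 = e * t * (e * b) - sc l * b - 1 by nc_ring.
  have lb : sc l * b = e * (sc l * b) by rewrite -{1}eb !mulrA (scC A l e).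
  rewrite eb lb; move: key.
  have -> : e * (t - sc l) * b = e * t * b - e * (sc l * b) by nc_ring.
  by move=> ->; nc_ring.
exists q, k.
have e1 : e = P p * d * q.
  by rewrite -[LHS]mulr1 E mulrDr !mulrA mulrBr mulr1 ee subrr mul0r addr0 ed Pd.
have -> : P p * (d * q + k * d) * P p = (P p * d * q + (P p * k) * d) * P p by nc_ring.
by rewrite -e1 k1 /e subrK PPp.
Qed.

(** For the new differential, [d' h + k d'] and [d' k + k' d'] are perturbations of projections and
    become invertible. As [d' d' = 0], [d'] intertwines them, hence also their inverses, which
    correct [h] and [k] to homotopies of [d']. *)
Lemma split_open (P : int -> Q) d p :
  graded_complex P d -> split_at P d p -> split_at P d (p - 1) ->
  exists2 e : R, 0 < e & forall d', graded_complex P d' -> bd (d' - d) e ->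
    split_at P d' p.
Proof.
move=> gr sp sp1; have [h [k [k' [[h1 h2 k1 k2] [k3 E F]]]]] := split_consistent gr sp sp1.
have [a ha] := bd_ex A h; have [b kb] := bd_ex A k; have [c kc] := bd_ex A k'.
have a0 := bd_ge0 ha; have b0 := bd_ge0 kb; have c0 := bd_ge0 kc.
(* With [d' - d] bounded by [1 / (2 C)], both perturbations have norm below 1/2. *)
pose C := a + b + c + 1; have C0 : 0 < C by rewrite /C; lra.
exists (2 * C)^-1; first by rewrite invr_gt0 mulr_gt0.
move=> d' gr' dd'; have [PP d'P d'd'] := gr'; have [_ dP dd] := gr.
set dl := d' - d in dd'.
have inv x y u v : bd x u -> bd y v -> u + v < C ->
    exists g, (1 + (dl * x + y * dl)) * g = 1 /\ g * (1 + (dl * x + y * dl)) = 1.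
  move=> xu yv uv.
  have [|g [g1 g2 _]] := neumann (bdN (bdD (bdM dd' xu) (bdM yv dd'))).
    rewrite [v * _]mulrC -mulrDr mulrC ltr_pdivrMr ?mulr_gt0 //; lra.
  by exists g; rewrite -[X in 1 + X]opprK.
have [|g [g1 g2]] := inv h k a b ha kb; first by rewrite /C; lra.
have [|g' [g1' g2']] := inv k k' b c kb kc; first by rewrite /C; lra.
have PPp q : P q * P q = P q by rewrite PP eqxx.
have d'Pp q : P q * d' = d' * P (q + 1) by rewrite d'P addrK.
set s := dl * h + k * dl in g1 g2; set s' := dl * k + k' * dl in g1' g2'.
have up : P p + s = d' * h + k * d' by rewrite -E /s /dl; nc_ring.
have up' : P (p - 1) + s' = d' * k + k' * d' by rewrite -F /s' /dl; nc_ring.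
have Ps : P p * s = s.
  have : P p * (P p + s) = P p + s.
    by rewrite up mulrDr !mulrA d'Pp -(mulrA d') h1 k1.
  by rewrite mulrDr PPp => /addrI.
have dlP : dl * P p = P (p - 1) * dl by rewrite mulrBl d'P dP mulrBr.
have sP : s * P p = s by rewrite mulrDl -mulrA h2 -mulrA dlP mulrA k2.
have comm : (1 + s') * (d' * P p) = d' * P p * (1 + s).
  have d'PP : P (p - 1) * d' * P p = d' * P p by rewrite -d'P -mulrA PPp.
  have -> : (1 + s') * (d' * P p) = (P (p - 1) + s') * d' * P p.
    by rewrite 2![in RHS]mulrDl d'PP mulrDl mul1r mulrA.
  have -> : d' * P p * (1 + s) = d' * (P p + s) * P p.
    by rewrite mulrDr mulr1 -mulrA Ps [in RHS]mulrDr mulrDl -!mulrA PPp sP.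
  rewrite up up'.
  have -> : (d' * k + k' * d') * d' * P p =
    d' * k * d' * P p + k' * (d' * d') * P p by nc_ring.
  have -> : d' * (d' * h + k * d') * P p =
    (d' * d') * h * P p + d' * k * d' * P p by nc_ring.
  by rewrite d'd' mulr0 !mul0r addr0 add0r.
have gd' : g' * (d' * P p) = d' * P p * g.
  have : g' * ((1 + s') * (d' * P p)) * g = g' * (d' * P p * (1 + s)) * g by rewrite comm.
  by rewrite mulrA g2' mul1r -!mulrA g1 mulr1 !mulrA => ->.
have Pup : P p = d' * h * g + k * d' * g.
  have : P p * ((1 + s) * g) = P p by rewrite g1 mulr1.
  by rewrite mulrA mulrDr mulr1 Ps up mulrDl => ->.
have Y : k * d' * g = k * g' * d' * P p.
  have -> : k * d' * g = k * (P (p - 1) * d') * g by rewrite mulrA k2.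
  by rewrite -d'P -mulrA -gd' !mulrA.
exists (h * g), (k * g').
have -> : P p * (d' * (h * g) + k * g' * d') * P p =
   P p * (d' * h * g + k * g' * d' * P p) * P p.
  have -> : P p * (d' * h * g + k * g' * d' * P p) * P p =
    P p * d' * h * g * P p + P p * k * g' * d' * (P p * P p) by nc_ring.
  by rewrite PPp; nc_ring.
by rewrite -Y -Pup !PPp.
Qed.

End BanachComplex.

(** * The complex over the opposite ring *)

Section ConverseComplex.
Variable Q : pzRingType.
Implicit Types (P : int -> Q) (d t : Q) (p : int).

(** Reversing products turns a map lowering degrees into one raising them, so degrees are reversed.
    The sign in [- d] is forced by the cone: transposing its matrix and exchanging the summands
    negates the diagonal. *)
Definition conv_degree (n : int) P : int -> Q^c := fun q => P (n - q).

Lemma graded_conv n P d :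
  graded_complex P d -> @graded_complex Q^c (conv_degree n P) (- d).
Proof.
move=> [PP dP dd]; split.
- move=> p q; rewrite -[LHS]/(P (n - q) * P (n - p)) PP /conv_degree.
  rewrite (inj_eq (addrI n)) eqr_opp eq_sym; by case: eqP => // ->.
- move=> p; rewrite -[LHS]/(P (n - p) * - d) -[RHS]/(- d * P (n - (p - 1))).
  rewrite mulrN mulNr dP; congr (- (P _ * _)); ring.
by rewrite -[LHS]/(- d * - d) mulrNN dd.
Qed.

Lemma split_conv n P d p :
  @split_at Q^c (conv_degree n P) (- d) (n - p) <-> split_at P d p.
Proof.
have E (h h' : Q) : @GRing.mul Q^c (@GRing.mul Q^c (conv_degree n P (n - p))
     (@GRing.mul Q^c (- d) h + @GRing.mul Q^c h' (- d))) (conv_degree n P (n - p)) =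
     P p * (d * - h' + - h * d) * P p :> Q.
  rewrite /conv_degree subKr -[LHS]/(P p * ((h * - d + - d * h') * P p)).
  by nc_ring.
split=> [[h [h' H]]|[h [h' H]]].
  exists (- h' : Q), (- h : Q); rewrite -E.
  by move: H; rewrite /conv_degree subKr.
exists (- h' : Q), (- h : Q); rewrite E !opprK.
by rewrite /conv_degree subKr.
Qed.

(** The cone is one degree longer than the complex, hence the reflection [n + 1 - p]; the blocks are
    transposed. *)
Lemma cone_conv n P d t p : cone_split P d t p ->
  @cone_split Q^c (conv_degree n P) (- d) t (n + 1 - p).
Proof.
move=> [h11 [h12 [h21 [h22 [g11 [g12 [g21 [g22 [E11 E12 E21 E22]]]]]]]]].
have n1 : n - (n + 1 - p) = p - 1 by ring.
have n2 : n - (n + 1 - p - 1) = p by ring.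
exists (g22 : Q^c), (g12 : Q^c), (g21 : Q^c), (g11 : Q^c),
  (h22 : Q^c), (h12 : Q^c), (h21 : Q^c), (h11 : Q^c); rewrite /conv_degree n1 n2; split.
- have E : P (p - 1) * ((g22 * - d + g21 * t + - d * h22) * P (p - 1)) =
    P (p - 1) * (g21 * t - d * h22 - g22 * d) * P (p - 1) :> Q by nc_ring.
  exact: etrans E E22.
- have E : P p * ((g12 * - d + g11 * t + t * h22 - - d * h12) * P (p - 1)) =
    P p * (d * h12 + t * h22 + g11 * t - g12 * d) * P (p - 1) :> Q by nc_ring.
  exact: etrans E E12.
- have E : P (p - 1) * ((- d * h21 - g21 * - d) * P p) =
    P (p - 1) * (g21 * d - d * h21) * P p :> Q by nc_ring.
  exact: etrans E E21.
have E : P p * ((t * h21 - g11 * - d - - d * h11) * P p) =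
  P p * (d * h11 + t * h21 + g11 * d) * P p :> Q by nc_ring.
exact: etrans E E11.
Qed.

End ConverseComplex.

(* The degrees of the spectra [delta, k] if [low], otherwise those of [pi, k];
   the bounds 0 and [n] are left out, as the complexes vanish beyond them. *)
Definition in_range (low : bool) (k n : nat) (p : int) : bool :=
  if low then p <= k%:Z else n%:Z - k%:Z <= p.

(** * Ranges of degrees *)

Section Ranges.
Variable Q : pzRingType.
Implicit Types (P : int -> Q) (d t : Q).

Lemma split_out P d p : P p = 0 -> split_at P d p.
Proof. by move=> P0; exists 0, 0; rewrite P0 !mulr0. Qed.

(** If [p] is in the range for [n.+1], both [p] and [p - 1] are in the range for [n]: low ranges are
    closed downwards, and the bound of high ranges moves by one. *)
Lemma cone_split_range low k n P d t : graded_complex P d ->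
  (forall p, t * P p = P p * t) -> t * d = d * t ->
  (forall p, in_range low k n p -> split_at P d p) ->
  forall p, in_range low k n.+1 p -> cone_split P d t p.
Proof.
move=> gr tP td sp p pr; apply: cone_split_of_split => //; apply: sp.
  by move: pr; rewrite /in_range; case: (low); lia.
by move: pr; rewrite /in_range; case: (low); lia.
Qed.

End Ranges.

(** Upwards from degree -1, where the complex vanishes, each degree providing the hypothesis at
    [p - 1] for the next. *)
Lemma split_below_of_cone (R : realType) (Q : pzRingType) (A : bdata R Q)
    (k : nat) (P : int -> Q) d t :
  graded_complex P d -> (forall p : int, p < 0 -> P p = 0) ->
  (forall p, t * P p = P p * t) -> t * d = d * t ->
  (forall l (p : int), p <= k%:Z -> cone_split P d (t - sc A l) p) ->
  forall p : int, p <= k%:Z -> split_at P d p.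
Proof.
move=> gr P0 tP td cs.
have main (m : nat) (p : int) : p <= k%:Z -> p < m%:Z -> split_at P d p.
  elim: m p => [|m IH] p pk pm; first exact/split_out/P0.
  by apply: (cone_not_split gr tP td (IH _ _ _) (fun l => cs l p pk)); lia.
by move=> p pk; apply: (main k.+1) => //; lia.
Qed.

Lemma split_range_of_cone (R : realType) (Q : pzRingType) (A : bdata R Q)
    low k n (P : int -> Q) d t : graded_complex P d ->
  (forall p, p < 0 -> P p = 0) -> (forall p, n%:Z < p -> P p = 0) ->
  (forall p, t * P p = P p * t) -> t * d = d * t ->
  (forall l p, in_range low k n.+1 p -> cone_split P d (t - sc A l) p) ->
  forall p, in_range low k n p -> split_at P d p.
Proof.
move=> gr P0 Pn tP td; case: low => cs p pr.
  exact: (split_below_of_cone gr P0 tP td cs).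
apply/(split_conv n%:Z); apply: (split_below_of_cone (A := conv_data A) (k := k)
  (graded_conv n%:Z gr) (t := t)).
- by move=> q q0; apply: Pn; lia.
- by move=> q; symmetry; apply: tP.
- by rewrite -[LHS]/(- d * t) -[RHS]/(t * - d) mulNr mulrN td.
- move=> l q qk; have -> : q = n%:Z + 1 - (n%:Z + 1 - q) by lia.
  by apply: cone_conv; apply: cs; rewrite /in_range; lia.
by move: pr; rewrite /in_range; lia.
Qed.

Lemma split_below_open (R : realType) (Q : pzRingType) (A : bdata R Q)
    (k : nat) (P : int -> Q) d :
  graded_complex P d -> (forall p : int, p < 0 -> P p = 0) ->
  (forall p : int, p <= k%:Z -> split_at P d p) ->
  exists2 e : R, 0 < e & forall d', graded_complex P d' -> bd A (d' - d) e ->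
    forall p : int, p <= k%:Z -> split_at P d' p.
Proof.
move=> gr P0 sp.
have main (m : nat) : exists2 e : R, 0 < e &
    forall d', graded_complex P d' -> bd A (d' - d) e ->
    forall p : int, p <= k%:Z -> p < m%:Z -> split_at P d' p.
  elim: m => [|m [e e0 IH]].
    by exists 1 => // d' _ _ p _ p0; exact/split_out/P0.
  have [mk|mk] := leqP m k; last first.
    by exists e => // d' gr' dd' p pk pm; apply: (IH d') => //; lia.
  have [||e' e'0 H] := split_open A gr (p := m%:Z); [by apply: sp; lia..|].
  exists (Num.min e e'); first by rewrite lt_min e0.
  move=> d' gr' dd' p pk pm; have [pm'|pm'] := ltP p m%:Z.
    by apply: (IH d') => //; apply: bd_le dd' _; rewrite ge_min lexx.
  have -> : p = m%:Z by lia.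
  by apply: H => //; apply: bd_le dd' _; rewrite ge_min lexx orbT.
have [e e0 H] := main k.+1; exists e => // d' gr' dd' p pk; apply: (H d') => //; lia.
Qed.

Lemma split_range_open (R : realType) (Q : pzRingType) (A : bdata R Q)
    low k n (P : int -> Q) d : graded_complex P d ->
  (forall p, p < 0 -> P p = 0) -> (forall p, n%:Z < p -> P p = 0) ->
  (forall p, in_range low k n p -> split_at P d p) ->
  exists2 e : R, 0 < e & forall d', graded_complex P d' -> bd A (d' - d) e ->
    forall p, in_range low k n p -> split_at P d' p.
Proof.
move=> gr P0 Pn; case: low => sp; first exact: split_below_open.
have [||e e0 H] := split_below_open (conv_data A) (k := k) (graded_conv n%:Z gr).
- by move=> q q0; apply: Pn; lia.
- move=> q qk; have -> : q = n%:Z - (n%:Z - q) by lia.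
  by apply/split_conv/sp; rewrite /in_range; lia.
exists e => // d' gr' dd' p pr; apply/(split_conv n%:Z); apply: H.
- exact: graded_conv.
- have E : - d' - - d = - (d' - d) :> Q by nc_ring.
  by have := bdN dd'; rewrite -E.
by move: pr; rewrite /in_range; lia.
Qed.

(** * Bounded and compact linear maps *)

Section BoundedMaps.
Variable R : realType.
Local Notation K := R[i].

Definition nrm (V : normedModType K) (x : V) : R := complex.Re `|x|.

Lemma nrmE (V : normedModType K) (x : V) : (nrm x)%:C%C = `|x|.
Proof.
rewrite /nrm; have := normr_ge0 x; case: (`|x|) => a b.
by rewrite lecE => /andP[/eqP /= -> _].
Qed.

Section NrmTheory.
Variable V : normedModType K.
Implicit Types x y : V.

Lemma nrm_ge0 x : 0 <= nrm x.
Proof. by rewrite -(@lecR R) nrmE; exact: (normr_ge0 x). Qed.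

Lemma nrmD x y : nrm (x + y) <= nrm x + nrm y.
Proof. by rewrite -(@lecR R) rmorphD /= !nrmE ler_normD. Qed.

Lemma nrmZ a x : nrm (a *: x) = cnorm a * nrm x.
Proof. by apply: (@complexI R); rewrite rmorphM /= !nrmE cnormE normrZ. Qed.

Lemma nrmN x : nrm (- x) = nrm x.
Proof. by apply: (@complexI R); rewrite !nrmE normrN. Qed.

Lemma nrmB x y : nrm (x - y) <= nrm x + nrm y.
Proof. by rewrite -(nrmN y) nrmD. Qed.

Lemma nrm_distC x y : nrm (x - y) = nrm (y - x).
Proof. by rewrite -nrmN opprB. Qed.

Lemma nrm0 : nrm (0 : V) = 0.
Proof. by apply: (@complexI R); rewrite nrmE normr0. Qed.

Lemma nrm0_eq0 x : nrm x = 0 -> x = 0.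
Proof. by move=> x0; apply/normr0_eq0; rewrite -nrmE x0. Qed.

Lemma nrm_sum I (r : seq I) (F : I -> V) :
  nrm (\sum_(i <- r) F i) <= \sum_(i <- r) nrm (F i).
Proof.
elim: r => [|i r IH]; first by rewrite !big_nil nrm0.
by rewrite !big_cons; apply: le_trans (nrmD _ _) _; rewrite lerD2l.
Qed.

Lemma nrm_small0 x : (forall e, 0 < e -> nrm x <= e) -> x = 0.
Proof.
move=> H; apply: nrm0_eq0; apply/eqP; rewrite eq_le nrm_ge0 andbT.
by apply/ler_addgt0Pl => e e0; rewrite addr0; apply: H.
Qed.

Lemma ball_nrm x y (e : R) : ball x e%:C%C y <-> nrm (x - y) < e.
Proof. by rewrite -ball_normE /ball_ /= -nrmE ltcR. Qed.

Lemma complex_pos (e : K) : 0 < e -> e = (complex.Re e)%:C%C /\ 0 < complex.Re e.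
Proof.
case: e => a b; rewrite ltcE /= => /andP[/eqP b0 a0]; split=> //.
by rewrite b0.
Qed.

End NrmTheory.

Definition op_le (U V : normedModType K) (f : U -> V) (c : R) :=
  0 <= c /\ forall x, nrm (f x) <= c * nrm x.

(** A predicate on bare functions, so that sums and compositions need no bundling; [linear_blin] and
    [blin_linear] translate from and to continuous linear maps. *)
Definition blin (U V : normedModType K) (f : U -> V) :=
  linear f /\ exists c, op_le f c.

Lemma blin_continuousP (U V : normedModType K) (f : {linear U -> V}) :
  continuous f <-> exists c, op_le f c.
Proof.
rewrite -linear_bounded_continuous linear_boundedP; split=> [[M [Mr H]]|[c [c0 fb]]].
  pose m := Num.max (complex.Re M) 0 + 1.
  have m0 : 0 <= m by rewrite addr_ge0 // le_max lexx orbT.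
  have Mm : M < m%:C%C.
    rewrite -(RRe_real Mr) ltcR; apply: (@le_lt_trans _ _ (Num.max (complex.Re M) 0)).
      by rewrite le_max lexx.
    by rewrite ltrDl.
  exists m; split=> // x; have := H _ Mm x.
  by rewrite -!nrmE -rmorphM /= lecR.
exists c%:C%C; split; first by rewrite complex_real.
move=> r cr x; rewrite -[`|f x|]nrmE; apply: le_trans (_ : c%:C%C * `|x| <= _).
  by rewrite -nrmE -rmorphM lecR.
by rewrite ler_wpM2r // ltW.
Qed.

Lemma blin_continuous (U V : normedModType K) (f : U -> V) : blin f -> continuous f.
Proof.
move=> [fl fb]; pose g : {linear U -> V} := HB.pack f (GRing.isLinear.Build _ _ _ _ f fl).
exact: (proj2 (blin_continuousP g) fb).
Qed.

Lemma blin_linear (U V : normedModType K) (f : U -> V) :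
  blin f -> exists g : {linear U -> V}, g =1 f /\ continuous g.
Proof.
move=> fb; have [fl _] := fb.
pose g : {linear U -> V} := HB.pack f (GRing.isLinear.Build _ _ _ _ f fl).
by exists g; split=> //; apply: blin_continuous.
Qed.

Lemma linear_blin (U V : normedModType K) (f : {linear U -> V}) :
  continuous f -> blin f.
Proof. by move=> /blin_continuousP fb; split=> //; apply: linearP. Qed.

Section BlinOps.
Variables U V W : normedModType K.

Lemma op_le_le (f : U -> V) c c' : op_le f c -> c <= c' -> op_le f c'.
Proof.
move=> [c0 fc] cc; split=> [|x]; first exact: le_trans cc.
by apply: le_trans (fc x) _; rewrite ler_wpM2r ?nrm_ge0.
Qed.

Lemma op_leD (f g : U -> V) c c' :
  op_le f c -> op_le g c' -> op_le (fun x => f x + g x) (c + c').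
Proof.
move=> [c0 fc] [c0' gc]; split=> [|x]; first exact: addr_ge0.
by apply: le_trans (nrmD _ _) _; rewrite mulrDl lerD.
Qed.

Lemma op_leM (f : V -> W) (g : U -> V) c c' :
  op_le f c -> op_le g c' -> op_le (f \o g) (c * c').
Proof.
move=> [c0 fc] [c0' gc]; split=> [|x]; first exact: mulr_ge0.
by apply: le_trans (fc _) _; rewrite -mulrA ler_wpM2l.
Qed.

Lemma blin_ext (f g : U -> V) : f =1 g -> blin f -> blin g.
Proof. by move=> /funext ->. Qed.

Lemma blinD (f g : U -> V) : blin f -> blin g -> blin (fun x => f x + g x).
Proof.
move=> [fl [c fc]] [gl [c' gc]]; split.
  by move=> a x y; rewrite fl gl scalerDr addrACA.
by exists (c + c'); apply: op_leD.
Qed.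

Lemma blinZ a (f : U -> V) : blin f -> blin (fun x => a *: f x).
Proof.
move=> [fl [c [c0 fc]]]; split.
  by move=> b x y; rewrite fl scalerDr !scalerA mulrC.
exists (cnorm a * c); split=> [|x]; first by rewrite mulr_ge0 ?cnorm_ge0.
by rewrite nrmZ -mulrA ler_wpM2l ?cnorm_ge0.
Qed.

Lemma blinN (f : U -> V) : blin f -> blin (fun x => - f x).
Proof.
by move=> fb; apply: blin_ext (blinZ (-1) fb) => x; rewrite scaleN1r.
Qed.

Lemma blin_comp (f : V -> W) (g : U -> V) : blin f -> blin g -> blin (f \o g).
Proof.
move=> [fl [c fc]] [gl [c' gc]]; split; first by move=> a x y /=; rewrite gl fl.
by exists (c * c'); apply: op_leM.
Qed.

Lemma blin0 : blin (fun _ : U => 0 : V).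
Proof.
split; first by move=> a x y; rewrite scaler0 addr0.
by exists 0; split=> // x; rewrite nrm0 mul0r.
Qed.

End BlinOps.

Lemma blin_id (U : normedModType K) : blin (@idfun U).
Proof. by split=> [a x y //|]; exists 1; split=> // x; rewrite mul1r. Qed.

Lemma blin_sum (U V : normedModType K) I (r : seq I) (F : I -> U -> V) :
  (forall i, blin (F i)) -> blin (fun x => \sum_(i <- r) F i x).
Proof.
move=> Fb; elim: r => [|i r IH].
  by apply: blin_ext (@blin0 U V) => x; rewrite big_nil.
by apply: blin_ext (blinD (Fb i) IH) => x; rewrite big_cons.
Qed.

Section CompactOpSub.
Variables U V : normedModType K.

Lemma compact_op_sub (k : U -> V) (C : set V) :
  compact C -> (forall x, `|x| <= 1 -> C (k x)) -> compact_op k.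
Proof.
move=> Cc kC; rewrite /compact_op precompactE.
apply: (@subclosed_compact _ _ C _ Cc); first exact: closed_closure.
have /closure_id -> : closed C by apply: compact_closed.
by apply: closure_subset => _ [x x1 <-]; apply: kC.
Qed.

Lemma compact_op_compact (k : U -> V) : compact_op k ->
  exists2 C : set V, compact C & forall x, `|x| <= 1 -> C (k x).
Proof.
rewrite /compact_op precompactE => kc; exists (closure (k @` [set x | `|x| <= 1])) => //.
by move=> x x1; apply: subset_closure; exists x.
Qed.

End CompactOpSub.

Section CompactOps.
Variables U V W : normedModType K.

Lemma compact_opD (k k' : U -> V) : compact_op k -> compact_op k' ->
  compact_op (fun x => k x + k' x).
Proof.
move=> /compact_op_compact[C Cc kC] /compact_op_compact[C' Cc' kC'].
apply: (@compact_op_sub _ _ _ ((fun p : V * V => p.1 + p.2) @` (C `*` C'))).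
  apply: continuous_compact; last exact: compact_setX.
  by apply: continuous_subspaceT => p; apply: add_continuous.
by move=> x x1; exists (k x, k' x) => //; split; [apply: kC|apply: kC'].
Qed.

Lemma compact_op_compl (f : V -> W) (k : U -> V) :
  blin f -> compact_op k -> compact_op (f \o k).
Proof.
move=> fb /compact_op_compact[C Cc kC].
apply: (@compact_op_sub _ _ _ (f @` C)).
  apply: continuous_compact => //; apply: continuous_subspaceT.
  exact: blin_continuous.
by move=> x x1; exists (k x) => //; apply: kC.
Qed.

Lemma compact_op0 : compact_op (fun _ : U => 0 : V).
Proof. by apply: (@compact_op_sub _ _ _ [set 0]) => //; apply: compact_set1. Qed.

End CompactOps.

Lemma compact_op_compr (U V W : normedModType K) (k : V -> W) (f : U -> V) :
  blin f -> linear k -> compact_op k -> compact_op (k \o f).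
Proof.
(* [f] divided by [a] maps the unit ball into itself; the added 1 keeps [a] invertible. *)
move=> [fl [c [c0 fc]]] kl kc; pose a : K := (c + 1)%:C%C.
have c10 : 0 < c + 1 by rewrite ltr_wpDl.
have a0 : a != 0 by rewrite -cnorm_gt0 cnormR gtr0_norm.
have sa : blin (fun x : W => a *: x) by apply: (blinZ a (@blin_id W)).
have [C Cc kC] := compact_op_compact (compact_op_compl sa kc).
apply: (compact_op_sub Cc) => x x1.
have -> : (k \o f) x = ((fun x : W => a *: x) \o k) (a^-1 *: f x).
  have kZ b y : k (b *: y) = b *: k y.
    have k0 : k 0 = 0.
      have := kl 1 0 0; rewrite scaler0 addr0 scale1r => h.
      by apply: (addrI (k 0)); rewrite addr0 -h.
    by rewrite -[b *: y]addr0 kl k0 addr0.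
  by rewrite /= kZ scalerA divff // scale1r.
apply: kC; rewrite -nrmE -(rmorph1 (real_complex R)) lecR nrmZ cnormV cnormR gtr0_norm //.
rewrite mulrC ler_pdivrMr // mul1r; apply: le_trans (fc x) _.
have : nrm x <= 1 by rewrite -(@lecR R) nrmE rmorph1.
have := nrm_ge0 x; nra.
Qed.

End BoundedMaps.

(** * A reflexive tactic for vector identities *)

Section AbelianGroup.
Variable V : zmodType.

(** The syntax of [nc_ring] is reused; reification into a group never produces 1 or products, which
    are sent to 0. *)
Fixpoint zm_eval (env : seq V) (e : nc_expr) : V :=
  match e with
  | NcVar i => nth 0 env i
  | NcOpp a => - zm_eval env a
  | NcAdd a b => zm_eval env a + zm_eval env b
  | _ => 0
  end.

Fixpoint zm_atoms (e : nc_expr) : seq nat * seq nat :=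
  match e with
  | NcVar i => ([:: i], [::])
  | NcOpp a => let w := zm_atoms a in (w.2, w.1)
  | NcAdd a b => let w := zm_atoms a in let v := zm_atoms b in
      (w.1 ++ v.1, w.2 ++ v.2)
  | _ => ([::], [::])
  end.

Let zm_eval_atoms env e : zm_eval env e =
  \sum_(i <- (zm_atoms e).1) nth 0 env i - \sum_(i <- (zm_atoms e).2) nth 0 env i.
Proof.
elim: e => [i|||a IHa|a IHa b IHb|a _ b _] /=; rewrite ?big_nil ?subrr //.
- by rewrite big_seq1 subr0.
- by rewrite IHa opprB.
by rewrite IHa IHb !big_cat /= opprD addrACA.
Qed.

Lemma zm_abelP env e1 e2 :
  perm_eq ((zm_atoms e1).1 ++ (zm_atoms e2).2)
          ((zm_atoms e2).1 ++ (zm_atoms e1).2) ->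
  zm_eval env e1 = zm_eval env e2.
Proof.
move=> ew; rewrite !zm_eval_atoms.
have /eqP H : \sum_(i <- (zm_atoms e1).1) nth 0 env i +
    \sum_(i <- (zm_atoms e2).2) nth 0 env i = \sum_(i <- (zm_atoms e2).1) nth 0 env i +
    \sum_(i <- (zm_atoms e1).2) nth 0 env i.
  by rewrite -!big_cat; apply: perm_big.
by apply/eqP; rewrite subr_eq addrAC eq_sym subr_eq eq_sym.
Qed.

End AbelianGroup.

Ltac zm_atoms_of e s :=
  lazymatch e with
  | @GRing.add _ ?a ?b => let s := zm_atoms_of a s in zm_atoms_of b s
  | @GRing.opp _ ?a => zm_atoms_of a s
  | @GRing.zero _ => s
  | _ => nc_insert e s
  end.
Ltac zm_reify e s :=
  lazymatch e with
  | @GRing.add _ ?a ?b =>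
      let a := zm_reify a s in let b := zm_reify b s in constr:(NcAdd a b)
  | @GRing.opp _ ?a => let a := zm_reify a s in constr:(NcOpp a)
  | @GRing.zero _ => constr:(NcZero)
  | _ => let i := nc_index e s in constr:(NcVar i)
  end.

Ltac zm_abel :=
  lazymatch goal with
  | |- @eq ?T ?a ?b =>
    let V := constr:(T : zmodType) in
    let s := zm_atoms_of a (@nil T) in
    let s := zm_atoms_of b s in
    let ea := zm_reify a s in
    let eb := zm_reify b s in
    refine (@zm_abelP V s ea eb _); by vm_compute
  end.

(** * The normed ring of bounded operators *)

Record bop (R : realType) (T : normedModType R[i]) :=
  Bop { bopf :> T -> T; bopP : blin bopf }.

Section BopRing.
Variables (R : realType) (T : normedModType R[i]).
Implicit Types a b c : bop T.

Lemma bop_ext a b : a =1 b -> a = b.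
Proof.
case: a b => [f fb] [g gb] /= /funext fg; case: _ / fg gb => gb.
by congr Bop; apply: Prop_irrelevance.
Qed.

HB.instance Definition _ := gen_eqMixin (bop T).
HB.instance Definition _ := gen_choiceMixin (bop T).

Definition bop_zero : bop T := Bop (@blin0 R T T).
Definition bop_add a b : bop T := Bop (blinD (bopP a) (bopP b)).
Definition bop_opp a : bop T := Bop (blinN (bopP a)).
Definition bop_one : bop T := Bop (@blin_id R T).
Definition bop_mul a b : bop T := Bop (blin_comp (bopP a) (bopP b)).

Fact bop_addA : associative bop_add.
Proof. by move=> a b c; apply: bop_ext => x /=; rewrite addrA. Qed.
Fact bop_addC : commutative bop_add.
Proof. by move=> a b; apply: bop_ext => x /=; rewrite addrC. Qed.
Fact bop_add0 : left_id bop_zero bop_add.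
Proof. by move=> a; apply: bop_ext => x /=; rewrite add0r. Qed.
Fact bop_addN : left_inverse bop_zero bop_opp bop_add.
Proof. by move=> a; apply: bop_ext => x /=; rewrite addNr. Qed.

HB.instance Definition _ :=
  GRing.isZmodule.Build (bop T) bop_addA bop_addC bop_add0 bop_addN.

Lemma bop_fD a x y : a (x + y) = a x + a y.
Proof. by have [l _] := bopP a; have := l 1 x y; rewrite !scale1r. Qed.

Fact bop_mulA : associative bop_mul.
Proof. by move=> a b c; apply: bop_ext. Qed.
Fact bop_mul1 : left_id bop_one bop_mul.
Proof. by move=> a; apply: bop_ext. Qed.
Fact bop_mul1r : right_id bop_one bop_mul.
Proof. by move=> a; apply: bop_ext. Qed.
Fact bop_mulDl : left_distributive bop_mul bop_add.
Proof. by move=> a b c; apply: bop_ext. Qed.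
Fact bop_mulDr : right_distributive bop_mul bop_add.
Proof. by move=> a b c; apply: bop_ext => x /=; rewrite bop_fD. Qed.

HB.instance Definition _ := GRing.Zmodule_isPzRing.Build (bop T)
  bop_mulA bop_mul1 bop_mul1r bop_mulDl bop_mulDr.

Lemma bopDE a b x : (a + b) x = a x + b x. Proof. by []. Qed.
Lemma bopNE a x : (- a) x = - a x. Proof. by []. Qed.
Lemma bopME a b x : (a * b) x = a (b x). Proof. by []. Qed.
Lemma bop1E x : (1 : bop T) x = x. Proof. by []. Qed.
Lemma bop0E x : (0 : bop T) x = 0. Proof. by []. Qed.
Lemma bopBE a b x : (a - b) x = a x - b x. Proof. by []. Qed.

Lemma bop_fZ a k x : a (k *: x) = k *: a x.
Proof.
have [l _] := bopP a.
have a0 : a 0 = 0 by apply: (addrI (a 0)); rewrite -bop_fD !addr0.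
by rewrite -[k *: x]addr0 l a0 addr0.
Qed.

Lemma bop_f0 a : a 0 = 0.
Proof. by apply: (addrI (a 0)); rewrite -bop_fD !addr0. Qed.

Lemma bop_fN a x : a (- x) = - a x.
Proof. by rewrite -scaleN1r bop_fZ scaleN1r. Qed.

Lemma bop_sumE I (r : seq I) (F : I -> bop T) x :
  (\sum_(i <- r) F i) x = \sum_(i <- r) F i x.
Proof.
elim: r => [|i r IH]; first by rewrite !big_nil.
by rewrite !big_cons bopDE IH.
Qed.

Lemma bop_f_sum I (r : seq I) (F : I -> T) a :
  a (\sum_(i <- r) F i) = \sum_(i <- r) a (F i).
Proof.
elim: r => [|i r IH]; first by rewrite !big_nil bop_f0.
by rewrite !big_cons bop_fD IH.
Qed.

Definition bop_sc (k : R[i]) : bop T := Bop (blinZ k (@blin_id R T)).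

Lemma bop_scE k x : bop_sc k x = k *: x. Proof. by []. Qed.

End BopRing.

Section Neumann.
Variables (R : realType) (T : completeNormedModType R[i]).

Lemma geometric_lim0 (c M e : R) : 0 <= c -> c < 1 -> 0 < e ->
  exists n0, forall n, (n0 <= n)%N -> c ^+ n * M <= e.
Proof.
move=> c0 c1 e0.
have /cvgrPdist_le /(_ _ e0) [n0 _ H] : (fun k => c ^+ k * M) @ \oo --> (0 : R).
  rewrite -[0](mul0r M); apply: cvgM; [apply: cvg_expr | exact: cvg_cst].
  by rewrite ger0_norm.
exists n0 => n nn; have := H n nn; rewrite /= sub0r normrN.
by apply: le_trans (ler_norm _).
Qed.

(** The equation [x - q x = y] is solved pointwise by iterating [x -> y + q x], so only the
    completeness of [T] enters; the lower bound gives injectivity and the norm of the inverse. *)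
Lemma bop_neumann (q : bop T) (c : R) : op_le q c -> c < 1 ->
  exists g : bop T, [/\ (1 - q) * g = 1, g * (1 - q) = 1 & op_le g (1 - c)^-1].
Proof.
move=> [c0 qc] c1; have c10 : 0 < 1 - c by rewrite subr_gt0.
have low x : (1 - c) * nrm x <= nrm ((1 - q) x).
  have := nrmD ((1 - q) x) (q x); rewrite bopBE subrK bop1E; have := qc x; lra.
have inj x y : (1 - q) x = (1 - q) y -> x = y.
  move=> E; apply/eqP; rewrite -subr_eq0; apply/eqP; apply: nrm0_eq0.
  apply/eqP; rewrite eq_le nrm_ge0 andbT.
  have := low (x - y); rewrite bop_fD bop_fN E subrr nrm0.
  by rewrite pmulr_rle0.
have surj y : exists x, (1 - q) x = y.
  pose u n := iter n (fun x => y + q x) 0.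
  have ud n : nrm (u n.+1 - u n) <= c ^+ n * nrm y.
    elim: n => [|n IH]; first by rewrite /u /= bop_f0 addr0 subr0 expr0 mul1r.
    rewrite {1}/u !iterS -!/(u _) opprD addrACA subrr add0r -bop_fN -bop_fD.
    by apply: le_trans (qc _) _; rewrite exprS -mulrA ler_wpM2l.
  have udist n m : nrm (u (n + m)%N - u n) <= c ^+ n * (nrm y / (1 - c)).
    have H : nrm (u (n + m)%N - u n) <= c ^+ n * ((1 - c ^+ m) / (1 - c) * nrm y).
      elim: m => [|m IH].
        by rewrite addn0 subrr nrm0 expr0 subrr !mul0r mulr0.
      have := nrmD (u (n + m).+1 - u (n + m)%N) (u (n + m)%N - u n).
      rewrite addrA subrK addnS => h; apply: le_trans h _.
      apply: le_trans (lerD (ud _) IH) _.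
      have -> : (1 - c ^+ m.+1) / (1 - c) = c ^+ m + (1 - c ^+ m) / (1 - c).
        by rewrite exprSr; field; rewrite subr_eq0 gt_eqF.
      by rewrite exprD; lra.
    apply: le_trans H _; rewrite ler_wpM2l ?exprn_ge0 //.
    rewrite mulrAC ler_wpM2r ?invr_ge0 ?(ltW c10) //.
    by rewrite ler_piMl ?nrm_ge0 // gerBl exprn_ge0.
  have cu : cvg (u @ \oo).
    apply: cauchy_cvg; apply: cauchy_exP => e /complex_pos[-> e0].
    have e20 : 0 < complex.Re e / 2 by rewrite divr_gt0.
    have [n0 Hn] := geometric_lim0 (nrm y / (1 - c)) c0 c1 e20.
    exists (u n0); exists n0 => // n /= nn; apply/ball_nrm.
    rewrite nrm_distC -(subnKC nn); apply: le_lt_trans (udist _ _) _.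
    by apply: le_lt_trans (Hn _ (leqnn _)) _; lra.
  pose x := lim (u @ \oo); exists x.
  apply/eqP; rewrite -subr_eq0; apply/eqP; apply: nrm_small0 => e e0.
  have e40 : 0 < e / 4 by rewrite divr_gt0.
  have [n0 Hn] := geometric_lim0 (nrm y) c0 c1 e40.
  have e4C : 0 < (e / 4)%:C%C by rewrite ltcR.
  have /cvgrPdist_lt /(_ _ e4C) [n1 _ Hx] := cu.
  pose n := maxn n0 n1.
  have xn : nrm (x - u n) < e / 4.
    rewrite -(@ltcR R) nrmE; apply: Hx; exact: leq_maxr.
  have E : (1 - q) x - y = (x - u n) - q (x - u n) - (u n.+1 - u n).
    rewrite bopBE bop1E bop_fD bop_fN [u n.+1]iterS -/(u n).
    by zm_abel.
  rewrite E; apply: le_trans (nrmB _ _) _; apply: le_trans (lerD (nrmB _ _) (ud n)) _.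
  have hn := Hn n (leq_maxl _ _); have hq := qc (x - u n).
  have xn0 := nrm_ge0 (x - u n).
  have : c * nrm (x - u n) <= nrm (x - u n) by rewrite ler_piMl // ltW.
  lra.
have [g gP] := choice surj.
have gl : linear g.
  move=> a x y; apply: inj; rewrite gP bop_fD bop_fZ !gP.
  by [].
have gb : op_le g (1 - c)^-1.
  split=> [|x]; first by rewrite invr_ge0 ltW.
  by rewrite mulrC ler_pdivlMr // mulrC; apply: le_trans (low _) _; rewrite gP.
exists (Bop (conj gl (ex_intro _ _ gb))); split=> //; apply: bop_ext => x.
  exact: gP.
by apply: inj; exact: (gP ((1 - q) x)).
Qed.

End Neumann.

Definition bop_bdata (R : realType) (T : completeNormedModType R[i]) :
  bdata R (bop T).
Proof.
refine (@Bdata R (bop T) (@bop_sc R T) _ _ _ _ (fun a c => op_le a c) _ _ _ _ _ _ _).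
- by move=> a b; apply: bop_ext => x; exact: scalerDl.
- by move=> a b; apply: bop_ext => x; rewrite bopME !bop_scE scalerA.
- by apply: bop_ext => x; rewrite bop_scE scale1r.
- by move=> a q; apply: bop_ext => x; rewrite !bopME !bop_scE bop_fZ.
- by move=> q c c'; apply: op_le_le.
- by move=> q c [].
- by move=> p q c c'; apply: op_leD.
- by move=> p q c c'; apply: op_leM.
- by move=> a; split=> [|x]; rewrite ?cnorm_ge0 // bop_scE nrmZ.
- by move=> q; case: (bopP q).
exact: bop_neumann.
Defined.

(** * Quotients by two-sided ideals; the Calkin algebra *)

Record two_sided (B : pzRingType) := TwoSided {
  tsI :> B -> Prop;
  ts0 : tsI 0;
  tsD : forall x y, tsI x -> tsI y -> tsI (x + y);
  tsL : forall x y, tsI y -> tsI (x * y);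
  tsR : forall x y, tsI x -> tsI (x * y) }.

Section RingQuotient.
Variables (B : pzRingType) (I : two_sided B).
Local Open Scope quotient_scope.

Let IN x : I x -> I (- x).
Proof. by move=> /(tsL (-1)); rewrite mulN1r. Qed.

Definition ts_equiv (x y : B) : bool := `[< I (x - y) >].

Fact ts_equiv_refl : reflexive ts_equiv.
Proof. by move=> x; apply/asboolP; rewrite subrr; apply: ts0. Qed.
Fact ts_equiv_sym : symmetric ts_equiv.
Proof.
by move=> x y; apply/asboolP/asboolP => /IN; rewrite opprB.
Qed.
Fact ts_equiv_trans : transitive ts_equiv.
Proof.
move=> y x z /asboolP xy /asboolP yz; apply/asboolP.
by have := tsD xy yz; rewrite addrA subrK.
Qed.

Canonical ts_equivR := EquivRel ts_equiv ts_equiv_refl ts_equiv_sym ts_equiv_trans.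

Definition rquot := {eq_quot ts_equivR}.
HB.instance Definition _ := EqQuotient.on rquot.
HB.instance Definition _ := Choice.on rquot.

Definition rpi (x : B) : rquot := \pi_rquot x.

Lemma rpi_eq x y : rpi x = rpi y <-> I (x - y).
Proof.
split=> [/eqP|xy]; last by apply/eqP; rewrite /rpi eqmodE; apply/asboolP.
by rewrite /rpi eqmodE => /asboolP.
Qed.

Lemma rpiK q : exists x, q = rpi x.
Proof. by exists (repr q); rewrite /rpi reprK. Qed.

Let rep_rpi x : I (repr (rpi x) - x).
Proof. by apply/rpi_eq; rewrite /rpi reprK. Qed.

Definition rq_add (p q : rquot) := rpi (repr p + repr q).
Definition rq_opp (p : rquot) := rpi (- repr p).
Definition rq_mul (p q : rquot) := rpi (repr p * repr q).

Let rpi_add x y : rq_add (rpi x) (rpi y) = rpi (x + y).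
Proof.
apply/rpi_eq; have -> : repr (rpi x) + repr (rpi y) - (x + y) =
  (repr (rpi x) - x) + (repr (rpi y) - y) by nc_ring.
exact: tsD.
Qed.

Let rpi_opp x : rq_opp (rpi x) = rpi (- x).
Proof.
apply/rpi_eq; have -> : - repr (rpi x) - - x = - (repr (rpi x) - x) by nc_ring.
exact: IN.
Qed.

Let rpi_mul x y : rq_mul (rpi x) (rpi y) = rpi (x * y).
Proof.
apply/rpi_eq; have -> : repr (rpi x) * repr (rpi y) - x * y =
  (repr (rpi x) - x) * repr (rpi y) + x * (repr (rpi y) - y) by nc_ring.
by apply: tsD; [apply: tsR | apply: tsL].
Qed.

Fact rq_addA : associative rq_add.
Proof.
move=> p q r; have [x ->] := rpiK p; have [y ->] := rpiK q; have [z ->] := rpiK r.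
by rewrite !rpi_add addrA.
Qed.
Fact rq_addC : commutative rq_add.
Proof.
move=> p q; have [x ->] := rpiK p; have [y ->] := rpiK q.
by rewrite !rpi_add addrC.
Qed.
Fact rq_add0 : left_id (rpi 0) rq_add.
Proof. by move=> p; have [x ->] := rpiK p; rewrite rpi_add add0r. Qed.
Fact rq_addN : left_inverse (rpi 0) rq_opp rq_add.
Proof. by move=> p; have [x ->] := rpiK p; rewrite rpi_opp rpi_add addNr. Qed.

HB.instance Definition _ :=
  GRing.isZmodule.Build rquot rq_addA rq_addC rq_add0 rq_addN.

Fact rq_mulA : associative rq_mul.
Proof.
move=> p q r; have [x ->] := rpiK p; have [y ->] := rpiK q; have [z ->] := rpiK r.
by rewrite !rpi_mul mulrA.
Qed.
Fact rq_mul1 : left_id (rpi 1) rq_mul.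
Proof. by move=> p; have [x ->] := rpiK p; rewrite rpi_mul mul1r. Qed.
Fact rq_mul1r : right_id (rpi 1) rq_mul.
Proof. by move=> p; have [x ->] := rpiK p; rewrite rpi_mul mulr1. Qed.
Fact rq_mulDl : left_distributive rq_mul rq_add.
Proof.
move=> p q r; have [x ->] := rpiK p; have [y ->] := rpiK q; have [z ->] := rpiK r.
by rewrite !(rpi_mul, rpi_add) mulrDl.
Qed.
Fact rq_mulDr : right_distributive rq_mul rq_add.
Proof.
move=> p q r; have [x ->] := rpiK p; have [y ->] := rpiK q; have [z ->] := rpiK r.
by rewrite !(rpi_mul, rpi_add) mulrDr.
Qed.

HB.instance Definition _ := GRing.Zmodule_isPzRing.Build rquot
  rq_mulA rq_mul1 rq_mul1r rq_mulDl rq_mulDr.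

Lemma rpiD x y : rpi (x + y) = rpi x + rpi y.
Proof. by rewrite -rpi_add. Qed.
Lemma rpiN x : rpi (- x) = - rpi x.
Proof. by rewrite -rpi_opp. Qed.
Lemma rpiB x y : rpi (x - y) = rpi x - rpi y.
Proof. by rewrite rpiD rpiN. Qed.
Lemma rpiM x y : rpi (x * y) = rpi x * rpi y.
Proof. by rewrite -rpi_mul. Qed.
Lemma rpi1 : rpi 1 = 1. Proof. by []. Qed.

End RingQuotient.

Section QuotientBdata.
Variables (R : realType) (B : pzRingType) (I : two_sided B) (A : bdata R B).

Definition quotient_bdata : bdata R (rquot I).
Proof.
refine (@Bdata R (rquot I) (fun a => rpi I (sc A a)) _ _ _ _
  (fun q c => exists x, q = rpi I x /\ bd A x c) _ _ _ _ _ _ _).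
- by move=> a b; rewrite scD rpiD.
- by move=> a b; rewrite scM rpiM.
- by rewrite sc1.
- by move=> a q; have [x ->] := rpiK q; rewrite -!rpiM scC.
- by move=> q c c' [x [-> xc]] cc; exists x; split=> //; apply: bd_le cc.
- by move=> q c [x [_ xc]]; apply: bd_ge0 xc.
- move=> p q c c' [x [-> xc]] [y [-> yc]]; exists (x + y).
  by rewrite rpiD; split=> //; apply: bdD.
- move=> p q c c' [x [-> xc]] [y [-> yc]]; exists (x * y).
  by rewrite rpiM; split=> //; apply: bdM.
- by move=> a; exists (sc A a); split=> //; apply: bd_sc.
- move=> q; have [x ->] := rpiK q; have [c xc] := bd_ex A x.
  by exists c, x.
move=> q c [x [-> xc]] c1; have [g [g1 g2 g3]] := neumann xc c1.
exists (rpi I g); rewrite -rpi1 -rpiB -!rpiM g1 g2; split=> //.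
by exists g.
Defined.

End QuotientBdata.

Section Calkin.
Variables (R : realType) (T : completeNormedModType R[i]).

Definition compact_ideal : two_sided (bop T).
Proof.
refine (@TwoSided (bop T) (fun a => compact_op a) _ _ _ _).
- exact: compact_op0.
- by move=> a b; apply: compact_opD.
- by move=> a b; apply: compact_op_compl; apply: bopP.
by move=> a b; apply: compact_op_compr; [apply: bopP | case: (bopP a)].
Defined.

Definition calkin : pzRingType := rquot compact_ideal.
Definition calkin_bdata : bdata R calkin := quotient_bdata compact_ideal (bop_bdata T).

End Calkin.

(* A point of the unit ball is the sum of the series [2 ^- n * x_(i n)] of
   points of a finite [1/2]-net. *)
Section CompactIdentity.
Variables (R : realType) (T : normedModType R[i]).

Lemma compact_id_finite_dimensional :
  compact_op (@idfun T) -> finite_dimensional T.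
Proof.
move=> /compact_op_compact[C Cc CT].
have /(_ _ [set: T] (fun y => ball y (2^-1 : R)%:C%C)) :
    cover_compact C by rewrite -compact_cover.
case=> [y _|x Cx|D _ CD].
- exact: ball_open.
- by exists x => //; apply: ballxx; rewrite ltcR invr_gt0.
pose s : seq T := finmap.enum_fset D; pose m := size s; pose e (i : 'I_m) := nth 0 s i.
have net x : nrm x <= 1 -> exists i, nrm (x - e i) <= 2^-1.
  move=> x1; have [|y /= yD] := CD x; first by apply: CT; rewrite -nrmE -(rmorph1 (real_complex R)) lecR.
  move=> /ball_nrm xy; have ys : y \in s by exact: yD.
  have im : (index y s < m)%N by rewrite index_mem.
  by exists (Ordinal im); rewrite /e /= nth_index // nrm_distC ltW.
have [iota iotaP] : exists iota : T -> 'I_m,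
    forall x, nrm x <= 1 -> nrm (x - e (iota x)) <= 2^-1.
  have [i0 _] : exists i, nrm ((0 : T) - e i) <= 2^-1 by apply: net; rewrite nrm0.
  have H x : exists i, nrm x <= 1 -> nrm (x - e i) <= 2^-1.
    have [x1|x1] := leP (nrm x) 1; last by exists i0.
    by have [i xi] := net x x1; exists i.
  by have [iota H'] := choice H; exists iota.
exists m, e.
have unit_ball x : nrm x <= 1 -> exists a : 'I_m -> R[i], x = \sum_i a i *: e i.
  (* The rescaled remainders: a remainder of norm at most 1/2 is doubled, so all stay in the unit
     ball. *)
  move=> x1; pose r n := iter n (fun y => 2 *: (y - e (iota y))) x.
  have r1 n : nrm (r n) <= 1.
    elim: n => [//|n IH]; rewrite /r iterS -/(r n) nrmZ.
    rewrite -(rmorph_nat (@real_complex R)) cnormR ger0_norm //.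
    by have := iotaP _ IH; lra.
  (* Collects the weights of the steps at which the net point [i] was chosen, so that the limit is a
     finite combination. *)
  pose a i := [series ((iota (r n) == i)%:R * 2^-1 ^+ n : R)]_n.
  have xE N : x = \sum_i (a i N)%:C%C *: e i + (2^-1 ^+ N)%:C%C *: r N.
    elim: N => [|N IH].
      rewrite big1 ?add0r ?expr0 ?scale1r // => i _.
      by rewrite /a /series /= big_geq // scale0r.
    rewrite [LHS]IH; have aS i : a i N.+1 = a i N + (iota (r N) == i)%:R * 2^-1 ^+ N.
      by rewrite /a /series /= big_nat_recr.
    have -> : \sum_i (a i N.+1)%:C%C *: e i =
       \sum_i (a i N)%:C%C *: e i + (2^-1 ^+ N)%:C%C *: e (iota (r N)).
      have -> : (2^-1 ^+ N)%:C%C *: e (iota (r N)) =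
          \sum_i ((iota (r N) == i)%:R * 2^-1 ^+ N)%:C%C *: e i.
        rewrite (bigD1 (iota (r N))) //= eqxx mul1r big1 ?addr0 // => i.
        by rewrite eq_sym => /negPf ->; rewrite mul0r scale0r.
      rewrite -big_split; apply: eq_bigr => i _.
      by rewrite aS rmorphD scalerDl.
    rewrite -addrA; congr (_ + _).
    have half : (2^-1)%:C%C * 2 = 1 :> R[i].
      by rewrite fmorphV rmorph_nat mulVf // pnatr_eq0.
    have -> : r N.+1 = 2 *: (r N - e (iota (r N))) by [].
    by rewrite exprSr rmorphM scalerA -mulrA half mulr1 scalerBr addrC subrK.
  have acvg i : cvgn (a i).
    apply: nondecreasing_is_cvgn.
      by apply/nondecreasing_series => n _ _; rewrite mulr_ge0 ?exprn_ge0.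
    exists 2 => _ [n _ <-].
    have : a i n <= 2 - 2 * 2^-1 ^+ n.
      elim: n => [|n IH]; first by rewrite /a /series /= big_geq // expr0 mulr1 subrr.
      rewrite /a /series /= big_nat_recr //= -/(a i n).
      have h : (iota (r n) == i)%:R * 2^-1 ^+ n <= (2^-1 : R) ^+ n.
        by rewrite ler_piMl ?exprn_ge0 //; case: (_ == _).
      have -> : (2^-1 : R) ^+ n.+1 = 2^-1 * 2^-1 ^+ n by rewrite exprS.
      rewrite /a /series /= in IH; lra.
    have : 0 <= (2^-1 : R) ^+ n by rewrite exprn_ge0.
    lra.
  exists (fun i => (lim (a i @ \oo))%:C%C).
  apply/eqP; rewrite -subr_eq0; apply/eqP; apply: nrm_small0 => eps eps0.
  pose S := \sum_i nrm (e i) + 1.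
  have S0 : 0 < S by rewrite ltr_wpDl // sumr_ge0 // => i _; apply: nrm_ge0.
  have d0 : 0 < eps / (2 * S) by rewrite divr_gt0 // mulr_gt0.
  have [N [N1 N2]] : exists N, (forall i, `|lim (a i @ \oo) - a i N| <= eps / (2 * S)) /\
      2^-1 ^+ N <= eps / 2.
    have F : \forall n \near \oo, forall i, `|lim (a i @ \oo) - a i n| <= eps / (2 * S).
      by apply: filter_forall => i; have /cvgrPdist_le := acvg i; apply.
    have e20 : 0 < eps / 2 by rewrite divr_gt0.
    have h2 : (2^-1 : R) < 1 by lra.
    have h0 : (0 : R) <= 2^-1 by lra.
    have [n0 Hn] := geometric_lim0 1 h0 h2 e20.
    have [n1 _ Fn] := F; exists (maxn n0 n1); split.
      by apply: Fn; rewrite /= leq_maxr.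
    by have := Hn _ (leq_maxl n0 n1); rewrite mulr1.
  rewrite (xE N) addrAC -sumrB.
  apply: le_trans (nrmD _ _) _; rewrite (splitr eps); apply: lerD.
    apply: le_trans (nrm_sum _ _) _.
    apply: (@le_trans _ _ (\sum_i eps / (2 * S) * nrm (e i))).
      apply: ler_sum => i _; rewrite -scalerBl -rmorphB nrmZ cnormR distrC.
      by rewrite ler_wpM2r ?nrm_ge0.
    rewrite -mulr_sumr mulrAC ler_pdivrMr ?mulr_gt0 //.
    have -> : eps / 2 * (2 * S) = eps * S by field.
    by rewrite ler_pM2l // /S lerDl.
  rewrite nrmZ cnormR ger0_norm ?exprn_ge0 //.
  by apply: le_trans N2; rewrite ler_piMr ?exprn_ge0.
move=> x; have [x0|x0] := eqVneq (nrm x) 0.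
  exists (fun _ => 0); rewrite big1 ?(nrm0_eq0 x0) // => i _.
  by rewrite scale0r.
have c0 : 0 < nrm x by rewrite lt_def x0 nrm_ge0.
have cC0 : (nrm x)%:C%C != 0 :> R[i] by rewrite -cnorm_gt0 cnormR gtr0_norm.
have [|a aE] := unit_ball ((nrm x)%:C%C^-1 *: x).
  by rewrite nrmZ cnormV cnormR gtr0_norm // mulVf.
exists (fun i => (nrm x)%:C%C * a i).
have -> : \sum_i ((nrm x)%:C%C * a i) *: e i = (nrm x)%:C%C *: \sum_i a i *: e i.
  by rewrite scaler_sumr; apply: eq_bigr => i _; rewrite scalerA.
by rewrite -aE scalerA divff // scale1r.
Qed.

End CompactIdentity.

(** * Coordinatewise operators and exterior signs *)

Section FfunBlin.
Variables (R : realType) (X : normedModType R[i]).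

Lemma nrm_ffun (I : finType) (u : {ffun I -> X}) : nrm u = \sum_i nrm (u i).
Proof.
apply: (@complexI R); rewrite nrmE rmorph_sum /=; apply: eq_bigr => i _.
by rewrite nrmE.
Qed.

Lemma blin_eval (I : finType) (i : I) : blin (fun u : {ffun I -> X} => u i).
Proof.
split; first by move=> a u v; rewrite !ffunE.
exists 1; split=> // u; rewrite mul1r nrm_ffun (bigD1 i) //= lerDl.
by apply: sumr_ge0 => j _; apply: nrm_ge0.
Qed.

Lemma blin_ffun (U : normedModType R[i]) (J : finType) (f : U -> {ffun J -> X}) :
  (forall j, blin (fun u => f u j)) -> blin f.
Proof.
move=> H; split.
  by move=> a u v; apply/ffunP => j; rewrite !ffunE; case: (H j) => l _; apply: l.
have H' j : exists c, op_le (fun u => f u j) c by case: (H j).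
have [c cP] := choice H'.
exists (\sum_j c j); split=> [|u]; first by apply: sumr_ge0 => j _; case: (cP j).
rewrite nrm_ffun mulr_suml; apply: ler_sum => j _; by case: (cP j).
Qed.

End FfunBlin.

Section Signs.
Variables (R : realType) (n : nat).
Implicit Types (A : {set 'I_n}) (i j k : 'I_n).

Definition swap_sign (k i : 'I_n) : R[i] := if (k < i)%N then -1 else 1.
(** The factor at [j = i] is 1, so the same sign serves for [A], [A :\ i] and [i |: A]. *)
Definition fsgn i A : R[i] := \prod_(j in A) swap_sign j i.

Lemma swap_sign_id i : swap_sign i i = 1.
Proof. by rewrite /swap_sign ltnn. Qed.

Lemma swap_sign2 k i : swap_sign k i * swap_sign k i = 1.
Proof. by rewrite /swap_sign; case: ifP; rewrite ?mulrNN mulr1. Qed.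

Lemma swap_signC k i : k != i -> swap_sign k i = - swap_sign i k.
Proof.
rewrite /swap_sign -val_eqE /=.
by case: (ltngtP k i) => //= _ _; rewrite opprK.
Qed.

Lemma fsgn2 i A : fsgn i A * fsgn i A = 1.
Proof. by rewrite -big_split /= big1 // => j _; apply: swap_sign2. Qed.

Lemma fsgnD1 i k A : k \in A -> fsgn i (A :\ k) = swap_sign k i * fsgn i A.
Proof.
by move=> kA; rewrite [in RHS]/fsgn (big_setD1 k kA) /= mulrA swap_sign2 mul1r.
Qed.

Lemma fsgnU1 i k A : k \notin A -> fsgn i (k |: A) = swap_sign k i * fsgn i A.
Proof. by move=> kA; rewrite /fsgn big_setU1. Qed.

End Signs.

(** * Creation and annihilation operators on the exterior algebra *)

Section Fock.
Variables (R : realType) (X : completeNormedModType R[i]) (n : nat).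
Local Notation K := R[i].
Local Notation T := {ffun {set 'I_n} -> X}.
Local Notation sgn := (@fsgn R n).
Local Notation sc := (@bop_sc R T).
Implicit Types (A : {set 'I_n}) (i j : 'I_n) (u : T).

(* The exterior product with [e_i] and its adjoint, the contraction, on
   [X (x) /\ K^n]; the coordinate at [A] is the coefficient of [e_A], and [sgn i A]
   is the sign of moving [e_i] to its place in [e_A]. *)
Fact eps1_blin i : blin (fun u : T =>
  [ffun A : {set 'I_n} => if i \in A then sgn i A *: u (A :\ i) else 0] : T).
Proof.
apply: blin_ffun => A; have [iA|iA] := boolP (i \in A).
  by apply: blin_ext (blinZ (sgn i A) (blin_eval X (A :\ i))) => u; rewrite ffunE iA.
by apply: blin_ext (@blin0 R _ _) => u; rewrite ffunE (negPf iA).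
Qed.
Definition eps1 i : bop T := Bop (eps1_blin i).

Fact iota1_blin i : blin (fun u : T =>
  [ffun A : {set 'I_n} => if i \in A then 0 else sgn i A *: u (i |: A)] : T).
Proof.
apply: blin_ffun => A; have [iA|iA] := boolP (i \in A).
  by apply: blin_ext (@blin0 R _ _) => u; rewrite ffunE iA.
by apply: blin_ext (blinZ (sgn i A) (blin_eval X (i |: A))) => u; rewrite ffunE (negPf iA).
Qed.
Definition iota1 i : bop T := Bop (iota1_blin i).

Fact flift_blin (a : bop X) : blin (fun u : T => [ffun A => a (u A)] : T).
Proof.
apply: blin_ffun => A; apply: blin_ext (blin_comp (bopP a) (blin_eval X A)) => u.
by rewrite ffunE.
Qed.
Definition flift (a : bop X) : bop T := Bop (flift_blin a).

Fact fproj_blin (p : int) : blin (fun u : T =>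
  [ffun A : {set 'I_n} => if #|A|%:Z == p then u A else 0] : T).
Proof.
apply: blin_ffun => A; have [iA|iA] := boolP (#|A|%:Z == p).
  by apply: blin_ext (blin_eval X A) => u; rewrite ffunE iA.
by apply: blin_ext (@blin0 R _ _) => u; rewrite ffunE (negPf iA).
Qed.
Definition fproj p : bop T := Bop (fproj_blin p).

Lemma eps1E i u A : eps1 i u A = if i \in A then sgn i A *: u (A :\ i) else 0.
Proof. by rewrite ffunE. Qed.
Lemma iota1E i u A : iota1 i u A = if i \in A then 0 else sgn i A *: u (i |: A).
Proof. by rewrite ffunE. Qed.
Lemma fliftE a u A : flift a u A = a (u A).
Proof. by rewrite ffunE. Qed.
Lemma fprojE p u A : fproj p u A = if #|A|%:Z == p then u A else 0.
Proof. by rewrite ffunE. Qed.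
Lemma fscE a u A : sc a u A = a *: u A.
Proof. by rewrite ffunE. Qed.

Lemma eps1C i j : eps1 i * eps1 j = - (eps1 j * eps1 i).
Proof.
apply: bop_ext => u; apply/ffunP => A; rewrite !bopNE [in RHS]ffunE !bopME !eps1E !in_setD1.
have [->|ij] := eqVneq i j; first by rewrite ?eqxx /= scaler0 if_same oppr0.
case: (boolP (i \in A)) => iA; case: (boolP (j \in A)) => jA;
  rewrite ?scaler0 ?oppr0 //=.
rewrite /= !scalerA !fsgnD1 // finset.setDDl [A :\ j :\ i]finset.setDDl finset.setUC.
by rewrite -scaleNr (swap_signC R ij); congr (_ *: _); ring.
Qed.

(** The canonical anticommutation relation. *)
Lemma iota1_eps1 i j : iota1 i * eps1 j + eps1 j * iota1 i = sc (i == j)%:R.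
Proof.
apply: bop_ext => u; apply/ffunP => A.
rewrite bopDE ffunE !bopME fscE iota1E !eps1E iota1E in_setU1 in_setD1.
have [->|ij] := eqVneq i j.
  rewrite ?eqxx scale1r /=; case: (boolP (j \in A)) => jA.
    by rewrite add0r fsgnD1 // swap_sign_id mul1r scalerA fsgn2 scale1r finset.setD1K.
  by rewrite addr0 fsgnU1 // swap_sign_id mul1r scalerA fsgn2 scale1r finset.setU1K.
rewrite /= scale0r.
case: (boolP (i \in A)) => iA; case: (boolP (j \in A)) => jA;
  rewrite ?scaler0 ?addr0 //=.
rewrite fsgnU1 // fsgnD1 // !scalerA.
have -> : (i |: A) :\ j = i |: (A :\ j).
  apply/setP => k; rewrite !inE; have [->|//] := eqVneq k j.
  by rewrite eq_sym (negPf ij).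
rewrite -scalerDl (swap_signC R ij) [X in X *: _](_ : _ = 0) ?scale0r //.
by ring.
Qed.

Lemma flift_eps1 a i : flift a * eps1 i = eps1 i * flift a.
Proof.
apply: bop_ext => u; apply/ffunP => A; rewrite !bopME fliftE !eps1E fliftE.
by case: ifP => _; rewrite ?bop_fZ ?bop_f0.
Qed.

Lemma flift_fproj a p : flift a * fproj p = fproj p * flift a.
Proof.
apply: bop_ext => u; apply/ffunP => A; rewrite !bopME fliftE !fprojE fliftE.
by case: ifP => _; rewrite ?bop_f0.
Qed.

Lemma fliftD a b : flift (a + b) = flift a + flift b.
Proof. by apply: bop_ext => u; apply/ffunP => A; rewrite bopDE [RHS]ffunE !fliftE. Qed.

Lemma fliftM a b : flift (a * b) = flift a * flift b.
Proof. by apply: bop_ext => u; apply/ffunP => A; rewrite bopME !fliftE. Qed.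

Lemma flift_sc k : flift (bop_sc X k) = sc k.
Proof. by apply: bop_ext => u; apply/ffunP => A; rewrite [LHS]ffunE [RHS]ffunE. Qed.

Lemma fprojM p q : fproj p * fproj q = if p == q then fproj p else 0.
Proof.
apply: bop_ext => u; apply/ffunP => A; rewrite !bopME !fprojE.
have [->|pq] := eqVneq p q; first by rewrite fprojE; case: (_ == q).
rewrite bop0E ffunE; case: eqP => // ->.
by rewrite (negPf pq).
Qed.

Lemma eps1_fproj i p : eps1 i * fproj p = fproj (p + 1) * eps1 i.
Proof.
apply: bop_ext => u; apply/ffunP => A; rewrite !bopME fprojE !eps1E fprojE.
case: (boolP (i \in A)) => iA; last by rewrite if_same.
have -> : (#|A|%:Z == p + 1) = (#|A :\ i|%:Z == p).
  by rewrite (cardsD1 i A) iA add1n -addn1 PoszD (inj_eq (addIr 1)).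
by case: ifP => _; rewrite ?scaler0.
Qed.

Lemma iota1_fproj i p : iota1 i * fproj p = fproj (p - 1) * iota1 i.
Proof.
apply: bop_ext => u; apply/ffunP => A; rewrite !bopME fprojE !iota1E fprojE.
case: (boolP (i \in A)) => iA; first by rewrite if_same.
have -> : (#|A|%:Z == p - 1) = (#|i |: A|%:Z == p).
  by rewrite cardsU1 iA add1n -addn1 PoszD eq_sym subr_eq eq_sym.
by case: ifP => _; rewrite ?scaler0.
Qed.

Lemma fproj_out p : p < 0 \/ n%:Z < p -> fproj p = 0.
Proof.
move=> pn; apply: bop_ext => u; apply/ffunP => A; rewrite fprojE bop0E ffunE.
case: eqP => // E; have h : (#|A| <= n)%N.
  by apply: leq_trans (max_card _) _; rewrite card_ord.
by move: pn h; rewrite -E; move: #|A| => k; lia.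
Qed.

Definition delta_fock A (x : X) : T := [ffun B => if B == A then x else 0].

Lemma delta_fock_eps1 i A x : i \in A ->
  delta_fock A x = sgn i A *: eps1 i (delta_fock (A :\ i) x).
Proof.
move=> iA; apply/ffunP => B; rewrite !ffunE.
case: (boolP (i \in B)) => iB; last first.
  by rewrite scaler0; case: eqP => // E; rewrite E iA in iB.
rewrite scalerA; have -> : (B :\ i == A :\ i) = (B == A).
  apply/eqP/eqP => [E|-> //]; by rewrite -(finset.setD1K iA) -E finset.setD1K.
by case: eqP => [->|_]; rewrite ?fsgn2 ?scale1r ?scaler0.
Qed.

Lemma fock_decomp u : u = \sum_A delta_fock A (u A).
Proof.
apply/ffunP => B; rewrite sum_ffunE (bigD1 B) //= ffunE eqxx big1 ?addr0 // => A AB.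
by rewrite ffunE eq_sym (negPf AB).
Qed.

(* An operator that (anti)commutes with the creation operators is determined
   by its values on the vacuum. *)
Lemma fock_ind (V : normedModType K) (a : T -> V) (e : 'I_n -> V -> V) : blin a ->
  (forall i, e i 0 = 0) -> (forall i u, a (eps1 i u) = e i (a u)) ->
  (forall x, a (delta_fock finset.set0 x) = 0) -> forall u, a u = 0.
Proof.
move=> [al _] e0 ae av u.
have a0 : a 0 = 0.
  by have h := al 1 0 0; rewrite scaler0 addr0 scale1r in h; apply: (addrI (a 0)); rewrite addr0 -h.
have aZ k v : a (k *: v) = k *: a v by rewrite -[k *: v]addr0 al a0 addr0.
have aD v w : a (v + w) = a v + a w by rewrite -[v]scale1r al !scale1r.
have H m A x : #|A| = m -> a (delta_fock A x) = 0.
  elim: m A => [|m IH] A; first by move/eqP; rewrite cards_eq0 => /eqP ->.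
  move=> Am; have /card_gt0P[i iA] : (0 < #|A|)%N by rewrite Am.
  rewrite (delta_fock_eps1 x iA) aZ ae IH ?e0 ?scaler0 //.
  by move: Am; rewrite (cardsD1 i A) iA => -[].
rewrite (fock_decomp u); elim: (index_enum _) => [|A r IH]; first by rewrite big_nil.
by rewrite big_cons aD IH addr0 (H #|A|).
Qed.

End Fock.

(** To be read with [k] the differential, [t] and [tw] the actions of [v] and [w], [e] the product
    with [w], and [e2], [t2] belonging to [[v, w]]. *)
Lemma commutator_anticomm (Q : pzRingType) (k t e e2 tw t2 : Q) :
  t * e = e * t + e2 -> k * e = tw - e * k -> k * e2 = t2 - e2 * k ->
  t2 = t * tw - tw * t -> (k * t - t * k) * e = - e * (k * t - t * k).
Proof.
move=> te ke ke2 br.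
have -> : (k * t - t * k) * e = k * (t * e) - t * (k * e) by nc_ring.
rewrite te ke; have -> : k * (e * t + e2) - t * (tw - e * k) =
  (k * e) * t + k * e2 - t * tw + (t * e) * k by nc_ring.
by rewrite ke ke2 te br; nc_ring.
Qed.

(** * The Koszul differential as an operator on the total space *)

Section KoszulOperator.
Variables (R : realType) (L : lieAlgType R[i]) (X : completeNormedModType R[i]).
Local Notation K := R[i].
Local Notation n := (\dim {:L}).
Local Notation T := {ffun {set 'I_n} -> X}.
Local Notation sc := (@bop_sc R T).
Local Notation b := (vbasis {:L}).
Local Notation co v i := (coord b i v).
Local Notation eps1 := (@eps1 R X n).
Local Notation iota1 := (@iota1 R X n).
Local Notation flift := (@flift R X n).
Local Notation fproj := (@fproj R X n).
Implicit Types (u v w : L).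

Definition vac (x : X) : T := delta_fock finset.set0 x.

Let scC k (a : bop T) : sc k * a = a * sc k.
Proof. exact: (scC (bop_bdata T)). Qed.
Let scM k l : sc (k * l) = sc k * sc l.
Proof. exact: (scM (bop_bdata T)). Qed.
Let scD k l : sc (k + l) = sc k + sc l.
Proof. exact: (scD (bop_bdata T)). Qed.
Let sc0 : sc 0 = 0.
Proof. exact: (sc0 (bop_bdata T)). Qed.
Let sc1 : sc 1 = 1.
Proof. exact: (sc1 (bop_bdata T)). Qed.
Let scN k : sc (- k) = - sc k.
Proof. exact: (scN (bop_bdata T)). Qed.

Definition op_linear (g : L -> bop T) :=
  forall k u v, g (k *: u + v) = sc k * g u + g v.

Lemma op_linear_coord g : op_linear g ->
  forall v, g v = \sum_(i < n) sc (co v i) * g b`_i.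
Proof.
move=> gl v; have g0 : g 0 = 0.
  by have := gl 1 0 0; rewrite scaler0 addr0 sc1 mul1r => h; apply: (addrI (g 0)); rewrite addr0 -h.
rewrite {1}(coord_vbasis (memvf v)).
by elim/big_rec2: _ => [//|i y1 y2 _ <-]; rewrite gl.
Qed.

Lemma op_linearD g u v : op_linear g -> g (u + v) = g u + g v.
Proof. by move=> gl; rewrite -[u]scale1r gl sc1 mul1r scale1r. Qed.

Lemma op_linearN g u : op_linear g -> g (- u) = - g u.
Proof.
move=> gl; apply: (addrI (g u)); rewrite -op_linearD // !subrr.
have := gl 1 0 0; rewrite scaler0 addr0 sc1 mul1r => h.
by apply: (addrI (g 0)); rewrite addr0 -h.
Qed.

Definition feps v : bop T := \sum_(i < n) sc (co v i) * eps1 i.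

Lemma feps_linear : op_linear feps.
Proof.
move=> k u v; rewrite /feps mulr_sumr -big_split; apply: eq_bigr => i _ /=.
by rewrite linearP /= scD scM mulrDl mulrA.
Qed.

Lemma feps_basis (i : 'I_n) : feps b`_i = eps1 i.
Proof.
rewrite /feps (bigD1 i) //= coord_free ?(basis_free (vbasisP _)) // eqxx sc1 mul1r.
rewrite big1 ?addr0 // => j ji.
by rewrite coord_free ?(basis_free (vbasisP _)) // eq_sym (negPf ji) sc0 mul0r.
Qed.

Lemma fepsC u v : feps u * feps v = - (feps v * feps u).
Proof.
have E x y : feps x * feps y =
    \sum_(i < n) \sum_j sc (co x i * co y j) * (eps1 i * eps1 j).
  rewrite /feps mulr_suml; apply: eq_bigr => i _; rewrite mulr_sumr.
  apply: eq_bigr => j _; rewrite scM -!mulrA; congr (_ * _).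
  by rewrite !mulrA scC.
rewrite !E exchange_big -sumrN; apply: eq_bigr => i _; rewrite -sumrN.
by apply: eq_bigr => j _; rewrite eps1C mulrN mulrC.
Qed.

Lemma iota1_feps i v : iota1 i * feps v = sc (co v i) - feps v * iota1 i.
Proof.
apply/eqP; rewrite eq_sym subr_eq eq_sym; apply/eqP.
rewrite /feps mulr_sumr mulr_suml -big_split /= (bigD1 i) //= big1 ?addr0.
  rewrite mulrA -scC -!mulrA -mulrDr iota1_eps1 eqxx.
  by rewrite sc1 mulr1.
move=> j ji; rewrite mulrA -scC -!mulrA -mulrDr iota1_eps1 eq_sym (negPf ji).
by rewrite sc0 mulr0.
Qed.

Lemma flift_feps a v : flift a * feps v = feps v * flift a.
Proof.
rewrite /feps mulr_sumr mulr_suml; apply: eq_bigr => i _.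
by rewrite mulrA -scC -!mulrA flift_eps1.
Qed.

Lemma feps_fproj v p : feps v * fproj p = fproj (p + 1) * feps v.
Proof.
rewrite /feps mulr_sumr mulr_suml; apply: eq_bigr => i _.
by rewrite mulrA -scC -!mulrA eps1_fproj.
Qed.

(* The derivation of [/\ L] that extends [ad u]. *)
Definition fG u : bop T := \sum_(i < n) feps (lieb u b`_i) * iota1 i.

Lemma fG_linear : op_linear fG.
Proof.
move=> k u v; rewrite /fG mulr_sumr -big_split; apply: eq_bigr => i _ /=.
by rewrite (lieb_linearl _ k u v) feps_linear mulrDl mulrA.
Qed.

Lemma fG_feps u v : fG u * feps v = feps v * fG u + feps (lieb u v).
Proof.
have lin : op_linear (fun w => feps (lieb u w)).
  by move=> k x y; rewrite (lieb_linearr u k x y) feps_linear.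
rewrite [feps (lieb u v)](op_linear_coord lin) /fG mulr_suml mulr_sumr -big_split.
apply: eq_bigr => i _ /=.
by rewrite -mulrA iota1_feps mulrBr -scC addrC !mulrA (fepsC (lieb u _) v) mulNr opprK.
Qed.

Lemma fG_fproj u p : fG u * fproj p = fproj p * fG u.
Proof.
rewrite /fG mulr_sumr mulr_suml; apply: eq_bigr => i _.
by rewrite -mulrA iota1_fproj mulrA feps_fproj subrK mulrA.
Qed.

Section Representation.
Variable rho : representation L X.

Fact rep_blin v : blin (rho v).
Proof.
split; first exact: rep_op_linear.
pose g : {linear X -> X} :=
  HB.pack (rho v) (GRing.isLinear.Build _ _ _ _ _ (rep_op_linear rho v)).
exact: (proj1 (blin_continuousP g) (rep_op_continuous (r := rho) (l := v))).
Qed.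
Definition rep_bop v : bop X := Bop (rep_blin v).

Definition frep v := flift (rep_bop v).

Lemma frep_linear : op_linear frep.
Proof.
move=> k u v; rewrite /frep -flift_sc -fliftM -fliftD; congr flift.
by apply: bop_ext => x; apply: (rep_linear rho x).
Qed.

Definition ftheta v : bop T := frep v + fG v.

Lemma ftheta_linear : op_linear ftheta.
Proof.
by move=> k u v; rewrite /ftheta frep_linear fG_linear mulrDr addrACA.
Qed.

Lemma ftheta_feps u v : ftheta u * feps v = feps v * ftheta u + feps (lieb u v).
Proof. by rewrite /ftheta mulrDl mulrDr flift_feps fG_feps addrA. Qed.

Lemma ftheta_fproj u p : ftheta u * fproj p = fproj p * ftheta u.
Proof. by rewrite /ftheta mulrDl mulrDr flift_fproj fG_fproj. Qed.

(* The factor 1/2 is there because the second sum meets each pair [i < j] twice. *)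
Definition kosz : bop T :=
  \sum_(i < n) frep b`_i * iota1 i + sc 2^-1 * \sum_(i < n) fG b`_i * iota1 i.

Lemma kosz_fproj p : kosz * fproj p = fproj (p - 1) * kosz.
Proof.
have E (g : 'I_n -> bop T) : (forall i q, g i * fproj q = fproj q * g i) ->
    (\sum_(i < n) g i * iota1 i) * fproj p = fproj (p - 1) * \sum_(i < n) g i * iota1 i.
  move=> gP; rewrite mulr_suml mulr_sumr; apply: eq_bigr => i _.
  by rewrite -mulrA iota1_fproj !mulrA gP.
rewrite /kosz mulrDl mulrDr E; last by move=> i q; apply: flift_fproj.
rewrite -mulrA E; last by move=> i q; apply: fG_fproj.
by rewrite !mulrA scC.
Qed.

(** Cartan's homotopy formula. In the second sum [fG v] arises twice, from contracting [v] and from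
    moving [fG] past [feps v]; the factor 1/2 compensates. *)
Lemma kosz_feps v : kosz * feps v + feps v * kosz = ftheta v.
Proof.
have E1 : (\sum_(i < n) frep b`_i * iota1 i) * feps v +
    feps v * (\sum_(i < n) frep b`_i * iota1 i) = frep v.
  rewrite mulr_suml mulr_sumr -big_split /= (op_linear_coord frep_linear v).
  apply: eq_bigr => i _; rewrite -mulrA iota1_feps mulrBr -scC.
  by rewrite !mulrA flift_feps subrK.
have E2 : (\sum_(i < n) fG b`_i * iota1 i) * feps v +
    feps v * (\sum_(i < n) fG b`_i * iota1 i) = fG v + fG v.
  rewrite mulr_suml mulr_sumr -big_split /= {1}(op_linear_coord fG_linear v).
  rewrite [X in _ = _ + X]/fG -big_split /=; apply: eq_bigr => i _.
  rewrite -mulrA iota1_feps mulrBr -scC !mulrA fG_feps.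
  rewrite (liebC b`_i v) (op_linearN _ feps_linear).
  set g := fG _; set e := feps (lieb _ _); set h := feps v; set a := iota1 i.
  by nc_ring.
rewrite /kosz /ftheta -{}E1.
have -> : fG v = sc 2^-1 * (fG v + fG v).
  rewrite mulrDr -mulrDl -scD; have := splitr (1 : K).
  by rewrite !mul1r => <-; rewrite sc1 mul1r.
rewrite -{}E2; set Y := \sum_(i < n) fG _ * _.
rewrite mulrDl !mulrDr !mulrA (scC _ (feps v)) -!mulrA; nc_ring.
Qed.

Lemma fock_zero (a : bop T) k : (forall v, a * feps v = sc k * feps v * a) ->
  (forall x, a (vac x) = 0) -> a = 0.
Proof.
move=> ae av; apply: bop_ext => u; rewrite bop0E.
apply: (@fock_ind _ X n T a (fun i y => (sc k * eps1 i) y)) => //.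
- exact: bopP.
- by move=> i; rewrite bop_f0.
by move=> i y; rewrite -!bopME -feps_basis ae.
Qed.

Lemma iota1_vac i x : iota1 i (vac x) = 0.
Proof.
apply/ffunP => A; rewrite iota1E !ffunE.
case: ifP => // _; case: eqP => [E|_]; last by rewrite scaler0.
by have := finset.in_setU1 i i A; rewrite E eqxx finset.in_set0.
Qed.

Lemma ftheta_vac v x : ftheta v (vac x) = vac (rho v x).
Proof.
rewrite bopDE /fG bop_sumE big1 ?addr0 => [|i _]; last by rewrite bopME iota1_vac bop_f0.
apply/ffunP => A; rewrite /frep fliftE !ffunE; case: eqP => // _.
exact: bop_f0.
Qed.

Lemma kosz_vac x : kosz (vac x) = 0.
Proof.
rewrite bopDE bopME !bop_sumE !big1 ?bop_f0 ?addr0 // => i _;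
  by rewrite bopME iota1_vac bop_f0.
Qed.

(** Both sides have the same commutator with [feps w], by Jacobi, and agree in degree 0, where this
    is the hypothesis on [rho]. *)
Lemma ftheta_lieb u v : ftheta (lieb u v) = ftheta u * ftheta v - ftheta v * ftheta u.
Proof.
apply/eqP; rewrite eq_sym -subr_eq0; apply/eqP; apply: (fock_zero (k := 1)).
  move=> w; rewrite sc1 mul1r.
  have J : feps (lieb u (lieb v w)) - feps (lieb v (lieb u w)) = feps (lieb (lieb u v) w).
    rewrite -(op_linearN _ feps_linear) -op_linearD; last exact: feps_linear.
    congr feps; have := lieb_jacobi u v w.
    rewrite (liebC w u) linearN /= (liebC w (lieb u v)) => /eqP.
    by rewrite subr_eq0 => /eqP.
  have E x y : ftheta x * ftheta y * feps w = feps w * ftheta x * ftheta y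
     + feps (lieb x w) * ftheta y + feps (lieb y w) * ftheta x + feps (lieb x (lieb y w)).
    rewrite -mulrA ftheta_feps mulrDr ftheta_feps mulrA ftheta_feps.
    by nc_ring.
  have H (p q r s : bop T) : (p - q - r) * s = p * s - q * s - r * s by nc_ring.
  rewrite H !E ftheta_feps -J.
  set p := ftheta u; set q := ftheta v; set r := ftheta (lieb u v); set e := feps w.
  set e1 := feps (lieb u w); set e2 := feps (lieb v w); set e3 := feps (lieb u _).
  by set e4 := feps (lieb v _); nc_ring.
move=> x; rewrite !bopBE !bopME !ftheta_vac rep_lieb.
have vB y z : vac (y - z) = vac y - vac z.
  by apply/ffunP => A; rewrite !ffunE; case: eqP; rewrite ?subr0.
by rewrite vB subrr.
Qed.

Lemma kosz_ftheta v : kosz * ftheta v = ftheta v * kosz.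
Proof.
apply/eqP; rewrite -subr_eq0; apply/eqP; apply: (fock_zero (k := -1)).
  move=> w; rewrite scN sc1 mulN1r.
  have kf x : kosz * feps x = ftheta x - feps x * kosz by rewrite -kosz_feps addrK.
  exact: (commutator_anticomm (ftheta_feps v w) (kf w) (kf _) (ftheta_lieb v w)).
by move=> x; rewrite bopBE !bopME ftheta_vac !kosz_vac bop_f0 subrr.
Qed.

(** By Cartan's formula and [kosz_ftheta] the square commutes with every [feps w]; it kills degree
    0, hence everything. *)
Lemma kosz_kosz : kosz * kosz = 0.
Proof.
apply: (fock_zero (k := 1)); last by move=> x; rewrite bopME kosz_vac bop_f0.
move=> w; rewrite sc1 mul1r.
have kf x : kosz * feps x = ftheta x - feps x * kosz by rewrite -kosz_feps addrK.
rewrite -mulrA kf mulrBr mulrA kf kosz_ftheta.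
set k := kosz; set t := ftheta w; set e := feps w; nc_ring.
Qed.

End Representation.

End KoszulOperator.

(** * Determinants and sorted enumerations *)

Section Minors.
Variables (K : comPzRingType) (L : nmodType).
Implicit Types (cs : seq (L -> K)) (l : seq L).

(** The columns form a list of functionals, so that a cofactor is a deletion in a list, with no
    reindexing of sets. *)
Definition minor cs l m : K :=
  \det (\matrix_(r < m, c < m) nth (fun=> 0) cs c l`_r).

Lemma minor_expand cs v l m : size cs = m.+1 ->
  minor cs (v :: l) m.+1 =
  \sum_(c < m.+1) nth (fun=> 0) cs c v * (-1) ^+ c * minor (take c cs ++ drop c.+1 cs) l m.
Proof.
move=> sc; rewrite /minor (expand_det_row _ ord0); apply: eq_bigr => j _.
rewrite mxE /= /cofactor add0n mulrA; congr (_ * \det _).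
apply/matrixP => r c; rewrite !mxE lift0 /= nth_cat size_take sc ltn_ord /bump.
case: (ltnP c j) => cj; first by rewrite nth_take.
by rewrite nth_drop add1n addSn subnKC.
Qed.

End Minors.

Section SortedSigns.
Variables (R : realType) (n : nat).
Implicit Types (A : {set 'I_n}) (i : 'I_n).

Let lt_ord : rel 'I_n := fun i j => (i < j)%N.
Let lt_trans : transitive lt_ord.
Proof. by move=> j i k; apply: ltn_trans. Qed.

Lemma enum_set_sorted A : sorted lt_ord (enum A).
Proof.
apply: sorted_filter => //; rewrite -enumT.
by have := iota_ltn_sorted 0 n; rewrite -val_enum_ord sorted_map.
Qed.

Lemma prod_swap_sign (s : seq 'I_n) i : sorted lt_ord s -> i \in s ->
  \prod_(j <- s) swap_sign R j i = (-1) ^+ index i s.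
Proof.
elim: s => [//|y s IH] ps; rewrite inE big_cons /=.
have /allP ys := order_path_min lt_trans ps.
have [->|yi] := eqVneq i y => /= [_|isin].
  rewrite swap_sign_id mul1r expr0 big1_seq // => j /andP[_ /ys].
  by rewrite /lt_ord /swap_sign => yj; rewrite ltnNge ltnW.
rewrite IH ?(path_sorted ps) // exprS.
by have yli := ys i isin; rewrite /lt_ord in yli; rewrite /swap_sign yli.
Qed.

Lemma fsgn_index i A : i \in A -> fsgn R i A = (-1) ^+ index i (enum A).
Proof.
move=> iA; rewrite -prod_swap_sign ?enum_set_sorted ?mem_enum //.
by rewrite big_enum.
Qed.

Lemma enum_setD1 i A : enum (A :\ i) = rem i (enum A).
Proof.
rewrite rem_filter ?enum_uniq // /enum_mem -filter_predI; apply: eq_filter => j /=.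
by rewrite !inE.
Qed.

End SortedSigns.

(** * Monomials and the embedding of the Koszul spaces *)

Section Mono.
Variables (R : realType) (L : lieAlgType R[i]) (X : completeNormedModType R[i]).
Local Notation K := R[i].
Local Notation n := (\dim {:L}).
Local Notation T := {ffun {set 'I_n} -> X}.
Local Notation b := (vbasis {:L}).
Implicit Types (A : {set 'I_n}) (l : seq L) (x : X).

(** The counterpart of [ktensor] on the total space: the tensor of [x] with the exterior product of
    [l]. *)
Definition mono x l : T := foldr (fun v u => feps X v u) (vac L x) l.

Let coords A : seq (L -> K) := [seq (fun v => coord b i v) | i <- enum A].

(** Applying [feps v] expands the minor along its first row; the sign of a column is [fsgn] of its
    index. *)
Lemma mono_coord x l A :
  mono x l A = if #|A| == size l then minor (coords A) l #|A| *: x else 0.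
Proof.
elim: l A => [|v l IH] A /=.
  rewrite ffunE cards_eq0; case: eqP => // ->.
  by rewrite /minor cards0 det_mx00 scale1r.
rewrite /feps bop_sumE sum_ffunE.
have -> : \sum_i (bop_sc T (coord b i v) * eps1 X i) (mono x l) A =
    \sum_(i in A) (coord b i v * fsgn R i A) *: mono x l (A :\ i).
  rewrite [RHS]big_mkcond; apply: eq_bigr => i _.
  by rewrite bopME fscE eps1E; case: ifP; rewrite ?scalerA ?scaler0.
have [Al|Al] := eqVneq #|A| (size l).+1; last first.
  rewrite big1 // => i iA; rewrite IH ifF ?scaler0 //.
  by apply: contraNF Al => /eqP <-; rewrite (cardsD1 i A) iA.
have sA : size (coords A) = (size l).+1 by rewrite size_map -cardE.
rewrite Al minor_expand // scaler_suml -big_enum /=.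
have /card_gt0P[i0 _] : (0 < #|A|)%N by rewrite Al.
rewrite (big_nth i0) -cardE Al big_mkord; apply: eq_bigr => c _.
have cA : (c < size (enum A))%N by rewrite -cardE Al.
set i := nth i0 (enum A) c.
have iA : i \in A by rewrite -mem_enum mem_nth.
have ic : index i (enum A) = c by rewrite index_uniq ?enum_uniq.
have Ai : #|A :\ i| = size l by move: Al; rewrite (cardsD1 i A) iA => -[].
rewrite IH Ai eqxx scalerA; congr (_ *: _); rewrite fsgn_index // ic.
rewrite /coords (nth_map i0) // -/i; congr (_ * _ * minor _ _ _).
by rewrite enum_setD1 remE ic map_cat map_take map_drop.
Qed.

Section Injections.
Variable p : int.
Local Notation kspace := (koszul_space L X p).

Definition kinj (v : kspace) : T := [ffun A => oapp v 0 (insub A)].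
Definition kproj (u : T) : kspace := [ffun B => u (val B)].

Lemma kinj_blin : blin kinj.
Proof.
apply: blin_ffun => A; case E: (insub A : option (subsets L p)) => [B|].
  by apply: blin_ext (blin_eval X B) => u; rewrite ffunE E.
by apply: blin_ext (@blin0 R _ _) => u; rewrite ffunE E.
Qed.

Lemma kproj_blin : blin kproj.
Proof.
apply: blin_ffun => B; apply: blin_ext (blin_eval X (val B)) => u.
by rewrite ffunE.
Qed.

Lemma kinjK v : kproj (kinj v) = v.
Proof. by apply/ffunP => B; rewrite !ffunE valK. Qed.

Lemma kprojK u : kinj (kproj u) = fproj X n p u.
Proof.
apply/ffunP => A; rewrite !ffunE; case: insubP => [B AP BA|/negPf ->] //=.
by rewrite ffunE BA AP.
Qed.

Lemma kinj_ktensor x l : (size l)%:Z = p -> kinj (ktensor p x l) = mono x l.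
Proof.
move=> lp; apply/ffunP => A; rewrite mono_coord ffunE.
case: insubP => [B AP BA|AP] /=; last first.
  by rewrite ifF //; apply: contraNF AP => /eqP ->; rewrite lp.
have Al : #|A| == size l by move: AP; rewrite -lp.
rewrite Al ffunE BA; congr (\det _ *: x); apply/matrixP => r c; rewrite !mxE.
rewrite /coords (nth_map (enum_val c)) -?cardE //.
by rewrite -enum_val_nth.
Qed.

End Injections.

End Mono.

(** * Agreement with the explicit differential *)

Section KoszulDifferential.
Variables (R : realType) (L : lieAlgType R[i]) (X : completeNormedModType R[i]).
Variable rho : representation L X.
Local Notation K := R[i].
Local Notation feps := (feps X).
Implicit Types (l : seq L) (x : X) (v w : L).

Lemma fepsCE v w u : feps v (feps w u) = - feps w (feps v u).
Proof. by rewrite -!bopME -bopNE -fepsC. Qed.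

Lemma delete0 v l : delete 0 (v :: l) = l.
Proof. by rewrite /delete /= drop0. Qed.

Lemma deleteS v l k : delete k.+1 (v :: l) = v :: delete k l.
Proof. by []. Qed.

Lemma size_delete l k : (k < size l)%N -> size (delete k l) = (size l).-1.
Proof.
move=> kl; rewrite size_cat size_drop size_takel ?(ltnW kl) //.
by rewrite -(subnKC kl) /= addKn.
Qed.

Lemma ftheta_mono v x l : ftheta rho v (mono x l) =
  mono (rho v x) l + \sum_(i < size l) (-1) ^+ i *: mono x (lieb v l`_i :: delete i l).
Proof.
elim: l => [|w l IH]; first by rewrite big_ord0 addr0 ftheta_vac.
rewrite -[mono x (w :: l)]/(feps w (mono x l)) -bopME ftheta_feps bopDE !bopME IH.
rewrite big_ord_recl expr0 scale1r /= delete0 bop_fD -addrA; congr (_ + _).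
rewrite addrC; congr (_ + _); rewrite bop_f_sum; apply: eq_bigr => i _.
by rewrite bop_fZ /= fepsCE ?add1n exprS mulN1r scalerN scaleNr.
Qed.

(** Induction by Cartan's formula: the action of the first vector gives the terms in which it is
    deleted or bracketed, and the remaining ones are those of the tail with indices shifted. *)
Lemma kosz_mono x l : kosz rho (mono x l) =
  \sum_(k < size l) (-1) ^+ k *: mono (rho l`_k x) (delete k l)
  + \sum_(j < size l) \sum_(i < j)
      (-1) ^+ (i + j + 1) *: mono x (lieb l`_i l`_j :: delete i (delete j l)).
Proof.
elim: l => [|v l IH]; first by rewrite !big_ord0 addr0 kosz_vac.
rewrite -[mono x (v :: l)]/(feps v (mono x l)).
have -> : kosz rho (feps v (mono x l)) =
    ftheta rho v (mono x l) - feps v (kosz rho (mono x l)).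
  by rewrite -(kosz_feps rho v) bopDE !bopME addrK.
rewrite IH ftheta_mono /= !big_ord_recl /= big_ord0 add0r expr0 scale1r delete0.
rewrite bop_fD !bop_f_sum opprD -!addrA; congr (_ + _).
rewrite addrCA; congr (_ + _).
  rewrite -sumrN; apply: eq_bigr => k _.
  by rewrite bop_fZ /= ?add1n exprS mulN1r scaleNr.
rewrite -sumrN -big_split; apply: eq_bigr => j _ /=.
rewrite big_ord_recl /= ?add0n ?add1n; congr (_ + _).
  by rewrite deleteS delete0 ?add0n addn1 !exprS !mulN1r opprK.
rewrite bop_f_sum -sumrN; apply: eq_bigr => i _ /=.
rewrite bop_fZ fepsCE scalerN opprK; congr (_ *: _).
have -> : (bump 0 i + bump 0 j + 1 = (i + j + 1).+2)%N.
  by rewrite /bump !leq0n !add1n !addn1 addSn addnS.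
by rewrite 2!exprS !mulN1r opprK.
Qed.

Lemma kinj_sum p I (r : seq I) (F : I -> koszul_space L X p) :
  kinj (\sum_(i <- r) F i) = \sum_(i <- r) kinj (F i).
Proof.
have [kl _] := @kinj_blin R L X p.
have kD (y z : koszul_space L X p) : kinj (y + z) = kinj y + kinj z.
  by have := kl 1 y z; rewrite !scale1r.
elim: r => [|i r IH]; last by rewrite !big_cons kD IH.
rewrite !big_nil; apply/ffunP => A; rewrite !ffunE.
by case: insubP => [B _ _|_] //=; rewrite ffunE.
Qed.

Lemma kinjZ p k (u : koszul_space L X p) : kinj (k *: u) = k *: kinj u.
Proof.
apply/ffunP => A; rewrite !ffunE; case: insubP => [B _ _|_] /=; last by rewrite scaler0.
by rewrite ffunE.
Qed.

Lemma kinjD p (u v : koszul_space L X p) : kinj (u + v) = kinj u + kinj v.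
Proof.
apply/ffunP => A; rewrite !ffunE; case: insubP => [B _ _|_] /=; last by rewrite addr0.
by rewrite ffunE.
Qed.

Lemma size_deleteZ l k q : (k < size l)%N -> (size l)%:Z = q + 1 ->
  (size (delete k l))%:Z = q.
Proof.
move=> kl; rewrite size_delete //; case: (size l) kl => [//|m] _ /=.
by rewrite -addn1 PoszD => /addIr.
Qed.

Lemma kinj_koszul_formula q x l : (size l)%:Z = q + 1 ->
  kinj (koszul_formula q rho x l) = kosz rho (mono x l).
Proof.
move=> lq; rewrite kosz_mono /koszul_formula kinjD !kinj_sum; congr (_ + _).
  by apply: eq_bigr => k _; rewrite kinjZ kinj_ktensor // (size_deleteZ _ lq).
apply: eq_bigr => j _; rewrite kinj_sum; apply: eq_bigr => i _.
rewrite kinjZ kinj_ktensor //=.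
have jl := ltn_ord j; have sj := size_deleteZ jl lq.
have ij : (i < size (delete j l))%N.
  rewrite size_delete //; apply: leq_trans (ltn_ord i) _.
  by rewrite -ltnS prednK // (leq_trans _ jl).
by rewrite size_delete // -sj; case: (size (delete j l)) ij.
Qed.

Lemma kinj_koszul_d p q (u : koszul_space L X p) : p = q + 1 ->
  kinj (koszul_d q rho u) = kosz rho (kinj u).
Proof.
move=> pq; rewrite /koszul_d kinj_sum [in RHS](koszul_space_decomp u) kinj_sum bop_f_sum.
apply: eq_bigr => A _; have sA : (size (basis_seq (val A)))%:Z = p.
  by rewrite size_map -cardE; apply/eqP; exact: (valP A).
by rewrite kinj_koszul_formula ?sA // kinj_ktensor.
Qed.

End KoszulDifferential.

(** * Functoriality of the exterior algebra *)

Section FockFunctor.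
Variables (R : realType) (L1 L2 : lieAlgType R[i]) (X : completeNormedModType R[i]).
Variable phi : {linear L1 -> L2}.
Local Notation K := R[i].
Local Notation n1 := (\dim {:L1}).
Local Notation T1 := {ffun {set 'I_n1} -> X}.
Local Notation T2 := {ffun {set 'I_(\dim {:L2})} -> X}.
Local Notation b := (vbasis {:L1}).
Local Notation eps2 := (@feps R L2 X).
Implicit Types (A : {set 'I_n1}) (i j : 'I_n1) (x : X).

Lemma vac_blin : blin (@vac R L2 X).
Proof.
apply: blin_ffun => A; have [A0|A0] := eqVneq A finset.set0.
  by apply: blin_ext (@blin_id R X) => x; rewrite ffunE A0 eqxx.
by apply: blin_ext (@blin0 R _ _) => x; rewrite ffunE (negPf A0).
Qed.

Lemma mono_blin (l : seq L2) : blin (fun x => mono x l).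
Proof.
elim: l => [|v l IH]; first exact: vac_blin.
exact: (blin_comp (bopP (eps2 v)) IH).
Qed.

(* The map [X (x) /\ phi]. *)
Definition fockJ (u : T1) : T2 :=
  \sum_A mono (u A) [seq phi v | v <- basis_seq A].

Lemma fockJ_blin : blin fockJ.
Proof.
by apply: blin_sum => A; apply: (blin_comp (mono_blin _) (blin_eval X A)).
Qed.

Lemma fockJ_delta A x : fockJ (delta_fock A x) = mono x [seq phi v | v <- basis_seq A].
Proof.
rewrite /fockJ (bigD1 A) //= ffunE eqxx big1 ?addr0 // => B BA.
rewrite ffunE (negPf BA); elim: [seq _ | _ <- _] => [|v l IH] /=.
  by apply/ffunP => C; rewrite !ffunE if_same.
by rewrite IH bop_f0.
Qed.

Let word (s : seq 'I_n1) x : T2 := mono x [seq phi b`_i | i : 'I_n1 <- s].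

Let lt_ord : rel 'I_n1 := fun i j => (i < j)%N.

(** Enumerates [i |: A] from the enumeration of [A]; the transpositions made on the way account for
    [fsgn i A]. *)
Fixpoint insert_ord i (s : seq 'I_n1) :=
  if s is j :: s' then if (i < j)%N then i :: s else j :: insert_ord i s' else [:: i].

Let mem_insert i s : insert_ord i s =i i :: s.
Proof.
elim: s => [//|j s IH] k /=; case: ifP => // _.
by rewrite !inE IH inE orbCA.
Qed.

Let sorted_insert i s : sorted lt_ord s -> i \notin s -> sorted lt_ord (insert_ord i s).
Proof.
elim: s => [//|j s IH] /= js; rewrite inE negb_or => /andP[ij iS].
case: (ltnP i j) => [ij'|ji]; first by rewrite /= /lt_ord ij'.
have tr : transitive lt_ord by move=> y z w; apply: ltn_trans.
have := order_path_min tr js => /allP jmin.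
have {}IH := IH (path_sorted js) iS.
rewrite /= path_min_sorted //; apply/allP => k; rewrite mem_insert inE.
case/orP => [/eqP ->|/jmin //].
by rewrite /lt_ord ltn_neqAle ji andbT eq_sym; rewrite -val_eqE in ij.
Qed.

Let enum_setU1 i A : i \notin A -> enum (i |: A) = insert_ord i (enum A).
Proof.
move=> iA; apply: (@irr_sorted_eq _ lt_ord).
- by move=> y z w; apply: ltn_trans.
- by move=> y; apply: ltnn.
- exact: enum_set_sorted.
- by apply: sorted_insert; rewrite ?mem_enum //; apply: enum_set_sorted.
by move=> k; rewrite mem_insert mem_enum inE !inE mem_enum.
Qed.

Let word_insert i s x : i \notin s -> sorted lt_ord s ->
  eps2 (phi b`_i) (word s x) =
    (\prod_(j <- s) swap_sign R j i) *: word (insert_ord i s) x.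
Proof.
have tr : transitive lt_ord by move=> y z w; apply: ltn_trans.
elim: s => [|j s IH]; first by rewrite big_nil scale1r.
rewrite inE negb_or => /andP[ij iS] /= js.
have /allP jmin := order_path_min tr js.
rewrite big_cons; case: (ltnP i j) => [ij'|ji].
  rewrite [swap_sign _ _ _]/swap_sign ltnNge (ltnW ij') /= mul1r.
  rewrite big1_seq ?scale1r // => k /andP[_ /jmin jk].
  by rewrite /swap_sign ltnNge ltnW // (ltn_trans ij').
have lji : (j < i)%N by rewrite ltn_neqAle ji andbT eq_sym; rewrite -val_eqE in ij.
rewrite -[word (j :: s) x]/(eps2 (phi b`_j) (word s x)) fepsCE IH ?(path_sorted js) //.
by rewrite bop_fZ [swap_sign R j i]/swap_sign lji mulN1r scaleNr.
Qed.

Lemma feps_sqr (v : L2) (u : T2) : eps2 v (eps2 v u) = 0.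
Proof.
have /eqP := fepsCE v v u; rewrite -subr_eq0 opprK => /eqP h.
have : (2 : K) *: eps2 v (eps2 v u) = 0 by rewrite scaler_nat mulr2n.
by move=> /eqP; rewrite scaler_eq0 pnatr_eq0 => /eqP.
Qed.

Let word_mem i s x : i \in s -> eps2 (phi b`_i) (word s x) = 0.
Proof.
elim: s => [//|j s IH]; rewrite inE => /orP[/eqP ->|iS]; first exact: feps_sqr.
by rewrite -[word (j :: s) x]/(eps2 (phi b`_j) (word s x)) fepsCE IH ?bop_f0 ?oppr0.
Qed.

Let JD u v : fockJ (u + v) = fockJ u + fockJ v.
Proof. by have [l _] := fockJ_blin; have := l 1 u v; rewrite !scale1r. Qed.
Let J0 : fockJ 0 = 0.
Proof. by apply: (addrI (fockJ 0)); rewrite -JD !addr0. Qed.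
Let JZ k u : fockJ (k *: u) = k *: fockJ u.
Proof. by have [l _] := fockJ_blin; have := l k u 0; rewrite !addr0 J0 addr0. Qed.
Let J_sum I (r : seq I) (F : I -> T1) : fockJ (\sum_(i <- r) F i) = \sum_(i <- r) fockJ (F i).
Proof. by elim: r => [|i r IH]; rewrite ?big_nil ?J0 // !big_cons JD IH. Qed.

Lemma fockJ_vac x : fockJ (vac L1 x) = vac L2 x.
Proof. by rewrite fockJ_delta /basis_seq enum_set0. Qed.

Let word_basis A x : mono x [seq phi v | v <- basis_seq A] = word (enum A) x.
Proof. by rewrite /basis_seq -map_comp. Qed.

Lemma fockJ_eps1 i u : fockJ (eps1 X i u) = eps2 (phi b`_i) (fockJ u).
Proof.
rewrite [in LHS](fock_decomp u) [in RHS](fock_decomp u) bop_f_sum !J_sum bop_f_sum.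
apply: eq_bigr => A _; set x := u A; rewrite fockJ_delta word_basis.
have [iA|iA] := boolP (i \in A).
  rewrite word_mem ?mem_enum //.
  rewrite (_ : eps1 X i (delta_fock A x) = 0) ?J0 //.
  apply/ffunP => B; rewrite !ffunE; case: ifP => // iB.
  case: eqP => [E|_]; last by rewrite scaler0.
  by have := finset.in_setD1 i B i; rewrite E iA eqxx.
have -> : eps1 X i (delta_fock A x) = fsgn R i A *: delta_fock (i |: A) x.
  have iU : i \in i |: A by rewrite finset.setU11.
  rewrite (delta_fock_eps1 x iU) finset.setU1K // fsgnU1 // swap_sign_id mul1r.
  by rewrite scalerA fsgn2 scale1r.
rewrite JZ fockJ_delta word_basis enum_setU1 // word_insert ?mem_enum ?enum_set_sorted //.
by rewrite /fsgn big_enum.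
Qed.

Lemma fockJ_feps v u : fockJ (feps X v u) = eps2 (phi v) (fockJ u).
Proof.
have lin := @feps_linear R L2 X.
have f0 : eps2 0 = 0 by apply: (addrI (eps2 0)); rewrite -(op_linearD _ _ lin) !addr0.
have -> : eps2 (phi v) = \sum_(i < n1) bop_sc T2 (coord b i v) * eps2 (phi b`_i).
  rewrite {1}(coord_vbasis (memvf v)) linear_sum.
  elim/big_rec2: _ => [//|i y1 y2 _ <-].
  by rewrite linearZ /= lin.
rewrite /feps !bop_sumE J_sum; apply: eq_bigr => i _.
by rewrite !bopME !bop_scE JZ fockJ_eps1.
Qed.

Lemma fockJ_fproj p u : fockJ (fproj X _ p u) = fproj X _ p (fockJ u).
Proof.
rewrite [in LHS](fock_decomp u) [in RHS](fock_decomp u) bop_f_sum !J_sum bop_f_sum.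
apply: eq_bigr => A _; set x := u A.
have -> : fproj X _ p (delta_fock A x) = if #|A|%:Z == p then delta_fock A x else 0.
  apply/ffunP => B; rewrite fprojE !ffunE; case: (eqVneq B A) => [->|BA].
    by case: ifP => _; rewrite !ffunE ?eqxx.
  by rewrite if_same; case: ifP => _; rewrite !ffunE ?(negPf BA).
rewrite (fun_if fockJ) J0 fockJ_delta; set l := map _ _.
have -> : #|A| = size l by rewrite !size_map -cardE.
elim: l p => [|v l IH] p.
  apply/ffunP => B /=; rewrite fprojE ffunE; case: (eqVneq B finset.set0) => [->|B0].
    by rewrite cards0; case: eqP => _; rewrite !ffunE ?eqxx.
  by rewrite if_same; case: eqP => _; rewrite !ffunE ?(negPf B0).
rewrite -[mono x (v :: l)]/(eps2 v (mono x l)) -[size (v :: l)]/((size l).+1).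
have -> : fproj X _ p (eps2 v (mono x l)) = eps2 v (fproj X _ (p - 1) (mono x l)).
  by rewrite -!bopME feps_fproj subrK.
rewrite -IH (fun_if (eps2 v)) bop_f0.
by rewrite -addn1 PoszD [_ + 1%:Z == p]eq_sym -subr_eq [p - 1 == _]eq_sym.
Qed.

Lemma fock_eq (V : normedModType K) (a c : T1 -> V) (e : L1 -> V -> V) :
  blin a -> blin c -> (forall v y z, e v (y - z) = e v y - e v z) ->
  (forall v u, a (feps X v u) = e v (a u)) ->
  (forall v u, c (feps X v u) = e v (c u)) ->
  (forall x, a (vac L1 x) = c (vac L1 x)) -> forall u, a u = c u.
Proof.
move=> ab cb eB ae ce av u; apply/eqP; rewrite -subr_eq0; apply/eqP.
apply: (@fock_ind _ X n1 V (fun u => a u - c u) (fun i => e b`_i)).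
- exact: blinD ab (blinN cb).
- by move=> i; have := eB b`_i 0 0; rewrite !subrr.
- by move=> i w; rewrite -!(feps_basis X) ae ce eB.
by move=> x; rewrite av subrr.
Qed.

End FockFunctor.

(* [L2] is an extension of a line by the ideal [phi L1]. *)
Record lie_ext (R : realType) (L1 L2 : lieAlgType R[i]) := LieExt {
  le_phi : {linear L1 -> L2};
  le_retr : {linear L2 -> L1};
  le_eta : {linear L2 -> R[i]^o};
  le_gen : L2;
  le_retrK : forall u, le_retr (le_phi u) = u;
  le_eta_phi : forall u, le_eta (le_phi u) = 0;
  le_eta_gen : le_eta le_gen = 1;
  le_decomp : forall v, le_phi (le_retr v) + le_eta v *: le_gen = v;
  le_lieb : forall u v, le_phi (lieb u v) = lieb (le_phi u) (le_phi v);
  le_ideal : forall m v, le_eta (lieb m (le_phi v)) = 0 }.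

Section FockZero.
Variables (R : realType) (L : lieAlgType R[i]) (X : completeNormedModType R[i]).

Lemma fock_zero_map (V : normedModType R[i]) (a : {ffun {set 'I_(\dim {:L})} -> X} -> V)
    (e : L -> V -> V) : blin a -> (forall v, e v 0 = 0) ->
  (forall v u, a (feps X v u) = e v (a u)) ->
  (forall x, a (vac L x) = 0) -> forall u, a u = 0.
Proof.
move=> ab e0 ae av; apply: (@fock_ind _ X _ V a (fun i => e (vbasis {:L})`_i)) => //.
by move=> i u; rewrite -feps_basis ae.
Qed.

End FockZero.

(** * Naturality under Lie homomorphisms *)

Section LieHom.
Variables (R : realType) (L1 L2 : lieAlgType R[i]) (X : completeNormedModType R[i]).
Variable phi : {linear L1 -> L2}.
Variables (rho1 : representation L1 X) (rho2 : representation L2 X).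
Hypothesis phiL : forall u v, phi (lieb u v) = lieb (phi u) (phi v).
Hypothesis rho12 : forall u x, rho1 u x = rho2 (phi u) x.
Local Notation T2 := {ffun {set 'I_(\dim {:L2})} -> X}.
Local Notation eps1 := (@feps R L1 X).
Local Notation eps2 := (@feps R L2 X).
Local Notation J := (@fockJ R L1 L2 X phi).

Let JB : blin J := @fockJ_blin R L1 L2 X phi.

Let J_add u v : J (u + v) = J u + J v.
Proof. by case: JB => l _; have := l 1 u v; rewrite !scale1r. Qed.
Let J_0 : J 0 = 0.
Proof. by apply: (addrI (J 0)); rewrite -J_add !addr0. Qed.
Let J_sub u v : J (u - v) = J u - J v.
Proof. by apply: (addIr (J v)); rewrite -J_add !subrK. Qed.

Lemma ftheta_hom v u : ftheta rho2 (phi v) (J u) = J (ftheta rho1 v u).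
Proof.
apply/eqP; rewrite -subr_eq0; apply/eqP.
apply: (@fock_zero_map R L1 X T2
  (fun u => ftheta rho2 (phi v) (J u) - J (ftheta rho1 v u)) (fun w z => eps2 (phi w) z)).
- apply: blinD; first exact: (blin_comp (bopP _) JB).
  exact: (blinN (blin_comp JB (bopP _))).
- by move=> w; rewrite bop_f0.
- move=> w z; rewrite fockJ_feps -!bopME !ftheta_feps !bopDE !bopME J_add !fockJ_feps.
  rewrite phiL opprD addrACA subrr addr0.
  by rewrite (bop_fD (eps2 (phi w))) (bop_fN (eps2 (phi w))).
by move=> x; rewrite fockJ_vac !ftheta_vac fockJ_vac rho12 subrr.
Qed.

Lemma kosz_hom u : kosz rho2 (J u) = J (kosz rho1 u).
Proof.
apply/eqP; rewrite -subr_eq0; apply/eqP.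
apply: (@fock_zero_map R L1 X T2
  (fun u => kosz rho2 (J u) - J (kosz rho1 u)) (fun w z => - eps2 (phi w) z)).
- apply: blinD; first exact: (blin_comp (bopP _) JB).
  exact: (blinN (blin_comp JB (bopP _))).
- by move=> w; rewrite bop_f0 oppr0.
- move=> w z; rewrite fockJ_feps.
  have k2 a : kosz rho2 (eps2 (phi w) a) = ftheta rho2 (phi w) a - eps2 (phi w) (kosz rho2 a).
    by rewrite -(kosz_feps rho2) bopDE !bopME addrK.
  have k1 a : kosz rho1 (eps1 w a) = ftheta rho1 w a - eps1 w (kosz rho1 a).
    by rewrite -(kosz_feps rho1) bopDE !bopME addrK.
  rewrite k1 k2 J_sub fockJ_feps ftheta_hom.
  rewrite (bop_fD (eps2 (phi w))) (bop_fN (eps2 (phi w))).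
  set a := J (ftheta _ _ _); set c := eps2 _ (kosz _ _); set d := eps2 _ (J _).
  by zm_abel.
by move=> x; rewrite fockJ_vac !kosz_vac J_0 subrr.
Qed.

End LieHom.

Lemma fockJK (R : realType) (L1 L2 : lieAlgType R[i]) (X : completeNormedModType R[i])
    (phi : {linear L1 -> L2}) (psi : {linear L2 -> L1}) :
  cancel phi psi -> cancel (@fockJ R L1 L2 X phi) (@fockJ R L2 L1 X psi).
Proof.
move=> phiK; apply: (@fock_eq R L1 X _ (fockJ psi \o fockJ phi) id (fun v w => feps X v w)) => //=.
- by apply: blin_comp; exact: fockJ_blin.
- exact: blin_id.
- by move=> v w z; rewrite bop_fD bop_fN.
- by move=> v w; rewrite !fockJ_feps phiK.
by move=> x; rewrite !fockJ_vac.
Qed.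

(** * The exterior algebra of an extension *)

Section Extension.
Variables (R : realType) (L1 L2 : lieAlgType R[i]) (X : completeNormedModType R[i]).
Variable E : lie_ext L1 L2.
Variables (rho1 : representation L1 X) (rho2 : representation L2 X).
Local Notation phi := (le_phi E).
Local Notation r := (le_retr E).
Local Notation eta := (le_eta E).
Local Notation y := (le_gen E).
Hypothesis rho12 : forall u x, rho1 u x = rho2 (phi u) x.
Local Notation n1 := (\dim {:L1}).
Local Notation n2 := (\dim {:L2}).
Local Notation T1 := {ffun {set 'I_n1} -> X}.
Local Notation T2 := {ffun {set 'I_n2} -> X}.
Local Notation eps2 := (@feps R L2 X).
Local Notation J := (@fockJ R L1 L2 X phi).
Local Notation Jr := (@fockJ R L2 L1 X r).

(** Interior product with the functional [eta]. *)
Definition ext_contract : bop T2 :=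
  \sum_(i < n2) bop_sc T2 (eta (vbasis {:L2})`_i) * iota1 X i.
Local Notation ct := ext_contract.

Lemma contract_feps v u : ct (eps2 v u) = eta v *: u - eps2 v (ct u).
Proof.
have cE w : ct w = \sum_(i < n2) eta (vbasis {:L2})`_i *: iota1 X i w.
  by rewrite bop_sumE.
have -> : eta v = \sum_(i < n2) coord (vbasis {:L2}) i v * eta (vbasis {:L2})`_i.
  rewrite {1}(coord_vbasis (memvf v)) linear_sum; apply: eq_bigr => i _.
  by rewrite linearZ.
rewrite !cE bop_f_sum scaler_suml -sumrB; apply: eq_bigr => i _.
rewrite bop_fZ -[iota1 X i (eps2 v u)]bopME iota1_feps bopBE !bopME.
by rewrite scalerBr bop_scE scalerA mulrC.
Qed.

Lemma contract_vac x : ct (vac L2 x) = 0.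
Proof.
by rewrite bop_sumE big1 // => i _; rewrite bopME iota1_vac bop_f0.
Qed.

Let JB : blin J := @fockJ_blin R L1 L2 X phi.
Let JrB : blin Jr := @fockJ_blin R L2 L1 X r.

Let J_add u v : J (u + v) = J u + J v.
Proof. by have [l _] := JB; have := l 1 u v; rewrite !scale1r. Qed.
Let J_0 : J 0 = 0.
Proof. by apply: (addrI (J 0)); rewrite -J_add !addr0. Qed.
Let J_Z k u : J (k *: u) = k *: J u.
Proof. by have [l _] := JB; have := l k u 0; rewrite !addr0 J_0 addr0. Qed.
Let J_sub u v : J (u - v) = J u - J v.
Proof. by rewrite J_add -scaleN1r J_Z scaleN1r. Qed.
Let Jr_add u v : Jr (u + v) = Jr u + Jr v.
Proof. by have [l _] := JrB; have := l 1 u v; rewrite !scale1r. Qed.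
Let Jr_0 : Jr 0 = 0.
Proof. by apply: (addrI (Jr 0)); rewrite -Jr_add !addr0. Qed.
Let Jr_Z k u : Jr (k *: u) = k *: Jr u.
Proof. by have [l _] := JrB; have := l k u 0; rewrite !addr0 Jr_0 addr0. Qed.
Let Jr_sub u v : Jr (u - v) = Jr u - Jr v.
Proof. by rewrite Jr_add -scaleN1r Jr_Z scaleN1r. Qed.

Lemma ext_retrK u : Jr (J u) = u.
Proof. exact: (@fockJK R L1 L2 X phi r (le_retrK E)). Qed.

Lemma contract_J u : ct (J u) = 0.
Proof.
apply: (@fock_zero_map R L1 X T2 (fun u => ct (J u)) (fun v w => - eps2 (phi v) w)).
- exact: (blin_comp (bopP ct) JB).
- by move=> v; rewrite bop_f0 oppr0.
- by move=> v w; rewrite fockJ_feps contract_feps le_eta_phi scale0r sub0r.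
by move=> x; rewrite fockJ_vac contract_vac.
Qed.

Let eps_phi_retr v w : eps2 (phi (r v)) w = eps2 v w - eta v *: eps2 y w.
Proof.
have lin := @feps_linear R L2 X.
have -> : eps2 v = eps2 (eta v *: y + phi (r v)) by rewrite addrC le_decomp.
by rewrite lin bopDE bopME bop_scE addrAC subrr add0r.
Qed.

(** The exterior algebra of [L2] is that of [L1] plus [y] times it; [Jr] kills the second summand
    and [ct] the first. *)
Lemma ext_decomp u : J (Jr u) + eps2 y (J (Jr (ct u))) = u.
Proof.
apply: (@fock_eq R L2 X T2 (fun u => J (Jr u) + eps2 y (J (Jr (ct u)))) id
  (fun v w => eps2 v w)) => //=.
- apply: blinD; first exact: (blin_comp JB JrB).
  exact: (blin_comp (bopP (eps2 y)) (blin_comp JB (blin_comp JrB (bopP ct)))).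
- exact: blin_id.
- by move=> v w z; rewrite bop_fD bop_fN.
- move=> v w; rewrite contract_feps Jr_sub Jr_Z J_sub J_Z !fockJ_feps !eps_phi_retr.
  rewrite !(bop_fD, bop_fN, bop_fZ) feps_sqr scaler0 subr0 [eps2 y (eps2 v _)]fepsCE opprK.
  set a := eps2 v (J (Jr w)); set c := eta v *: _; set d := eps2 v _.
  by zm_abel.
by move=> x; rewrite contract_vac Jr_0 J_0 bop_f0 addr0 !fockJ_vac.
Qed.

Lemma ftheta_phi v u : ftheta rho2 (phi v) (J u) = J (ftheta rho1 v u).
Proof. exact: (ftheta_hom (le_lieb E) rho12). Qed.

Lemma kosz_phi u : kosz rho2 (J u) = J (kosz rho1 u).
Proof. exact: (kosz_hom (le_lieb E) rho12). Qed.

(** The kernel of [ct] is the range of [J]: all of [L2] acts on the complex of the ideal [L1]. *)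
Lemma contract_ftheta m u : ct (ftheta rho2 m (J u)) = 0.
Proof.
apply: (@fock_zero_map R L1 X T2
  (fun u => ct (ftheta rho2 m (J u))) (fun w z => - eps2 (phi w) z)).
- exact: (blin_comp (bopP ct) (blin_comp (bopP (ftheta rho2 m)) JB)).
- by move=> w; rewrite bop_f0 oppr0.
- move=> w z; rewrite fockJ_feps -[ftheta _ _ _]bopME ftheta_feps bopDE bop_fD bopME.
  rewrite !contract_feps le_eta_phi le_ideal !scale0r contract_J bop_f0 subr0 addr0.
  by rewrite sub0r.
by move=> x; rewrite fockJ_vac ftheta_vac contract_vac.
Qed.

Fact ext_theta_blin m : blin (fun u => Jr (ftheta rho2 m (J u))).
Proof. exact: (blin_comp JrB (blin_comp (bopP (ftheta rho2 m)) JB)). Qed.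
(** With this action the theorem on brackets in [L2] applies inside the Calkin algebra of the
    complex of [L1]. *)
Definition ext_theta m : bop T1 := Bop (ext_theta_blin m).

Lemma ext_thetaE m u : J (ext_theta m u) = ftheta rho2 m (J u).
Proof.
by rewrite -[RHS]ext_decomp contract_ftheta Jr_0 J_0 bop_f0 addr0.
Qed.

Lemma J_inj u v : J u = J v -> u = v.
Proof. by move=> h; rewrite -[u]ext_retrK h ext_retrK. Qed.

Lemma ext_theta_phi v : ext_theta (phi v) = ftheta rho1 v.
Proof. by apply: bop_ext => u; apply: J_inj; rewrite ext_thetaE ftheta_phi. Qed.

Lemma ext_theta_rep : lie_rep (bop_bdata T1) ext_theta.
Proof.
split=> [k u v|u v]; apply: bop_ext => z; apply: J_inj.
  rewrite -[RHS]/(J (k *: ext_theta u z + ext_theta v z)) J_add J_Z !ext_thetaE.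
  by rewrite (ftheta_linear rho2 k u v).
rewrite ext_thetaE ftheta_lieb bopBE !bopME -!ext_thetaE -J_sub.
by congr (J _).
Qed.

Lemma ext_theta_kosz m : ext_theta m * kosz rho1 = kosz rho1 * ext_theta m.
Proof.
apply: bop_ext => u; apply: J_inj.
by rewrite !bopME ext_thetaE -!kosz_phi ext_thetaE -!bopME kosz_ftheta.
Qed.

Lemma ext_theta_fproj m p : ext_theta m * fproj X n1 p = fproj X n1 p * ext_theta m.
Proof.
apply: bop_ext => u; apply: J_inj.
by rewrite !bopME ext_thetaE !fockJ_fproj ext_thetaE -!bopME ftheta_fproj.
Qed.

End Extension.

Definition ring_map (B Q : pzRingType) (f : B -> Q) : Prop :=
  [/\ forall a b, f (a + b) = f a + f b, forall a b, f (a * b) = f a * f b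
    & forall a, f (- a) = - f a].

Lemma ring_map_homotopy (B Q : pzRingType) (f : B -> Q) P d h h' : ring_map f ->
  f P * (f d * f h + f h' * f d) * f P = f (P * (d * h + h' * d) * P).
Proof. by move=> [fD fM _]; rewrite !(fM, fD). Qed.

Section CalkinProjection.
Variables (R : realType) (T : completeNormedModType R[i]).
Implicit Types a b : bop T.

Definition cpi a : calkin T := rpi (compact_ideal T) a.

Lemma cpi_eq a b : cpi a = cpi b <-> compact_op (a - b).
Proof. exact: rpi_eq. Qed.
Lemma cpiK q : exists a, q = cpi a. Proof. exact: rpiK. Qed.
Lemma cpi_map : @ring_map (bop T) (calkin T) cpi.
Proof. by split; [exact: rpiD | exact: rpiM | exact: rpiN]. Qed.

End CalkinProjection.

(** * Fredholm splitting read in the Calkin algebra *)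

Section KoszulCalkin.
Variables (R : realType) (L : lieAlgType R[i]) (X : completeNormedModType R[i]).
Local Notation n := (\dim {:L}).
Local Notation T := {ffun {set 'I_n} -> X}.
Local Notation pi := (@cpi R T).
Local Notation P := (fproj X n).

Definition calkin_proj (p : int) : calkin T := pi (P p).
Definition calkin_kosz (rho : representation L X) : calkin T := pi (kosz rho).

Lemma calkin_graded rho : graded_complex calkin_proj (calkin_kosz rho).
Proof.
have [cD cM _] := @cpi_map R T; split=> [p q|p|].
- by rewrite /calkin_proj -cM fprojM; case: eqP.
- by rewrite /calkin_proj /calkin_kosz -!cM kosz_fproj.
by rewrite /calkin_kosz -cM kosz_kosz.
Qed.

Lemma calkin_proj_out p : p < 0 \/ n%:Z < p -> calkin_proj p = 0.
Proof. by move=> pn; rewrite /calkin_proj fproj_out. Qed.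

Variable rho : representation L X.
Local Notation D := (kosz rho).
Local Notation kin q := (@kinj R L X q).
Local Notation kpr q := (@kproj R L X q).

(** Homotopies are carried over by inclusion and projection; the projections around the homotopy
    equation confine its compact defect to degree [p]. *)
Lemma koszul_split_atP (p : int) :
  koszul_fredholm_split p rho <-> split_at calkin_proj (calkin_kosz rho) p.
Proof.
have [cD cM _] := @cpi_map R T.
have dup u : kinj (koszul_d p rho u) = D (kin (p + 1) u).
  by apply: kinj_koszul_d.
have ddown u : kinj (koszul_d (p - 1) rho u) = D (kin p u).
  by apply: kinj_koszul_d; rewrite subrK.
have Pkinj q (u : koszul_space L X q) : P q (kinj u) = kinj u.
  by rewrite -kprojK kinjK.
have DP q u : D (P q u) = P (q - 1) (D u) by rewrite -!bopME kosz_fproj.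
have kprojP q u : kpr q (P q u) = kpr q u.
  by rewrite -kprojK kinjK.
have kprojlin q u v : kpr q (u + v) = kpr q u + kpr q v.
  by have [l _] := @kproj_blin R L X q; have := l 1 u v; rewrite !scale1r.
split=> [[h [h' [k [hc h'c kc kk E]]]]|[qh [qh' E]]].
  have Hb : blin (kin (p + 1) \o h \o kpr p : T -> T).
    exact: (blin_comp (blin_comp (@kinj_blin R L X (p + 1)) (linear_blin hc)) (@kproj_blin R L X p)).
  have Hb' : blin (kin p \o h' \o kpr (p - 1) : T -> T).
    exact: (blin_comp (blin_comp (@kinj_blin R L X p) (linear_blin h'c)) (@kproj_blin R L X (p - 1))).
  exists (pi (Bop Hb)), (pi (Bop Hb')).
  rewrite /calkin_proj /calkin_kosz.
  rewrite (ring_map_homotopy (P p) D (Bop Hb) (Bop Hb') (@cpi_map R T)); apply/cpi_eq.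
  have EE u : (P p * (D * Bop Hb + Bop Hb' * D) * P p - P p) u =
     - kinj (k (kproj p u)).
    set v := kpr p u; have Pu : P p u = kin p v by rewrite kprojK.
    rewrite -[LHS]/(P p (D (kin (p + 1) (h (kpr p (P p u)))) +
      kin p (h' (kpr (p - 1) (D (P p u))))) - P p u).
    rewrite Pu kinjK -dup -ddown kinjK -kinjD E Pkinj.
    have -> : kinj (v - k v) = kinj v - kinj (k v).
      by rewrite kinjD -scaleN1r kinjZ scaleN1r.
    by rewrite addrAC subrr add0r.
  have kC : compact_op (kin p \o k \o kpr p : T -> T).
    apply: compact_op_compr; first exact: (@kproj_blin R L X).
      by move=> a x y /=; rewrite linearP kinjD kinjZ.
    by apply: compact_op_compl kk; exact: (@kinj_blin R L X).
  have Nc : compact_op ((fun w : T => - w) \o (kin p \o k \o kpr p) : T -> T).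
    by apply: compact_op_compl kC; apply: blinN; apply: blin_id.
  by move: Nc; congr compact_op; apply/funext => u; rewrite [RHS]EE.
have [H HE] := cpiK qh; have [H' HE'] := cpiK qh'.
rewrite HE HE' /calkin_proj /calkin_kosz (ring_map_homotopy (P p) D H H' (@cpi_map R T)) in E.
move/cpi_eq: E.
set C := _ - _ => Cc.
have [h [hE hc]] := blin_linear
  (blin_comp (@kproj_blin R L X (p + 1)) (blin_comp (bopP H) (@kinj_blin R L X (p)))).
have [h' [h'E h'c]] := blin_linear
  (blin_comp (@kproj_blin R L X (p)) (blin_comp (bopP H') (@kinj_blin R L X (p - 1)))).
have kb : blin (fun v : koszul_space L X p => - kproj p (C (kinj v))).
  exact: (blinN (blin_comp (@kproj_blin R L X (p)) (blin_comp (bopP C) (@kinj_blin R L X (p))))).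
have [k [kE kc]] := blin_linear kb.
exists h, h', k; split=> //.
  have Cc' : compact_op ((fun w : T => - kpr p w) \o C).
    by apply: compact_op_compl Cc; apply: blinN; exact: (@kproj_blin R L X).
  have : compact_op (((fun w : T => - kpr p w) \o C) \o kin p).
    apply: compact_op_compr Cc'; first exact: (@kinj_blin R L X).
    by case: (blin_comp (blinN (@kproj_blin R L X (p))) (bopP C)).
  by congr compact_op; apply/funext => v; rewrite kE.
move=> v; rewrite hE h'E kE opprK.
rewrite -[LHS]/(koszul_d p rho (kpr (p + 1) (H (kin p v))) +
  kpr p (H' (kin (p - 1) (koszul_d (p - 1) rho v)))) -[RHS]/(v + kpr p (C (kin p v))).
have -> : koszul_d p rho (kproj (p + 1) (H (kinj v))) = kproj p (D (H (kinj v))).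
  by rewrite -[LHS]kinjK dup kprojK DP addrK kprojP.
have CE : C (kin p v) = P p (D (H (kin p v)) + H' (D (kin p v))) - kin p v.
  rewrite -[LHS]/(P p (D (H (P p (kin p v))) + H' (D (P p (kin p v)))) - P p (kin p v)).
  by rewrite !Pkinj.
have vE z : v + kpr p (z - kin p v) = kpr p z.
  by rewrite -{1}(kinjK v) -kprojlin addrC subrK.
by rewrite ddown CE vE kprojP [RHS]kprojlin.
Qed.

End KoszulCalkin.

Section RingMapCone.
Variables (B Q : pzRingType) (f : B -> Q).
Hypothesis fm : ring_map f.

Let fE : (forall a b, f (a + b) = f a + f b) *
  (forall a b, f (a * b) = f a * f b) * (forall a, f (- a) = - f a).
Proof. by case: fm. Qed.

Lemma ring_map_cone11 P d t a b c :
  f P * (f d * f a + f t * f b + f c * f d) * f P = f (P * (d * a + t * b + c * d) * P).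
Proof. by rewrite !fE. Qed.

Lemma ring_map_cone12 P P' d t a b c e :
  f P * (f d * f a + f t * f b + f c * f t - f e * f d) * f P' =
  f (P * (d * a + t * b + c * t - e * d) * P').
Proof. by rewrite !fE. Qed.

Lemma ring_map_cone21 P P' d a b :
  f P' * (f a * f d - f d * f b) * f P = f (P' * (a * d - d * b) * P).
Proof. by rewrite !fE. Qed.

Lemma ring_map_cone22 P d t a b c :
  f P * (f a * f t - f d * f b - f c * f d) * f P =
  f (P * (a * t - d * b - c * d) * P).
Proof. by rewrite !fE. Qed.

End RingMapCone.

(** * Complexes that decompose as cones *)

Section ConeTranslation.
Variables (R : realType) (T1 T2 : completeNormedModType R[i]).
Variables (P1 : int -> bop T1) (D1 t : bop T1) (P2 : int -> bop T2) (D2 : bop T2).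
Variables (i1 i2 : T1 -> T2) (p1 p2 : T2 -> T1).
Hypotheses (i1b : blin i1) (i2b : blin i2) (p1b : blin p1) (p2b : blin p2).
Hypotheses (p1i1 : forall u, p1 (i1 u) = u) (p1i2 : forall u, p1 (i2 u) = 0).
Hypotheses (p2i1 : forall u, p2 (i1 u) = 0) (p2i2 : forall u, p2 (i2 u) = u).
Hypothesis dec : forall u, i1 (p1 u) + i2 (p2 u) = u.
Hypothesis D2i1 : forall u, D2 (i1 u) = i1 (D1 u).
Hypothesis D2i2 : forall u, D2 (i2 u) = i1 (t u) - i2 (D1 u).
Hypothesis P2i1 : forall q u, P2 q (i1 u) = i1 (P1 q u).
Hypothesis P2i2 : forall q u, P2 q (i2 u) = i2 (P1 (q - 1) u).

Let addE (U V : normedModType R[i]) (f : U -> V) : @blin R U V f -> forall u v, f (u + v) = f u + f v.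
Proof. by move=> [l _] u v; have := l 1 u v; rewrite !scale1r. Qed.
Let zeroE (U V : normedModType R[i]) (f : U -> V) : @blin R U V f -> f 0 = 0.
Proof. by move=> fb; apply: (addrI (f 0)); rewrite -(addE fb) !addr0. Qed.
Let oppE (U V : normedModType R[i]) (f : U -> V) : @blin R U V f -> forall u, f (- u) = - f u.
Proof.
by move=> fb u; apply: (addrI (f u)); rewrite -(addE fb) !subrr (zeroE fb).
Qed.

Let p1D2 u : p1 (D2 u) = D1 (p1 u) + t (p2 u).
Proof.
rewrite -{1}(dec u) (bop_fD D2) D2i1 D2i2 !(addE p1b) (oppE p1b) !p1i1 p1i2.
by rewrite subr0.
Qed.

Let p2D2 u : p2 (D2 u) = - D1 (p2 u).
Proof.
rewrite -{1}(dec u) (bop_fD D2) D2i1 D2i2 !(addE p2b) (oppE p2b) !p2i1 p2i2.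
by rewrite !add0r.
Qed.

Let p1P2 q u : p1 (P2 q u) = P1 q (p1 u).
Proof.
by rewrite -{1}(dec u) (bop_fD (P2 q)) P2i1 P2i2 (addE p1b) p1i1 p1i2 addr0.
Qed.

Let p2P2 q u : p2 (P2 q u) = P1 (q - 1) (p2 u).
Proof.
by rewrite -{1}(dec u) (bop_fD (P2 q)) P2i1 P2i2 (addE p2b) p2i1 p2i2 add0r.
Qed.

Definition block (pr : T2 -> T1) (pb : blin pr) (inj : T1 -> T2) (ib : blin inj)
  (M : bop T2) : bop T1 := Bop (blin_comp pb (blin_comp (bopP M) ib)).

Local Notation b11 := (block p1b i1b).
Local Notation b12 := (block p1b i2b).
Local Notation b21 := (block p2b i1b).
Local Notation b22 := (block p2b i2b).

Lemma block_compact (M : bop T2) : compact_op M <->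
  [/\ compact_op (b11 M), compact_op (b12 M), compact_op (b21 M) & compact_op (b22 M)].
Proof.
have H pr inj (pb : blin pr) (ib : blin inj) :
    compact_op M -> compact_op (@block pr pb inj ib M).
  move=> Mc; have c1 : compact_op (pr \o M) by apply: compact_op_compl.
  apply: (compact_op_compr ib _ c1).
  by case: (blin_comp pb (bopP M)).
split=> [Mc|[c11 c12 c21 c22]]; first by split; apply: H.
have C inj (ib : blin inj) pr (pb : blin pr) (N : bop T1) : compact_op N ->
    compact_op (inj \o (N \o pr) : T2 -> T2).
  move=> Nc; apply: compact_op_compl => //; apply: compact_op_compr => //.
  by case: (bopP N).
have := compact_opD (compact_opD (C _ i1b _ p1b _ c11) (C _ i1b _ p2b _ c12))
  (compact_opD (C _ i2b _ p1b _ c21) (C _ i2b _ p2b _ c22)).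
congr compact_op; apply/funext => u /=.
rewrite -[LHS]/(i1 (p1 (M (i1 (p1 u)))) + i1 (p1 (M (i2 (p2 u)))) +
  (i2 (p2 (M (i1 (p1 u)))) + i2 (p2 (M (i2 (p2 u)))))).
rewrite -!(addE i1b) -!(addE i2b) -!(addE p1b) -!(addE p2b) -!(bop_fD M) !dec.
by [].
Qed.

Section Blocks.
Variables (H H' : bop T2) (p : int).
Let M := P2 p * (D2 * H + H' * D2) * P2 p - P2 p.

Let ME u : M u = P2 p (D2 (H (P2 p u)) + H' (D2 (P2 p u))) - P2 p u.
Proof. by []. Qed.

Let p1M u : p1 (M u) = P1 p (D1 (p1 (H (P2 p u))) + t (p2 (H (P2 p u))) + p1 (H' (D2 (P2 p u))))
  - P1 p (p1 u).
Proof. by rewrite ME (addE p1b) (oppE p1b) !p1P2 (addE p1b) p1D2. Qed.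

Let p2M u : p2 (M u) = P1 (p - 1) (- D1 (p2 (H (P2 p u))) + p2 (H' (D2 (P2 p u))))
  - P1 (p - 1) (p2 u).
Proof. by rewrite ME (addE p2b) (oppE p2b) !p2P2 (addE p2b) p2D2. Qed.

Let Hi2 (G : bop T2) u : G (D2 (i2 u)) = G (i1 (t u)) - G (i2 (D1 u)).
Proof. by rewrite D2i2 (bop_fD G) (bop_fN G). Qed.

Lemma block11 : b11 M =
  P1 p * (D1 * b11 H + t * b21 H + b11 H' * D1) * P1 p - P1 p.
Proof.
apply: bop_ext => u; rewrite -[LHS]/(p1 (M (i1 u))) p1M P2i1 D2i1 p1i1.
by [].
Qed.

Lemma block12 : b12 M =
  P1 p * (D1 * b12 H + t * b22 H + b11 H' * t - b12 H' * D1) * P1 (p - 1).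
Proof.
apply: bop_ext => u; rewrite -[LHS]/(p1 (M (i2 u))) p1M P2i2 Hi2 p1i2.
rewrite (bop_f0 (P1 p)) subr0 (addE p1b) (oppE p1b).
rewrite -[RHS]/(P1 p (D1 (p1 (H (i2 (P1 (p - 1) u)))) + t (p2 (H (i2 (P1 (p - 1) u)))) +
  p1 (H' (i1 (t (P1 (p - 1) u)))) - p1 (H' (i2 (D1 (P1 (p - 1) u)))))).
exact: (congr1 (bopf (P1 p)) (addrA _ _ _)).
Qed.

Lemma block21 : b21 M = P1 (p - 1) * (b21 H' * D1 - D1 * b21 H) * P1 p.
Proof.
apply: bop_ext => u; rewrite -[LHS]/(p2 (M (i1 u))) p2M P2i1 D2i1 p2i1.
rewrite (bop_f0 (P1 (p - 1))) subr0.
exact: (congr1 (bopf (P1 (p - 1))) (addrC _ _)).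
Qed.

Lemma block22 : b22 M =
  P1 (p - 1) * (b21 H' * t - D1 * b22 H - b22 H' * D1) * P1 (p - 1) - P1 (p - 1).
Proof.
apply: bop_ext => u; rewrite -[LHS]/(p2 (M (i2 u))) p2M P2i2 Hi2 p2i2.
rewrite (addE p2b) (oppE p2b).
have E (a b c : T1) : - a + (b - c) = b - a - c by rewrite addrCA addrA.
exact: (congr1 (fun w => bopf (P1 (p - 1)) w - _) (E _ _ _)).
Qed.

End Blocks.

Local Notation cpi1 := (@cpi R T1).
Local Notation cpi2 := (@cpi R T2).

(** Operators on [T2] are matrices of operators on [T1], compact if and only if their four blocks
    are; the homotopy equation modulo compacts becomes four block equations. *)
Lemma split_at_coneP p :
  split_at (fun q => cpi2 (P2 q)) (cpi2 D2) p <->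
  cone_split (fun q => cpi1 (P1 q)) (cpi1 D1) (cpi1 t) p.
Proof.
have m1 := @cpi_map R T1; have m2 := @cpi_map R T2.
have key (H H' : bop T2) :
    cpi2 (P2 p) * (cpi2 D2 * cpi2 H + cpi2 H' * cpi2 D2) * cpi2 (P2 p) = cpi2 (P2 p) <->
  [/\ cpi1 (P1 p) * (cpi1 D1 * cpi1 (b11 H) + cpi1 t * cpi1 (b21 H) + cpi1 (b11 H') * cpi1 D1)
         * cpi1 (P1 p) = cpi1 (P1 p),
      cpi1 (P1 p) * (cpi1 D1 * cpi1 (b12 H) + cpi1 t * cpi1 (b22 H) + cpi1 (b11 H') * cpi1 t
         - cpi1 (b12 H') * cpi1 D1) * cpi1 (P1 (p - 1)) = 0,
      cpi1 (P1 (p - 1)) * (cpi1 (b21 H') * cpi1 D1 - cpi1 D1 * cpi1 (b21 H)) * cpi1 (P1 p) = 0 &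
      cpi1 (P1 (p - 1)) * (cpi1 (b21 H') * cpi1 t - cpi1 D1 * cpi1 (b22 H)
         - cpi1 (b22 H') * cpi1 D1) * cpi1 (P1 (p - 1)) = cpi1 (P1 (p - 1))].
  rewrite (ring_map_homotopy (P2 p) D2 H H' m2) cpi_eq block_compact.
  rewrite block11 block12 block21 block22.
  have ceq (a b : bop T1) : (cpi1 a = cpi1 b) = compact_op (a - b).
    by apply/propext; exact: cpi_eq.
  have z (a : bop T1) : (cpi1 a = 0) = compact_op a.
    by rewrite -{2}(subr0 a) -ceq.
  rewrite (ring_map_cone11 m1 (P1 p) D1 t (b11 H) (b21 H) (b11 H')) ceq.
  rewrite (ring_map_cone12 m1 (P1 p) (P1 (p - 1)) D1 t (b12 H) (b22 H) (b11 H') (b12 H')) z.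
  rewrite (ring_map_cone21 m1 (P1 p) (P1 (p - 1)) D1 (b21 H') (b21 H)) z.
  by rewrite (ring_map_cone22 m1 (P1 (p - 1)) D1 t (b21 H') (b22 H) (b22 H')) ceq.
split=> [[qH [qH' E]]|].
  have [H HE] := cpiK qH; have [H' HE'] := cpiK qH'; rewrite HE HE' in E.
  exists (cpi1 (b11 H)), (cpi1 (b12 H)), (cpi1 (b21 H)), (cpi1 (b22 H)).
  exists (cpi1 (b11 H')), (cpi1 (b12 H')), (cpi1 (b21 H')), (cpi1 (b22 H')).
  exact: (proj1 (key H H') E).
have lift4 (q11 q12 q21 q22 : calkin T1) : exists H,
    [/\ q11 = cpi1 (b11 H), q12 = cpi1 (b12 H), q21 = cpi1 (b21 H) & q22 = cpi1 (b22 H)].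
  have [h11 ->] := cpiK q11; have [h12 ->] := cpiK q12.
  have [h21 ->] := cpiK q21; have [h22 ->] := cpiK q22.
  have C inj (ib : blin inj) pr (pb : blin pr) (N : bop T1) :
      blin (inj \o (N \o pr) : T2 -> T2).
    by apply: blin_comp => //; apply: blin_comp => //; apply: bopP.
  pose H : bop T2 := Bop (blinD (blinD (C _ i1b _ p1b h11) (C _ i1b _ p2b h12))
    (blinD (C _ i2b _ p1b h21) (C _ i2b _ p2b h22))).
  have HEE u : H u = i1 (h11 (p1 u)) + i1 (h12 (p2 u)) + (i2 (h21 (p1 u)) + i2 (h22 (p2 u))).
    by [].
  exists H; split; congr cpi1; apply: bop_ext => u; symmetry.
  - rewrite -[LHS]/(p1 (H (i1 u))) HEE !(addE p1b) !p1i1 !p1i2 p2i1.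
    by rewrite (bop_f0 h12) !addr0.
  - rewrite -[LHS]/(p1 (H (i2 u))) HEE !(addE p1b) !p1i1 !p1i2 p2i2.
    by rewrite (bop_f0 h11) !addr0 add0r.
  - rewrite -[LHS]/(p2 (H (i1 u))) HEE !(addE p2b) !p2i1 !p2i2 p1i1.
    by rewrite (bop_f0 h22) !add0r addr0.
  - rewrite -[LHS]/(p2 (H (i2 u))) HEE !(addE p2b) !p2i1 !p2i2 p1i2.
    by rewrite (bop_f0 h21) !add0r.
move=> [q11 [q12 [q21 [q22 [r11 [r12 [r21 [r22 E]]]]]]]].
have [H [e1 e2 e3 e4]] := lift4 q11 q12 q21 q22.
have [H' [e1' e2' e3' e4']] := lift4 r11 r12 r21 r22.
exists (cpi2 H), (cpi2 H'); apply/key.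
by rewrite -e1 -e2 -e3 -e4 -e1' -e2' -e3' -e4'.
Qed.

End ConeTranslation.

(** * Regularity and twists by characters *)

Section Regular.
Variables (R : realType) (L : lieAlgType R[i]) (X : completeNormedModType R[i]).
Local Notation n := (\dim {:L}).
Local Notation T := {ffun {set 'I_n} -> X}.

Definition regular low k (rho : representation L X) : Prop :=
  forall p, in_range low k n p -> split_at (calkin_proj L X) (calkin_kosz rho) p.

Lemma rep_ext (rho sigma : representation L X) :
  (forall l x, rho l x = sigma l x) -> rho = sigma.
Proof.
case: rho => f a b c d; case: sigma => g a' b' c' d' /= fg.
have E : f = g by apply/funext => l; apply/funext => x.
rewrite -{}E in a' b' c' d' *; clear fg.
by congr Representation; apply: Prop_irrelevance.
Qed.

Definition rep_twist (rho : representation L X) (f : 'Hom(L, R[i]^o)) (fc : character f) :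
  representation L X.
Proof.
exists (fun l x => rho l x - f l *: x).
- move=> l a x y; rewrite (rep_op_linear rho l a x y) scalerBr scalerDr !scalerA.
  by rewrite (mulrC (f l)) opprD addrACA.
- move=> l; have /blin_continuous : blin (fun x => rho l x - f l *: x).
    exact: (blinD (rep_blin rho l) (blinN (blinZ (f l) (blin_id X)))).
  exact.
- move=> x a u v; rewrite (rep_linear rho x a u v) linearP /= scalerDl scalerBr.
  by rewrite -scalerA opprD addrACA.
move=> l m x; rewrite rep_lieb fc scale0r subr0.
have rB k y z : rho k (y - z) = rho k y - rho k z.
  have := rep_op_linear rho k (-1) z y; rewrite !scaleN1r => E.
  by rewrite addrC E addrC.
have rZ k a y : rho k (a *: y) = a *: rho k y.
  have r0 : rho k 0 = 0 by have := rB k 0 0; rewrite !subrr.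
  by have := rep_op_linear rho k a y 0; rewrite r0 !addr0.
rewrite !rB !rZ !scalerBr !scalerA (mulrC (f m) (f l)).
set a := rho l _; set b := rho m _; set c := _ *: _; set d := _ *: _; set e := _ *: _.
by zm_abel.
Defined.

Lemma rep_twistE rho f fc l x : @rep_twist rho f fc l x = rho l x - f l *: x.
Proof. by []. Qed.

Lemma ftheta_twist rho f (fc : character f) v :
  ftheta (rep_twist rho fc) v = ftheta rho v - bop_sc T (f v).
Proof.
rewrite /ftheta addrAC; congr (_ + _); apply: bop_ext => u; apply/ffunP => A.
rewrite bopBE [RHS]ffunE [X in _ = _ + X]ffunE /frep !fliftE.
by rewrite [X in _ = _ - X]ffunE.
Qed.

(** By Cartan's formula the action of [v] is homotopic to 0; if it is invertible modulo compacts,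
    the complex is contractible there. *)
Lemma regular_contractible low k (rho : representation L X) v (g : calkin T) :
  cpi (ftheta rho v) * g = 1 -> g * cpi (ftheta rho v) = 1 -> regular low k rho.
Proof.
have [cD cM _] := @cpi_map R T.
rewrite -(kosz_feps rho v) cD !cM => g1 g2 p _.
exact: (@contractible_split _ _ _ (cpi (feps X v)) g (calkin_graded rho) p g1 g2).
Qed.

End Regular.

(** * One extension of codimension 1 *)

Section Step.
Variables (R : realType) (L1 L2 : lieAlgType R[i]) (X : completeNormedModType R[i]).
Variable E : lie_ext L1 L2.
Local Notation phi := (le_phi E).
Local Notation r := (le_retr E).
Local Notation eta := (le_eta E).
Local Notation y := (le_gen E).
Local Notation n1 := (\dim {:L1}).
Local Notation n2 := (\dim {:L2}).
Local Notation T1 := {ffun {set 'I_n1} -> X}.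
Local Notation T2 := {ffun {set 'I_n2} -> X}.

Lemma le_retr_gen : r y = 0.
Proof.
have := le_decomp E y; rewrite le_eta_gen scale1r => h.
have h0 : phi (r y) = 0 by apply: (addIr y); rewrite h add0r.
by rewrite -(le_retrK E (r y)) h0 linear0.
Qed.

Lemma le_dim : n2 = n1.+1.
Proof.
pose f := linfun phi; have fE u : f u = phi u by rewrite lfunE.
have d1 : \dim (limg f) = n1.
  apply: limg_dim_eq; apply/eqP; rewrite -subv0; apply/subvP => u.
  rewrite memv_cap memv_ker memv0 fE => /andP[_ /eqP u0].
  by rewrite -(le_retrK E u) u0 linear0.
have y0 : y != 0.
  by apply/eqP => y0; have /eqP := le_eta_gen E; rewrite y0 linear0 eq_sym oner_eq0.
rewrite -d1 -addn1 -[X in (_ + X)%N](_ : \dim <[y]>%VS = 1%N); last by rewrite dim_vline y0.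
rewrite -dimv_disjoint_sum.
  congr (\dim _); apply/esym/eqP; rewrite eqEsubv subvf; apply/subvP => v _.
  rewrite -(le_decomp E v) memv_add ?memvZ ?memv_line //.
  by rewrite -fE memv_img ?memvf.
apply/eqP; rewrite -subv0; apply/subvP => v.
rewrite memv_cap memv0 => /andP[/memv_imgP[u _ ->] /vlineP[a]].
rewrite fE => ua; have := le_eta_phi E u; rewrite ua linearZ /= le_eta_gen => a0.
by rewrite [a](_ : a = 0) ?scale0r //; rewrite -[a]mulr1.
Qed.

Section Koszul.
Variables (rho1 : representation L1 X) (rho2 : representation L2 X).
Hypothesis rho12 : forall u x, rho1 u x = rho2 (phi u) x.
Local Notation J := (@fockJ R L1 L2 X phi).
Local Notation Jr := (@fockJ R L2 L1 X r).
Local Notation ct := (ext_contract X E).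
Local Notation t := (ext_theta E rho2 y).

(** Cartan's formula computes the differential on the summand with factor [y]: the action of [y]
    minus [y] times the differential, which is a cone. *)
Lemma koszul_coneP p : split_at (calkin_proj L2 X) (calkin_kosz rho2) p <->
  cone_split (calkin_proj L1 X) (calkin_kosz rho1) (cpi t) p.
Proof.
have JB : blin J := @fockJ_blin R L1 L2 X phi.
have JrB : blin Jr := @fockJ_blin R L2 L1 X r.
pose i2 := (feps X y : T2 -> T2) \o J.
pose p2 := Jr \o (ct : T2 -> T2).
have p2i2 u : p2 (i2 u) = u.
  rewrite /p2 /i2 /= contract_feps le_eta_gen scale1r contract_J bop_f0 subr0.
  exact: ext_retrK.
have Jr0 : Jr 0 = 0.
  by have [l _] := JrB; have := l 1 0 0; rewrite !scale1r addr0 => h;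
     apply: (addrI (Jr 0)); rewrite addr0 -h.
apply: (@split_at_coneP _ T1 T2 (fproj X n1) (kosz rho1) t (fproj X n2) (kosz rho2)
  J i2 Jr p2) => //.
- exact: blin_comp (bopP _) JB.
- exact: blin_comp JrB (bopP _).
- exact: ext_retrK.
- move=> u; rewrite /i2 /= fockJ_feps le_retr_gen.
  have -> : feps X (0 : L1) = 0.
    have F := @feps_linear R L1 X; apply: (addrI (feps X 0)).
    by rewrite -(op_linearD _ _ F) !addr0.
  by rewrite bop0E.
- by move=> u; rewrite /p2 /= contract_J Jr0.
- exact: ext_decomp.
- exact: kosz_phi.
- move=> u; rewrite -[X in _ = _ - X]/(feps X y (J (kosz rho1 u))) -(kosz_phi rho12 u).
  rewrite ext_thetaE -(kosz_feps rho2 y).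
  rewrite -[RHS]/(kosz rho2 (feps X y (J u)) + feps X y (kosz rho2 (J u)) -
    feps X y (kosz rho2 (J u))).
  by rewrite [RHS]addrK.
- by move=> q u; rewrite fockJ_fproj.
move=> q u; rewrite /i2 /= fockJ_fproj -!bopME feps_fproj subrK.
by [].
Qed.

Lemma ext_theta_calkin : (forall q, cpi t * calkin_proj L1 X q = calkin_proj L1 X q * cpi t) /\
  cpi t * calkin_kosz rho1 = calkin_kosz rho1 * cpi t.
Proof.
have [_ cM _] := @cpi_map R T1; rewrite /calkin_proj /calkin_kosz.
split=> [q|]; rewrite -!cM; first by rewrite ext_theta_fproj.
by rewrite (ext_theta_kosz rho12).
Qed.

Lemma regular_up low k : regular low k rho1 -> regular low k rho2.
Proof.
move=> reg p pr; apply/koszul_coneP; have {}pr : in_range low k n1.+1 p by rewrite -le_dim.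
have [h1 h2] := ext_theta_calkin.
exact: (cone_split_range (calkin_graded rho1) h1 h2 reg pr).
Qed.

End Koszul.

Section Descent.
Variables (rho1 : representation L1 X) (rho2 : representation L2 X).
Hypothesis rho12 : forall u x, rho1 u x = rho2 (phi u) x.
Local Notation J := (@fockJ R L1 L2 X phi).
Local Notation t := (ext_theta E rho2 y).

Lemma le_eta_character l : character (l *: linfun eta).
Proof.
move=> u v; rewrite scale_lfunE lfunE /= -(le_decomp E v) linearD /= linearD /=.
rewrite le_ideal add0r linearZ /= linearZ /= -(le_decomp E u) lieb_addl lieb_scalel liebb.
by rewrite scaler0 addr0 liebC linearN /= le_ideal oppr0 !scaler0.
Qed.

Let cpiB (a b : bop T1) : cpi (a - b) = cpi a - cpi b.
Proof. by have [cD _ cN] := @cpi_map R T1; rewrite cD cN. Qed.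

Lemma ext_theta_twist l :
  ext_theta E (rep_twist rho2 (le_eta_character l)) y = t - bop_sc T1 l.
Proof.
have [Jl _] := @fockJ_blin R L1 L2 X phi.
apply: bop_ext => u; apply: (@J_inj R L1 L2 X E).
rewrite ext_thetaE ftheta_twist bopBE -ext_thetaE bopBE.
rewrite scale_lfunE lfunE /= le_eta_gen.
have -> : l *: (1 : R[i]^o) = l by rewrite -[RHS]mulr1.
rewrite [RHS](_ : _ = J (- 1 *: (l *: u) + t u)); last by rewrite scaleN1r addrC.
have J0 : J 0 = 0.
  by have := Jl 1 0 0; rewrite !scale1r addr0 => h; apply: (addrI (J 0)); rewrite addr0 -h.
have JZ a v : J (a *: v) = a *: J v by have := Jl a v 0; rewrite J0 !addr0.
by rewrite Jl JZ scaleN1r addrC.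
Qed.

Lemma regular_down low k :
  (forall l, regular low k (rep_twist rho2 (le_eta_character l))) -> regular low k rho1.
Proof.
move=> reg; have [h1 h2] := ext_theta_calkin rho12.
apply: (@split_range_of_cone _ _ (calkin_bdata T1) low k n1 _ _ (cpi t)
  (calkin_graded rho1) _ _ h1 h2).
- by move=> p p0; apply: calkin_proj_out; left.
- by move=> p p0; apply: calkin_proj_out; right.
move=> l p pr.
have rho12' u x : rho1 u x = rep_twist rho2 (le_eta_character l) (phi u) x.
  by rewrite rep_twistE scale_lfunE lfunE /= le_eta_phi scaler0 scale0r subr0 rho12.
have /(reg l) : in_range low k n2 p by rewrite le_dim.
move=> /(koszul_coneP rho12'); rewrite ext_theta_twist cpiB.
exact.
Qed.

End Descent.

End Step.

(** * Invariance under isomorphism *)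

Section Isomorphism.
Variables (R : realType) (L1 L2 : lieAlgType R[i]) (X : completeNormedModType R[i]).
Variables (phi : {linear L1 -> L2}) (psi : {linear L2 -> L1}).
Hypotheses (phiK : cancel phi psi) (psiK : cancel psi phi).
Hypothesis phiL : forall u v, phi (lieb u v) = lieb (phi u) (phi v).
Variables (rho1 : representation L1 X) (rho2 : representation L2 X).
Hypothesis rho12 : forall u x, rho1 u x = rho2 (phi u) x.
Local Notation n1 := (\dim {:L1}).
Local Notation n2 := (\dim {:L2}).
Local Notation T1 := {ffun {set 'I_n1} -> X}.
Local Notation T2 := {ffun {set 'I_n2} -> X}.
Local Notation J := (@fockJ R L1 L2 X phi).
Local Notation Jr := (@fockJ R L2 L1 X psi).

Let JB : blin J := @fockJ_blin R L1 L2 X phi.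
Let JrB : blin Jr := @fockJ_blin R L2 L1 X psi.

Lemma iso_dim : n1 = n2.
Proof.
have d1 : \dim (limg (linfun phi)) = n1.
  apply: limg_dim_eq; apply/eqP; rewrite -subv0; apply/subvP => u.
  rewrite memv_cap memv_ker memv0 lfunE /= => /andP[_ /eqP u0].
  by rewrite -(phiK u) u0 linear0.
rewrite -d1; congr (\dim _); apply/eqP; rewrite eqEsubv subvf; apply/subvP => v _.
have -> : v = linfun phi (psi v) by rewrite lfunE /= psiK.
by rewrite memv_img ?memvf.
Qed.

(** Required at the top of a chain: the full subalgebra, as a type, is only isomorphic to [L], and
    its chosen basis may be another one. *)
Lemma regular_iso low k : regular low k rho1 -> regular low k rho2.
Proof.
move=> reg p pr; have {}pr : in_range low k n1 p by rewrite iso_dim.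
have [qh [qh' E]] := reg p pr; have [h hE] := cpiK qh; have [h' hE'] := cpiK qh'.
rewrite hE hE' /calkin_proj /calkin_kosz in E.
rewrite (ring_map_homotopy _ _ h h' (@cpi_map R T1)) in E; move/cpi_eq: E => C.
pose c (a : bop T1) : bop T2 := Bop (blin_comp JB (blin_comp (bopP a) JrB)).
exists (cpi (c h)), (cpi (c h')).
rewrite (ring_map_homotopy _ _ (c h) (c h') (@cpi_map R T2)); apply/cpi_eq.
set N := _ - _ in C.
have {C} : compact_op (J \o (N \o Jr)).
  by apply: compact_op_compl JB _; apply: (compact_op_compr JrB _ C); case: (bopP N).
congr compact_op; apply/funext => u; rewrite {}/N.
set D1 := kosz rho1; set D2 := kosz rho2; set P1 := fproj X n1 p; set P2 := fproj X n2 p.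
have DJ v : D2 (J v) = J (D1 v) by apply: kosz_hom.

have JrK (v : T2) : J (Jr v) = v := @fockJK R L2 L1 X psi phi psiK v.
have JK (v : T1) : Jr (J v) = v := @fockJK R L1 L2 X phi psi phiK v.
have PJ v : P2 (J v) = J (P1 v) by rewrite fockJ_fproj.
have [Jl _] := JB.
have JD v w : J (v + w) = J v + J w by have := Jl 1 v w; rewrite !scale1r.
have JN v : J (- v) = - J v.
  have J0 : J 0 = 0 by apply: (addrI (J 0)); rewrite -JD !addr0.
  by apply: (addrI (J v)); rewrite -JD !subrr J0.
rewrite -[LHS]/(J (P1 (D1 (h (P1 (Jr u))) + h' (D1 (P1 (Jr u)))) - P1 (Jr u))).
rewrite -[RHS]/(P2 (D2 (J (h (Jr (P2 u)))) + J (h' (Jr (D2 (P2 u))))) - P2 u).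
have PJr w : Jr (P2 w) = P1 (Jr w) by rewrite -{1}(JrK w) PJ JK.
have DJr w : Jr (D2 w) = D1 (Jr w) by rewrite -{1}(JrK w) DJ JK.
have PE : P2 u = J (P1 (Jr u)) by rewrite -PJ JrK.
rewrite (DJr (P2 u)) (PJr u) PE (DJ (h _)) -(JD (D1 _)) (PJ (_ + _)).
by rewrite (JD (P1 _)) (JN (P1 _)).
Qed.

End Isomorphism.

(** * Singular characters and their extension *)

Section Singular.
Variables (R : realType) (X : completeNormedModType R[i]).

(** The twist depends on a proof that [f] is a character, whence the existential; by proof
    irrelevance the choice is immaterial. *)
Definition singular low k (L : lieAlgType R[i]) (rho : representation L X) :
    set 'Hom(L, R[i]^o) :=
  [set f | exists fc : character f, ~ regular low k (rep_twist rho fc)].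

Definition pullback (L1 L2 : lieAlgType R[i]) (phi : {linear L1 -> L2})
  (g : 'Hom(L2, R[i]^o)) : 'Hom(L1, R[i]^o) := (g \o linfun phi)%VF.

Lemma pullbackE (L1 L2 : lieAlgType R[i]) (phi : {linear L1 -> L2}) g u : pullback phi g u = g (phi u).
Proof. by rewrite comp_lfunE lfunE. Qed.

Lemma pullback_character (L1 L2 : lieAlgType R[i]) (phi : {linear L1 -> L2}) g :
  (forall u v, phi (lieb u v) = lieb (phi u) (phi v)) ->
  character g -> character (pullback phi g).
Proof. by move=> phiL gc u v; rewrite pullbackE phiL gc. Qed.

Section Maps.
Variables (L1 L2 : lieAlgType R[i]).
Variables (rho1 : representation L1 X) (rho2 : representation L2 X).
Variables (low : bool) (k : nat).

Lemma singular_iso (phi : {linear L1 -> L2}) (psi : {linear L2 -> L1}) :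
  cancel phi psi -> cancel psi phi ->
  (forall u v, phi (lieb u v) = lieb (phi u) (phi v)) ->
  (forall u x, rho1 u x = rho2 (phi u) x) ->
  pullback phi @` singular low k rho2 = singular low k rho1.
Proof.
move=> phiK psiK phiL rho12.
have psiL u v : psi (lieb u v) = lieb (psi u) (psi v).
  by rewrite -{1}(psiK u) -{1}(psiK v) -phiL phiK.
apply/seteqP; split=> [_ [g [gc gs] <-]|f [fc fs]].
  exists (pullback_character phiL gc) => reg; apply: gs.
  apply: (regular_iso phiK psiK phiL _ reg) => u x.
  by rewrite !rep_twistE pullbackE rho12.
exists (pullback psi f); last by apply/lfunP => u; rewrite !pullbackE phiK.
exists (pullback_character psiL fc) => reg; apply: fs.
apply: (regular_iso psiK phiK psiL _ reg) => u x.
by rewrite !rep_twistE pullbackE rho12 psiK.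
Qed.

Variable E : lie_ext L1 L2.
Local Notation phi := (le_phi E).
Local Notation r := (le_retr E).
Local Notation eta := (le_eta E).
Local Notation y := (le_gen E).
Hypothesis rho12 : forall u x, rho1 u x = rho2 (phi u) x.
Hypothesis Lsol : lie_solvable L2.
Local Notation T1 := {ffun {set 'I_(\dim {:L1})} -> X}.

(** The bracket lies in the ideal, so its action shifted by its value under [f] is an action in the
    twisted complex; for a nonzero value it is invertible in the Calkin algebra, and [f] would be
    regular. *)
Lemma singular_bracket f v : singular low k rho1 f -> f (r (lieb y (phi v))) = 0.
Proof.
move=> [fc fs]; apply/eqP/negPn/negP => a0; apply: fs.
set z := lieb y (phi v) in a0 *; set a := f _ in a0.
have [cD cM cN] := @cpi_map R T1.
have thr : lie_rep (calkin_bdata T1) (fun m => cpi (ext_theta E rho2 m)).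
  have [h1 h2] := @ext_theta_rep R L1 L2 X E rho2; split=> [c u w|u w]; last first.
    by rewrite h2 cD cN !cM.
  by rewrite h1 cD cM.
have [g [g1 g2]] := quasinilpotent_bracket Lsol y (phi v) thr a0.
have zE : z = phi (r z) by rewrite -{1}(le_decomp E z) le_ideal scale0r addr0.
have Ez : cpi (ext_theta E rho2 z) - sc (calkin_bdata T1) a =
    cpi (ftheta (rep_twist rho1 fc) (r z)).
  by rewrite ftheta_twist cD cN {1}zE (ext_theta_phi rho12).
rewrite -/z Ez in g1 g2.
exact: regular_contractible g1 g2.
Qed.

(** [f] composed with [r] is a character by [singular_bracket], and all extensions of [f] differ
    from it by multiples of [eta]. If none were singular, every shifted cone would split and so
    would the complex of [L1]. *)
Lemma singular_step : pullback phi @` singular low k rho2 = singular low k rho1.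
Proof.
have phiL := le_lieb E.
apply/seteqP; split=> [_ [g [gc gs] <-]|f fS].
  exists (pullback_character phiL gc) => reg; apply: gs.
  apply: (regular_up _ reg) => u x.
  by rewrite !rep_twistE pullbackE rho12.
have fb := singular_bracket _ fS; have [fc fs] := fS.
pose g := (f \o linfun r + 0 *: linfun eta)%VF.
pose g0 : 'Hom(L2, R[i]^o) := (f \o linfun r)%VF.
have g0E v : g0 v = f (r v) by rewrite comp_lfunE lfunE.
have g0c : character g0.
  move=> u v; rewrite g0E -(le_decomp E v) linearD /= linearD linearD /= linearZ /=.
  rewrite -{1 2}(le_decomp E u) !lieb_addl !lieb_scalel liebb scaler0 addr0.
  rewrite -phiL !linearD /= le_retrK fc add0r !linearZ /= fb scaler0 add0r.
  by rewrite liebC linearN linearN /= fb oppr0 scaler0.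
apply: contrapT => H; apply: fs.
have rho12' u x : rep_twist rho1 fc u x = rep_twist rho2 g0c (phi u) x.
  by rewrite !rep_twistE g0E le_retrK rho12.
apply: (regular_down rho12') => l; apply: contrapT => nreg; apply: H.
have glc : character (g0 + l *: linfun eta).
  by move=> u v; rewrite add_lfunE g0c (le_eta_character E l) addr0.
exists (g0 + l *: linfun eta); last first.
  apply/lfunP => u; rewrite pullbackE add_lfunE g0E le_retrK scale_lfunE lfunE /= le_eta_phi.
  by rewrite scaler0 addr0.
exists glc => reg; apply: nreg.
rewrite (_ : rep_twist _ _ = rep_twist rho2 glc) //; apply: rep_ext => v x.
by rewrite !rep_twistE add_lfunE scalerDl opprD addrA.
Qed.

End Maps.
End Singular.

Lemma solvable_subalg (K : fieldType) (L : lieAlgType K) (I : lie_subalg L) :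
  lie_solvable L -> lie_solvable (subvs_of I).
Proof.
move=> [m mL]; exists m.
have H k (u : subvs_of I) : u \in iter k (fun U => lieprod U U) fullv ->
    vsval u \in iter k (fun U => lieprod U U) {:L}%VS.
  elim: k u => [|k IH] u; first by rewrite /= !memvf.
  set W := iter k.+1 _ {:L}%VS.
  have : (lieprod (iter k (fun U => lieprod U U) {:subvs_of I}%VS)
      (iter k (fun U => lieprod U U) fullv) <= linfun vsval @^-1: W)%VS.
    apply/lieprod_subP => a b /IH aW /IH bW.
    by rewrite -memv_preim lfunE /=; apply: memv_lieprod.
  by move=> /subvP /(_ u) h /= /h; rewrite -memv_preim lfunE.
apply/eqP; rewrite -subv0; apply/subvP => u /H.
by rewrite mL !memv0 => /eqP u0; apply/eqP/val_inj.
Qed.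

(** * Subalgebras as extensions *)

Section Inclusion.
Variables (R : realType) (L : lieAlgType R[i]) (I J : lie_subalg L) (y : L).
Hypotheses (yI : y \notin lsval I) (JE : lsval J = (I + <[y]>)%VS).
Hypothesis yIdeal : forall u, u \in lsval I -> lieb y u \in lsval I.

Let IJ : (I <= J)%VS.
Proof. by rewrite JE addvSl. Qed.
Let yJ : y \in lsval J.
Proof. by rewrite JE memvE addvSr. Qed.

Lemma inclusion_ext : exists E : lie_ext (subvs_of I) (subvs_of J),
  forall u, vsval (le_phi E u) = vsval u.
Proof.
have [g [gy gI]] := exists_functional yI.
pose ph : {linear subvs_of I -> subvs_of J} := vsproj J \o vsval.
have phE u : vsval (ph u) = vsval u.
  by rewrite /ph /= vsprojK // (subvP IJ) ?subvsP.
have gJ v : v \in lsval J -> v - g v *: y \in lsval I.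
  rewrite JE => /memv_addP[u uI [w /vlineP[a ->] ->]].
  have -> : g (u + a *: y) = a by rewrite linearD linearZ /= gI // gy add0r -[LHS]/(a * 1) mulr1.
  by rewrite addrK.
(* Retraction along [y], for a functional [g] with value 1 at [y] that vanishes on [I]. *)
pose rf (v : subvs_of J) : subvs_of I := vsproj I (vsval v - g (vsval v) *: y).
have rfE v : vsval (rf v) = vsval v - g (vsval v) *: y.
  by rewrite /rf vsprojK // gJ // subvsP.
have rfL : linear rf.
  move=> a u v; apply: val_inj; rewrite -[LHS]/(vsval (rf (a *: u + v))) rfE.
  rewrite -[RHS]/(a *: vsval (rf u) + vsval (rf v)) !rfE.
  rewrite -[vsval (a *: u + v)]/(a *: vsval u + vsval v) [g (_ + _)]linearP /=.
  rewrite -[a *: g _]/(a * g (vsval u)) scalerDl -(scalerA a _ y) scalerBr opprD.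
  by rewrite addrACA.
pose r : {linear subvs_of J -> subvs_of I} := HB.pack rf (GRing.isLinear.Build _ _ _ _ rf rfL).
pose eta : {linear subvs_of J -> R[i]^o} := g \o vsval.
have etaE v : eta v = g (vsval v) by [].
pose gen : subvs_of J := Subvs yJ.
unshelve eexists (@LieExt R _ _ ph r eta gen _ _ _ _ _ _).
- move=> u; apply: val_inj; rewrite -[LHS]/(vsval (rf (ph u))) rfE phE gI ?subvsP //.
  by rewrite scale0r subr0.
- by move=> u; rewrite etaE phE gI ?subvsP.
- exact: gy.
- move=> v; apply: val_inj.
  rewrite -[LHS]/(vsval (ph (rf v)) + eta v *: y) phE rfE etaE.
  by rewrite subrK.
- by move=> u v; apply: val_inj; rewrite -[LHS]/(vsval (ph (lieb u v))) -[RHS]/(lieb (vsval (ph u)) (vsval (ph v))) !phE.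
- move=> m v; rewrite etaE -[vsval _]/(lieb (vsval m) (vsval (ph v))) phE gI //.
  have : vsval m \in (I + <[y]>)%VS by rewrite -JE; exact: subvsP.
  move=> /memv_addP[u uI [w /vlineP[a ->] ->]].
  rewrite lieb_addl lieb_scalel memvD ?memvZ ?yIdeal ?subvsP //.
  by apply: (lie_subalgP uI); apply: subvsP.
exact: phE.
Qed.

End Inclusion.

(** * Restriction along a chain *)

Section Restriction.
Variables (R : realType) (X : completeNormedModType R[i]) (L : lieAlgType R[i]).
Variable rho : representation L X.
Hypothesis Lsol : lie_solvable L.

(** [subnormal] speaks of subspaces, so the closure proof of [I] is generalised before the induction
    up the chain. *)
Lemma singular_restrict low k (I : lie_subalg L) : subnormal (lsval I) ->
  @dual_restrict _ L I @` singular low k rho = singular low k (rep_restrict rho I).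
Proof.
case: I => U Ua /= sU; elim: sU Ua => [|{}U y yU Us yUs _ IH] Ua.
  set I := LieSubalg Ua.
  apply: (@singular_iso R X (subvs_of I) L (rep_restrict rho I) rho low k vsval (vsproj fullv)).
  - exact: vsvalK.
  - by move=> v; apply: vsprojK; apply: memvf.
  - by [].
  - by [].
set I := LieSubalg Ua.
have Va : {in (U + <[y]>)%VS &, forall u v, lieb u v \in (U + <[y]>)%VS}.
  move=> u v /memv_addP[a aU [w /vlineP[c ->] ->]] /memv_addP[b bU [w' /vlineP[c' ->] ->]].
  apply: (subvP (addvSl _ _)).
  rewrite lieb_addl lieb_scalel (linearD (lieb a)) (linearD (lieb y)) !linearZ /= liebb.
  rewrite scaler0 addr0.
  apply: memvD; last by apply: memvZ; exact: yUs.
  apply: memvD; first exact: (Ua _ _ aU bU).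
  by apply: memvZ; rewrite liebC memvN; exact: yUs.
set J := LieSubalg Va.
have [E phE] := @inclusion_ext R L I J y yU erefl yUs.
have rho12 u x : rep_restrict rho I u x = rep_restrict rho J (le_phi E u) x.
  by rewrite /= phE.
rewrite -(singular_step low k rho12 (solvable_subalg J Lsol)) -(IH Va).
rewrite image_comp; congr image; apply/funext => f; apply/lfunP => u.
rewrite -[RHS]/(pullback (le_phi E) (dual_restrict J f) u) pullbackE.
by rewrite /dual_restrict !comp_lfunE !lfunE /= phE.
Qed.

End Restriction.

(** * Compact sets in the dual space *)

Section DualCompactness.
Variables (R : realType) (L : lieAlgType R[i]).
Local Notation n := (\dim {:L}).
Local Notation b := (vbasis {:L}).
Local Notation dual := 'Hom(L, R[i]^o).

Lemma dual_basis_le (h : dual) (i : 'I_n) : cnorm (h b`_i) <= nrm h.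
Proof.
rewrite -(@lecR R) cnormE nrmE -[`|h|]/(dual_norm h) /dual_norm.
have bi : b`_i \in (b : seq L) by rewrite mem_nth ?size_tuple.
by rewrite (big_rem _ bi) /= lerDl sumr_ge0.
Qed.

Lemma dual_eval_le (u : L) : exists2 c, 0 <= c & forall h : dual, cnorm (h u) <= c * nrm h.
Proof.
exists (\sum_i cnorm (coord b i u)) => [|h]; first by apply: sumr_ge0 => i _; exact: cnorm_ge0.
rewrite [u in h u](coord_vbasis (memvf u)) linear_sum mulr_suml.
apply: (big_ind2 (fun (x : R[i]) y => cnorm x <= y)).
- by rewrite cnorm0.
- by move=> x x' y y' xx yy; apply: le_trans (cnormD _ _) (lerD xx yy).
move=> i _; rewrite linearZ /= cnormM.
by apply: ler_wpM2l; [exact: cnorm_ge0 | exact: dual_basis_le].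
Qed.

Lemma dual_closed (S : set dual) :
  (forall f, (forall e, 0 < e -> exists2 g, S g & nrm (f - g) < e) -> S f) -> closed S.
Proof.
move=> H f cf; apply: H => e e0.
have [|g [Sg fg]] := cf (ball f e%:C%C); first by apply: nbhsx_ballx; rewrite ltcR.
by exists g => //; apply/ball_nrm.
Qed.

(** A closed subset of the continuous image of a box of real and imaginary parts of coordinates. *)
Lemma dual_compact (S : set dual) (r : R) : closed S ->
  (forall f (i : 'I_n), S f -> cnorm (f b`_i) <= r) -> compact S.
Proof.
move=> Sc Sr.
pose e (i : 'I_n) : dual := linfun (coord b i : L -> R[i]^o).
pose z (x : 'rV[R]_n * 'rV[R]_n) i : R[i] := (x.1 0 i +i* x.2 0 i)%C.
pose Phi x : dual := \sum_i z x i *: e i.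
pose K := [set v : 'rV[R]_n | forall i, [set` `[- r, r]] (v ord0 i)].
have Kc : compact K by apply: (@rV_compact R n (fun=> _)) => _; apply: segment_compact.
apply: (subclosed_compact Sc (continuous_compact (f := Phi) _ (compact_setX Kc Kc))) => [|f Sf]; last first.
  exists (\row_i complex.Re (f b`_i), \row_i complex.Im (f b`_i)).
    split=> i; rewrite /= mxE; have := Sr f i Sf; case: (f b`_i) => x y xy;
      rewrite in_itv /= -ler_norml;
      apply: le_trans xy; rewrite /cnorm normc_def /= -sqrtr_sqr ler_wsqrtr //.
      by rewrite lerDl sqr_ge0.
    by rewrite lerDr sqr_ge0.
  apply/lfunP => u; rewrite /Phi sum_lfunE [u in RHS](coord_vbasis (memvf u)) linear_sum.
  apply: eq_bigr => i _; rewrite scale_lfunE lfunE linearZ /z /= !mxE.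
  by rewrite [RHS]mulrC; congr (_ * _); case: (f _).
apply: continuous_subspaceT => v.
have zc i : {for v, continuous (fun x => z x i : R[i]^o)}.
  apply/cvgrPdist_lt => d' /complex_pos[dE d0].
  set d := complex.Re d' in d0; rewrite dE -/d.
  exists (ball v.1 (d / 2), ball v.2 (d / 2)).
    by split; apply: nbhsx_ballx; rewrite divr_gt0.
  move=> y [/= [_ y1] [_ y2]]; rewrite -cnormE ltcR.
  apply: (le_lt_trans (cnorm_ReIm _)).
  rewrite (splitr d); apply: ltrD; [exact: y1 | exact: y2].
rewrite /Phi; elim: (index_enum _) => [|i s IH].
  rewrite (_ : (fun _ => _) = cst 0); first exact: cvg_cst.
  by apply/funext => w; rewrite big_nil.
rewrite (_ : (fun _ => _) = fun w => z w i *: e i + \sum_(j <- s) z w j *: e j).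
  by apply: cvgD IH; apply: cvgZr_tmp; exact: zc.
by apply/funext => w; rewrite big_cons.
Qed.

End DualCompactness.

(** * Topology and identification of the spectra *)

Section SpectralSets.
Variables (R : realType) (X : completeNormedModType R[i]) (L : lieAlgType R[i]).
Variable rho : representation L X.
Local Notation n := (\dim {:L}).
Local Notation b := (vbasis {:L}).
Local Notation T := {ffun {set 'I_n} -> X}.

Lemma kosz_twist (f : 'Hom(L, R[i]^o)) (fc : character f) :
  kosz (rep_twist rho fc) = kosz rho - \sum_(i < n) bop_sc T (f b`_i) * iota1 X i.
Proof.
rewrite /kosz -addrA [_ * _ - _]addrC addrA; congr (_ + _).
rewrite -sumrB; apply: eq_bigr => i _; rewrite -mulrBl; congr (_ * _).
apply: bop_ext => u; apply/ffunP => A.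
rewrite bopBE [RHS]ffunE [X in _ = _ + X]ffunE /frep !fliftE.
by rewrite [X in _ = _ - X]ffunE.
Qed.

(** Twisting changes the differential only by the contraction with [f], which is linear in [f]. *)
Lemma calkin_kosz_lipschitz : exists2 C, 0 <= C &
  forall f g (fc : character f) (gc : character g),
    bd (calkin_bdata T) (calkin_kosz (rep_twist rho gc) - calkin_kosz (rep_twist rho fc))
      (C * nrm (f - g)).
Proof.
have [cD cM cN] := @cpi_map R T.
have /choice[c ic] i := bd_ex (bop_bdata T) (iota1 X i).
exists (\sum_i c i); first by apply: sumr_ge0 => i _; exact: (bd_ge0 (ic i)).
move=> f g fc gc; exists (kosz (rep_twist rho gc) - kosz (rep_twist rho fc)); split.
  symmetry; rewrite -[LHS]/(cpi (kosz (rep_twist rho gc) - kosz (rep_twist rho fc))) cD cN.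
  by [].
rewrite !kosz_twist opprB [X in bd _ X _]addrC addrA subrK -sumrB mulr_suml.
apply: (big_ind2 (fun q y => bd (bop_bdata T) q y)).
- exact: bd0.
- by move=> q q' y y' h h'; apply: bdD.
move=> i _; rewrite -mulrBl mulrC.
have -> : bop_sc T (f b`_i) - bop_sc T (g b`_i) = sc (bop_bdata T) ((f - g) b`_i).
  by rewrite add_lfunE opp_lfunE; exact: esym (scB (bop_bdata T) _ _).
apply: bdM (ic i); apply: bd_le (bd_sc _ _) _; exact: dual_basis_le.
Qed.

Lemma singular_closed low k : closed (singular low k rho).
Proof.
apply: dual_closed => f fS.
have fc : character f.
  move=> u v; have [c c0 H] := dual_eval_le (lieb u v).
  apply: nrm_small0 => e e0; have c1 : 0 < c + 1 by rewrite ltr_wpDl.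
  have [|g [gc _] fg] := fS (e / (c + 1)); first by rewrite divr_gt0.
  have -> : f (lieb u v) = (f - g) (lieb u v) by rewrite add_lfunE opp_lfunE gc subr0.
  apply: le_trans (H _) _; apply: (@le_trans _ _ ((c + 1) * nrm (f - g))).
    by apply: ler_wpM2r; [exact: nrm_ge0 | rewrite lerDl].
  by rewrite mulrC -ler_pdivlMr // ltW.
exists fc => reg; have [C C0 lip] := calkin_kosz_lipschitz.
have [||e e0 H] := split_range_open (calkin_bdata T) (calkin_graded (rep_twist rho fc)) _ _ reg.
- by move=> p p0; apply: calkin_proj_out; left.
- by move=> p pn; apply: calkin_proj_out; right.
have C1 : 0 < C + 1 by rewrite ltr_wpDl.
have [|g [gc gS] fg] := fS (e / (C + 1)); first by rewrite divr_gt0.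
apply: gS; apply: H; first exact: calkin_graded.
apply: bd_le (lip f g fc gc) _; apply: (@le_trans _ _ ((C + 1) * nrm (f - g))).
  by apply: ler_wpM2r; [exact: nrm_ge0 | rewrite lerDl].
by rewrite mulrC -ler_pdivlMr // ltW.
Qed.

(** A value of [f] at a basis vector beyond the norm of its action makes the shifted action
    invertible, so [f] is regular. *)
Lemma singular_compact low k : compact (singular low k rho).
Proof.
have [cD cM cN] := @cpi_map R T.
have /choice[c ic] (i : 'I_n) := bd_ex (calkin_bdata T) (cpi (ftheta rho b`_i)).
apply: (@dual_compact _ _ _ (\sum_i c i)); first exact: singular_closed.
move=> f i [fc fS]; apply: (@le_trans _ _ (c i)); last first.
  rewrite (bigD1 i) //= lerDl; apply: sumr_ge0 => j _; exact: (bd_ge0 (ic j)).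
rewrite leNgt; apply/negP => /(bd_resolvent (ic i))[g [g1 g2 _]]; apply: fS.
have E : cpi (ftheta rho b`_i) - sc (calkin_bdata T) (f b`_i) = cpi (ftheta (rep_twist rho fc) b`_i).
  by rewrite ftheta_twist [RHS]cD cN.
rewrite E in g1 g2.
exact: regular_contractible g1 g2.
Qed.

Lemma not_regularP low k (f : 'Hom(L, R[i]^o)) (fc : character f) :
  ~ regular low k (rep_twist rho fc) <->
  exists p : int, [/\ in_range low k n p, 0 <= p <= n%:Z & sp_pe p rho f].
Proof.
split=> [|[p [pr _ [_ np]]] reg]; last exact/np/(koszul_split_atP (rep_twist rho fc))/reg.
apply: contra_notP => H p pr.
have out : p < 0 \/ n%:Z < p -> split_at (calkin_proj L X) (calkin_kosz (rep_twist rho fc)) p.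
  by move=> /(calkin_proj_out (L := L) X) P0; exact: split_out.
have [p0|p0] := ltP p 0; first by apply: out; left.
have [pn|pn] := ltP n%:Z p; first by apply: out; right.
apply/koszul_split_atP; apply: contrapT => np; apply: H; exists p; split=> //.
by rewrite p0 pn.
Qed.

Lemma singularP low k f : singular low k rho f <->
  exists p : int, [/\ in_range low k n p, 0 <= p <= n%:Z & sp_pe p rho f].
Proof.
split=> [[fc] /not_regularP //|H].
have [p [_ _ [fc _]]] := H; exists fc; exact/not_regularP.
Qed.

Lemma sp_pe_bound p f : sp_pe p rho f -> 0 <= p <= n%:Z.
Proof.
move=> [fc np]; apply/negPn/negP => pn; apply: np.
apply/(koszul_split_atP (rep_twist rho fc))/split_out/calkin_proj_out.
by move: pn; rewrite negb_and -!ltNge => /orP[|]; [left|right].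
Qed.

Lemma sp_deltaE k : sp_delta_e k L rho = singular true k rho.
Proof.
apply/seteqP; split=> f; rewrite singularP /sp_delta_e /=.
  move=> [p /andP[p0 pk] fp]; exists p; split=> //; exact: sp_pe_bound fp.
by move=> [p [pk /andP[p0 _] fp]]; exists p => //=; rewrite p0.
Qed.

Lemma sp_piE k : sp_pi_e k L rho = singular false k rho.
Proof.
apply/seteqP; split=> f; rewrite singularP /sp_pi_e /=.
  move=> [p /andP[p0 pk] fp]; exists p; split=> //; exact: sp_pe_bound fp.
by move=> [p [pk /andP[_ pn] fp]]; exists p => //=; rewrite pn andbT.
Qed.

(** [k] is left free so that the dimension of [L] serves for all its subalgebras at once. *)
Lemma sp_eE k : (n <= k)%N -> sp_e L rho = singular true k rho.
Proof.
move=> nk; apply/seteqP; split=> f; rewrite singularP /sp_e /=.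
  by move=> [p /andP[p0 pn] fp]; exists p; split=> //; [exact: le_trans pn _ | exact: sp_pe_bound fp].
by move=> [p [_ pn fp]]; exists p.
Qed.

(** In dimension 0 the total space is [X] in degree 0 with zero differential, and splitting says
    that the identity is compact. *)
Lemma regular_dim0 low k : n = 0%N -> regular low k rho -> finite_dimensional X.
Proof.
move=> n0 /(_ 0); rewrite /in_range => H.
have {H} [h [h' E]] : split_at (calkin_proj L X) (calkin_kosz rho) 0.
  by apply: H; case: low; lia.
have P1 : fproj X n 0 = 1.
  apply: bop_ext => u; apply/ffunP => A; rewrite fprojE.
  suff -> : #|A| = 0%N by [].
  by apply/eqP; rewrite -leqn0 -[X in (_ <= X)%N]n0 -[X in (_ <= X)%N]card_ord max_card.
have D0 : kosz rho = 0.
  rewrite -[LHS]mulr1 -P1 kosz_fproj fproj_out ?mul0r //; by left.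
have [cD cM cN] := @cpi_map R T.
have c0 : cpi (0 : bop T) = 0.
  by have := cD (0 : bop T) 0; rewrite addr0 => /(congr1 (fun q => q - cpi 0)); rewrite subrr addrK.
move: E; rewrite /calkin_proj /calkin_kosz P1 D0 c0 !(mul0r, mulr0) addr0 mulr0 mul0r -c0.
move=> /esym/cpi_eq; rewrite subr0 => /compact_id_finite_dimensional[m [e He]].
exists m, (fun i => e i finset.set0) => x.
have [a ax] := He [ffun _ => x]; exists a.
have := congr1 (fun u : T => u finset.set0) ax; rewrite ffunE => ->.
by rewrite sum_ffunE; apply: eq_bigr => i _; rewrite ffunE.
Qed.

End SpectralSets.

Lemma singular_nonempty (R : realType) (X : completeNormedModType R[i]) (L : lieAlgType R[i])
    (rho : representation L X) low k : lie_solvable L ->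
  ~ finite_dimensional X -> singular low k rho !=set0.
Proof.
move=> Lsol Xinf.
have Z0 : is_lie_ideal (0%VS : {vspace L}).
  by move=> x y; rewrite !memv0 => /eqP ->; rewrite linear0.
have Z0a : {in (0%VS : {vspace L}) &, forall x y, lieb x y \in (0%VS : {vspace L})}.
  by move=> x y _; exact: Z0.
pose I := LieSubalg Z0a.
have sub : subnormal (lsval I) by exact: subnormal_ideal Lsol Z0.
have c0 : character (0 : 'Hom(subvs_of I, R[i]^o)) by move=> u v; rewrite zero_lfunE.
(* On the zero algebra 0 is the only functional; it is singular, and a singular extension of it to
   [L] exists. *)
have : singular low k (rep_restrict rho I) 0.
  exists c0 => /regular_dim0 H; apply: Xinf; apply: H.
  by rewrite dimvf /dim /= dimv0.
by rewrite -(singular_restrict rho Lsol low k sub) => -[f fS _]; exists f.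
Qed.

Lemma singular_projection (R : realType) (X : completeNormedModType R[i]) (L : lieAlgType R[i])
    (rho : representation L X) low k (I : lie_subalg L) : lie_solvable L ->
  is_lie_ideal I \/ lie_nilpotent L ->
  @dual_restrict _ L I @` singular low k rho = singular low k (rep_restrict rho I).
Proof.
move=> Lsol IP; apply: singular_restrict => //; case: IP => H.
  exact: subnormal_ideal.
by apply: subnormal_nilpotent => //; exact: (@lie_subalgP _ _ I).
Qed.

Theorem theorem3p10 (R : realType) (X : completeNormedModType R[i])
    (L : lieAlgType R[i]) (rho : representation L X) (Lsol : lie_solvable L) :
  let compact_nonvoid_projection
      (S : forall L' : lieAlgType R[i],
             representation L' X -> set 'Hom(L', R[i]^o)) :=
    [/\ compact (S L rho),
        ~ finite_dimensional X -> S L rho !=set0 &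
        projection_property S rho] in
  [/\ compact_nonvoid_projection sp_e,
      forall k : nat, (k <= \dim {:L})%N ->
        compact_nonvoid_projection (sp_delta_e k) &
      forall k : nat, (k <= \dim {:L})%N ->
        compact_nonvoid_projection (sp_pi_e k)].
Proof.
have props (S : forall L' : lieAlgType R[i], representation L' X -> set 'Hom(L', R[i]^o))
    low k : S L rho = singular low k rho ->
    (forall I, S _ (rep_restrict rho I) = singular low k (rep_restrict rho I)) ->
    [/\ compact (S L rho), ~ finite_dimensional X -> S L rho !=set0 &
        projection_property S rho].
  move=> SL SI; split; rewrite ?SL; first exact: singular_compact.
    exact: singular_nonempty.
  by move=> I IP; rewrite SL SI; exact: singular_projection.
split=> [|k _|k _].
- apply: (props _ true (\dim {:L})) => [|I]; first exact: sp_eE.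
  by apply: sp_eE; rewrite dimvf /dim /=; exact: dimvS (subvf _).
- by apply: (props _ true k) => [|I]; exact: sp_deltaE.
by apply: (props _ false k) => [|I]; exact: sp_piE.
Qed.
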